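(* Let $d\ge3$, and let $V(x,\omega)=\mathbb V(\tau_x\omega)$ be the mean-zero stationary random potential described in the context. Assume that $V$ is a zero-mean Gaussian random field whose auto-covariance function $R(x)=\mathbb E\{V(0)V(x)\}$ satisfies $R(x)\sim|x|^{-\beta}$ as $|x|\to\infty$ for some $\beta\in(2,d)$. Let $f\in C_c^\infty(\mathbb R^d)$, let $$u_\varepsilon(t,x)=\mathbb E_B\Big\{f(x+B_t)\exp\Big(\frac{i}{\varepsilon}\int_0^tV\Big(\frac{x+B_s}{\varepsilon}\Big)ds\Big)\Big\}$$ be the Feynman-Kac solution of $\partial_tu_\varepsilon=\frac12\Delta u_\varepsilon+\frac{i}{\varepsilon}V(\frac{x}{\varepsilon})u_\varepsilon$, $u_\varepsilon(0,\cdot)=f$, and let $u_{hom}(t,x)=e^{-\sigma^2t/2}\mathbb E_B\{f(x+B_t)\}$ be the solution of $\partial_tu_{hom}=\frac12\Delta u_{hom}-\frac12\sigma^2u_{hom}$, $u_{hom}(0,\cdot)=f$, where $\sigma^2=\frac{4}{(2\pi)^d}\int_{\mathbb R^d}\hat R(\xi)|\xi|^{-2}d\xi$ (which is finite). Then there is a constant $C_{d,f,\beta}$, depending only on $d$, $f$ and $\beta$, such that for all $t>0$, $x\in\mathbb R^d$ and $\varepsilon\in(0,\frac12]$: (i) if $d=3$ or $d=4$, $\ \mathbb E\{|u_\varepsilon(t,x)-u_{hom}(t,x)|\}\le(1+t)\,C_{d,f,\beta}\,\varepsilon^{\frac\beta2-1}$; (ii) if $d>4$, $$\mathbb E\{|u_\varepsilon(t,x)-u_{hom}(t,x)|\}\le(1+t)\,C_{d,f,\beta}\,\begin{cases}\varepsilon^{\frac\beta2-1}&\beta\in(2,4),\\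 \varepsilon\sqrt{|\log\varepsilon|}&\beta=4,\\ \varepsilon&\beta\in(4,d).\end{cases}$$
   Context: Random medium: $(\Omega,\mathcal F,\mathbb P)$ is a probability space with a group $\{\tau_x\}_{x\in\mathbb R^d}$ of measure-preserving transformations acting ergodically (as usual, $(x,\omega)\mapsto\tau_x\omega$ is jointly measurable). $\mathbb V\in L^2(\Omega)$ is real-valued with mean zero, and $V(x)=\mathbb V(\tau_x\omega)$. $T_xg(\omega)=g(\tau_x\omega)$ is assumed strongly continuous on $L^2(\Omega)$. $\hat R\ge0$ is the power spectrum (assumed to exist as a density): $R(x)=(2\pi)^{-d}\int e^{i\xi\cdot x}\hat R(\xi)d\xi$. $a(x)\sim b(x)$ means $a(x)/b(x)\to1$. $B$ is a standard $d$-dimensional Brownian motion started at $0$, independent of $V$; $\mathbb E_B$ is expectation with respect to $B$ only and $\mathbb E$ is expectation with respect to $V$ only.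
   Formalization: The constant C is allowed to depend on the auto-covariance function R (and its power spectrum) besides d, f and β; a constant depending only on d, f and β, uniform over all R with R(x)~|x|^{-β}, does not exist. *)

(* Defs.v *)
From HB Require Import structures.
From mathcomp Require Import all_boot all_order all_algebra.
From mathcomp Require Import all_classical all_reals all_analysis.
From mathcomp Require Import complex.

Set Implicit Arguments.
Unset Strict Implicit.
Unset Printing Implicit Defensive.

Import Order.TTheory GRing.Theory Num.Theory.
Import numFieldNormedType.Exports.

Local Open Scope classical_set_scope.
Local Open Scope ring_scope.
Local Open Scope complex_scope.

(* Row vectors carry the product sigma-algebra, which on R^n is the Borel one. *)
Fact rV_display : measure_display -> measure_display.
Proof. exact. Qed.

Section measurable_rV.
Context {d : measure_display} {T : measurableType d}.
Variable n : nat.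

Let coor : 'I_n -> 'rV[T]_n -> T := fun i x => x ord0 i.

Let rV_set0 : g_sigma_preimage coor set0.
Proof. exact: sigma_algebra0. Qed.

Let rV_setC A : g_sigma_preimage coor A -> g_sigma_preimage coor (~` A).
Proof. exact: sigma_algebraC. Qed.

Let rV_bigcup (F : _^nat) : (forall i, g_sigma_preimage coor (F i)) ->
  g_sigma_preimage coor (\bigcup_i (F i)).
Proof. exact: sigma_algebra_bigcup. Qed.

HB.instance Definition _ := @isMeasurable.Build (rV_display d)
  'rV[T]_n (g_sigma_preimage coor) rV_set0 rV_setC rV_bigcup.

End measurable_rV.


Lemma measurable_coord d (T : measurableType d) n (i : 'I_n) :
  measurable_fun [set: 'rV[T]_n] (fun x : 'rV[T]_n => x ord0 i).
Proof.
move=> _ Y mY; rewrite setTI; apply: sub_sigma_algebra => /=.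
rewrite -bigcup_seq/=; exists i => /=; first by rewrite mem_index_enum.
by exists Y => //; rewrite setTI.
Qed.

Lemma measurable_fun_rVP d1 d2 (T1 : measurableType d1)
    (T2 : measurableType d2) n (f : T1 -> 'rV[T2]_n) :
  (forall i, measurable_fun [set: T1] (fun x => f x ord0 i)) ->
  measurable_fun [set: T1] f.
Proof.
move=> mf.
have sub : g_sigma_preimage (fun i => (fun x : 'rV[T2]_n => x ord0 i) \o f)
    `<=` measurable.
  apply: smallest_sub; first exact: sigma_algebra_measurable.
  case: n => [|n] in f mf *; first by rewrite big_ord0.
  rewrite -bigcup_mkord_ord; apply: bigcup_sub => i Ii.
  by move=> A [B mB <-]; exact: mf.
move=> _ A mA; apply: sub.
rewrite (g_sigma_preimage_comp (fun i (x : 'rV[T2]_n) => x ord0 i) f).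
by exists A.
Qed.

Section lebesgue_rV.
Variable R : realType.

Definition rV_cons n (p : R * 'rV[R]_n) : 'rV[R]_n.+1 := row_mx p.1%:M p.2.

Lemma rV_cons0 n (p : R * 'rV[R]_n) : rV_cons p ord0 ord0 = p.1.
Proof. by rewrite mxE; case: splitP => // j; rewrite ord1 mxE eqxx. Qed.

Lemma rV_consS n (p : R * 'rV[R]_n) i :
  rV_cons p ord0 (lift ord0 i) = p.2 ord0 i.
Proof.
rewrite mxE; case: splitP => [j /= j0|k /= [] ik]; first by rewrite ord1 in j0.
by congr (p.2 _ _); exact/val_inj.
Qed.

Lemma measurable_rV_cons n : measurable_fun setT (@rV_cons n).
Proof.
apply: measurable_fun_rVP => i; have [->|] := eqVneq i ord0.
  by under eq_fun do rewrite rV_cons0; exact: measurable_fst.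
rewrite eq_sym => /unlift_some[j -> _]; under eq_fun do rewrite rV_consS.
apply: (measurableT_comp (@measurable_coord _ R n j)).
exact: measurable_snd.
Qed.

Section step.
Variables (n : nat) (mu : {sigma_finite_measure set 'rV[R]_n -> \bar R}).

Definition lebesgue_rV_step : set 'rV[R]_n.+1 -> \bar R :=
  pushforward (@lebesgue_measure R \x mu)%E (@rV_cons n).

Let leb := lebesgue_rV_step.

Let leb0 : leb set0 = 0%E.
Proof. by rewrite /leb /lebesgue_rV_step /pushforward preimage_set0 measure0. Qed.

Let leb_ge0 A : (0 <= leb A)%E.
Proof. by rewrite /leb /lebesgue_rV_step /pushforward measure_ge0. Qed.

Let leb_sigma_additive : semi_sigma_additive leb.
Proof.
move=> F mF tF mUF; rewrite /leb /lebesgue_rV_step /pushforward preimage_bigcup.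
have mp A : measurable A -> measurable (@rV_cons n @^-1` A).
  by move=> mA; rewrite -[X in measurable X]setTI; exact: measurable_rV_cons.
apply: measure_semi_sigma_additive => [k||]; first exact: mp.
- apply/trivIsetP => /= i j _ _ ij; rewrite -preimage_setI.
  by move/trivIsetP : tF => /(_ _ _ _ _ ij) ->//; rewrite preimage_set0.
- by rewrite -preimage_bigcup; exact: mp.
Qed.

Let leb_sigma_finite : sigma_finite setT leb.
Proof.
have /sigma_finiteP[F [TF ndF Foo]] := sigma_finiteT (@lebesgue_measure R).
have /sigma_finiteP[G [TG ndG Goo]] := sigma_finiteT mu.
pose tl (x : 'rV[R]_n.+1) : 'rV[R]_n := \row_i x ord0 (lift ord0 i).
have mtl : measurable_fun setT tl.
  apply: measurable_fun_rVP => i; under eq_fun do rewrite mxE.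
  exact: measurable_coord.
exists (fun k => [set x : 'rV[R]_n.+1 | F k (x ord0 ord0)] `&`
                 [set x | G k (tl x)]).
  apply/esym; rewrite -subTset => x _.
  have [i _ Fi] : (\bigcup_i F i) (x ord0 ord0) by rewrite -TF.
  have [j _ Gj] : (\bigcup_i G i) (tl x) by rewrite -TG.
  exists (maxn i j) => //; split => /=.
  - by move: Fi; exact/subsetPset/ndF/leq_maxl.
  - by move: Gj; exact/subsetPset/ndG/leq_maxr.
move=> k; have [mF Fk] := Foo k; have [mG Gk] := Goo k; split.
  apply: measurableI.
    by rewrite -[X in measurable X]setTI; exact: measurable_coord.
  by rewrite -[X in measurable X]setTI; exact: mtl.
rewrite /leb /lebesgue_rV_step /pushforward.
rewrite (_ : _ @^-1` _ = F k `*` G k).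
  by rewrite product_measure1E// lte_mul_pinfty// ge0_fin_numE.
apply/seteqP; split => -[a y] /=; rewrite rV_cons0 /=.
  move=> [Fa]; rewrite (_ : tl _ = y)//.
  by apply/rowP => i; rewrite mxE rV_consS.
move=> [Fa Gy]; split => //; rewrite (_ : tl _ = y)//.
by apply/rowP => i; rewrite mxE rV_consS.
Qed.

HB.instance Definition _ := isMeasure.Build _ _ _ lebesgue_rV_step
  leb0 leb_ge0 leb_sigma_additive.
HB.instance Definition _ := @Measure_isSigmaFinite.Build _ _ _ lebesgue_rV_step
  leb_sigma_finite.

End step.

Fixpoint lebesgue_rV (n : nat) : {sigma_finite_measure set 'rV[R]_n -> \bar R} :=
  if n is n'.+1 then lebesgue_rV_step (lebesgue_rV n') else \d_(0 : 'rV[R]_0).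

Lemma lebesgue_rV_box n (A : 'I_n -> set R) : (forall i, measurable (A i)) ->
  lebesgue_rV n [set x | forall i, A i (x ord0 i)] =
  (\big[*%E/1%E]_(i < n) lebesgue_measure (A i))%E.
Proof.
elim: n A => [|n IH] A mA /=.
  by rewrite big_ord0 diracE mem_set// => -[].
rewrite /lebesgue_rV_step /pushforward big_ord_recl -IH//.
have mB : measurable [set x : 'rV[R]_n | forall i, A (lift ord0 i) (x ord0 i)].
  rewrite (_ : [set _ | _] = \bigcap_(i in [set: 'I_n])
      (fun x : 'rV[R]_n => x ord0 i) @^-1` A (lift ord0 i)); last first.
    by apply/seteqP; split => x /= Ax i => [_|]; exact: Ax.
  apply: fin_bigcap_measurable => // i _.
  by rewrite -[X in measurable X]setTI; exact: measurable_coord.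
rewrite -product_measure1E//; last exact: mA.
rewrite [X in _ X = _](_ : _ = A ord0 `*`
  [set x : 'rV[R]_n | forall i, A (lift ord0 i) (x ord0 i)])//.
apply/seteqP; split => -[a y] /=.
  move=> Aay; split; first by have := Aay ord0; rewrite rV_cons0.
  by move=> i; have := Aay (lift ord0 i); rewrite rV_consS.
move=> [Aa Ay] i; have [->|] := eqVneq i ord0; first by rewrite rV_cons0.
by rewrite eq_sym => /unlift_some[j -> _]; rewrite rV_consS; exact: Ay.
Qed.

End lebesgue_rV.

Section euclidean.
Variables (R : realType) (d : nat).
Implicit Types (x y : 'rV[R]_d) (g a b : 'rV[R]_d -> R).

Definition dot x y : R := \sum_(i < d) x ord0 i * y ord0 i.

(* The library norm on 'rV[R]_d is the sup norm; |x| here is Euclidean. *)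
Definition enorm x : R := Num.sqrt (dot x x).

Definition enorm_infty : set_system 'rV[R]_d :=
  [set A | exists M, forall x, M < enorm x -> A x].

Definition asymp_infty a b := a x / b x @[x --> enorm_infty] --> (1 : R).

Definition partial (i : 'I_d) g : 'rV[R]_d -> R :=
  fun x => 'D_(delta_mx ord0 i) g x.

Definition smooth g := forall s : seq 'I_d,
  continuous (foldr partial g s) /\
  forall i x, derivable (foldr partial g s) x (delta_mx ord0 i).

Definition Cc_infty (f : 'rV[R]_d -> R[i]) :=
  [/\ smooth (fun x => complex.Re (f x)),
      smooth (fun x => complex.Im (f x)) &
      compact (closure [set x | f x != 0])].

End euclidean.

Definition expi (R : realType) (t : R) : R[i] := cos t +i* sin t.

Definition integralC d (T : measurableType d) (R : realType)
    (mu : {measure set T -> \bar R}) (F : T -> R[i]) : R[i] :=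
  (\int[mu]_x complex.Re (F x))%R +i* (\int[mu]_x complex.Im (F x))%R.

Section random_medium.
Context (R : realType) (n : nat) (d : measure_display) (T : measurableType d).
Variable P : probability T R.

(* normal_prob m 0 is not a point mass in the library, whence the case s = 0. *)
Definition normal_law (m s : R) (X : T -> R) :=
  measurable_fun setT X /\ forall A : set R, measurable A ->
    P (X @^-1` A) = if s == 0 then \d_m A else normal_prob m s A.

Definition mutually_independent (I : finType) d' (T' : measurableType d')
    (X : I -> T -> T') :=
  forall A : I -> set T', (forall i, measurable (A i)) ->
    P (\bigcap_i (X i @^-1` A i)) =
    (\big[*%E/1%E]_(i : I) P (X i @^-1` A i))%E.

Definition gaussian_field (V : 'rV[R]_n -> T -> R) :=
  forall (k : nat) (x : 'I_k -> 'rV[R]_n) (a : 'I_k -> R),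
    exists m s, normal_law m s (fun w => \sum_(i < k) a i * V (x i) w).

Record ergodic_action (tau : 'rV[R]_n -> T -> T) : Prop := {
  action0 : forall w, tau 0 w = w ;
  actionD : forall x y w, tau (x + y) w = tau x (tau y w) ;
  action_measurable :
    measurable_fun setT (fun p : 'rV[R]_n * T => tau p.1 p.2) ;
  action_preserving :
    forall x (A : set T), measurable A -> P (tau x @^-1` A) = P A ;
  action_ergodic : forall A : set T, measurable A ->
    (forall x, tau x @^-1` A = A) -> P A = 0%E \/ P A = 1%E }.

Definition strongly_continuous_L2 (tau : 'rV[R]_n -> T -> T) :=
  forall g : T -> R, g \in Lfun P 2%:E -> forall x0,
    (fun x => Lnorm P 2%:E (fun w => (g (tau x w) - g (tau x0 w))%:E)) @ x0
      --> 0%E.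

Definition stationary_field (tau : 'rV[R]_n -> T -> T) (VV : T -> R)
  : 'rV[R]_n -> T -> R := fun x w => VV (tau x w).

End random_medium.

Definition power_spectrum (R : realType) (n : nat)
    (cov spec : 'rV[R]_n -> R) :=
  [/\ forall xi, 0 <= spec xi,
      (lebesgue_rV R n).-integrable setT (EFin \o spec) &
      forall x, (cov x)%:C = (((2 * pi) ^- n)%:C *
        integralC (lebesgue_rV R n) (fun xi => expi (dot xi x) * (spec xi)%:C))].

Definition sigma2 (R : realType) (n : nat) (spec : 'rV[R]_n -> R) : R :=
  4 / (2 * pi) ^+ n * (\int[lebesgue_rV R n]_xi (spec xi / enorm xi ^+ 2))%R.

Record standard_brownian (R : realType) (n : nat) (d : measure_display)
    (T : measurableType d) (P : probability T R) (B : R -> T -> 'rV[R]_n)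
    : Prop := {
  brownian_measurable : forall t, 0 <= t -> measurable_fun setT (B t) ;
  brownian0 : forall b, B 0 b = 0 ;
  brownian_continuous :
    forall b, {within [set t | 0 <= t], continuous (fun t => B t b)} ;
  brownian_independent : forall (k : nat) (t : nat -> R), 0 <= t 0%N ->
    {homo t : i j / (i <= j)%N >-> i <= j} ->
    mutually_independent P (fun (i : 'I_k) b => B (t i.+1) b - B (t i) b) ;
  brownian_coords : forall s t, 0 <= s <= t ->
    mutually_independent P (fun (j : 'I_n) b => (B t b - B s b) ord0 j) ;
  brownian_normal : forall s t (j : 'I_n), 0 <= s <= t ->
    normal_law P 0 (Num.sqrt (t - s)) (fun b => (B t b - B s b) ord0 j) }.

Section solutions.
Context (R : realType) (n : nat) (d : measure_display) (T : measurableType d).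
Variables (PB : probability T R) (B : R -> T -> 'rV[R]_n).
Variable f : 'rV[R]_n -> R[i].

(* V is a realization of the potential: B lives on its own probability space,
   so the expectation over B is taken with the medium frozen. *)
Definition u_eps (V : 'rV[R]_n -> R) (eps t : R) (x : 'rV[R]_n) : R[i] :=
  integralC PB (fun b => f (x + B t b) *
    expi (eps^-1 *
      (\int[lebesgue_measure]_(s in `[0, t]) V (eps^-1 *: (x + B s b)))%R)).

Definition u_hom (sig2 t : R) (x : 'rV[R]_n) : R[i] :=
  (expR (- sig2 * t / 2))%:C * integralC PB (fun b => f (x + B t b)).

End solutions.

Definition rate_low (R : realType) (beta eps : R) : R := eps `^ (beta / 2 - 1).

Definition rate_high (R : realType) (beta eps : R) : R :=
  if beta < 4 then eps `^ (beta / 2 - 1)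
  else if beta == 4 then eps * Num.sqrt `|ln eps|
  else eps.

(* Main.v *)
(* Let X = e^-1 int_0^t V(e^-1 (x + B_s)) ds be the random phase in the Feynman-Kac formula.
   Given the path B, X is Gaussian under P with variance Q, so E_P cos X = exp (- Q / 2), and Q
   concentrates under E_B around sigma2 * t. The error is a sum of four terms
   D = E_B[g (cos X - exp (- sigma2 t / 2))] or E_B[g sin X] with g bounded. Doubling the path,
   E_P D^2 is an average over two independent paths, and the Gaussian formula bounds it by
   E_B (Q - sigma2 t)^2 and E_BB |C|, where C is the covariance of the phases of the two paths.
   Both are controlled by a single profile: cov is dominated by a product of one dimensional
   profiles (1 + |x_i|)^(- beta / n), each integrable near the origin because beta < n, so that
   E |cov (e^-1 (y + N (0, s)))| <= K (1 + s / e^2)^(- beta / 2) uniformly in y. Independence of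
   the increments of B makes disjoint increments uncorrelated, and overlapping or nested ones
   leave a product of two profiles. Everything is then O((1 + t) int_0^t (1 + s / e^2)^(1 - beta / 2) ds),
   whose size is the square of the rate, with the three regimes beta < 4, beta = 4, beta > 4. *)
Require Import Defs.
From HB Require Import structures.
From mathcomp Require Import all_boot all_order all_algebra.
From mathcomp Require Import all_classical all_reals all_analysis.
From mathcomp Require Import measurable_realfun complex.
From mathcomp Require Import ring lra.

Set Implicit Arguments.
Unset Strict Implicit.
Unset Printing Implicit Defensive.

Import Order.TTheory GRing.Theory Num.Theory.
Import numFieldNormedType.Exports.

Local Open Scope classical_set_scope.
Local Open Scope ring_scope.

(** * Bounded measurable functions under probability measures *)

(** The doubled path yields the square of the rate because the Gaussian formula factors. Put A = exp
    (- Q / 2), B = exp (- Q' / 2) and k = exp (- sigma2 t / 2): up to an error |C| the two-path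
    correlation is (A - k)(B - k), and each factor is Lipschitz in its phase variance. The
    uniformity in y of the profile bound is what tames dependent increments: one increment is
    averaged while all the others are frozen into y. A factor that may be averaged over either of
    two increments satisfies two bounds at once, hence a bound by the profile at the sum of both
    lengths. Averaging that over time raises the exponent from - beta / 2 to 1 - beta / 2; beta > 2
    makes the profile integrable, so that only one such loss occurs. The obstacle on the
    probabilistic side is that Gaussianity concerns finite linear combinations only, while the field
    is unbounded along a path. The formula for X is therefore obtained from step functions in time,
    with an L2 error controlled by the continuity of cov, and time integrals are split only for
    almost every medium. *)

Section bounded_measurable.
Context d (T : measurableType d) (R : realType).
Implicit Types f g : T -> R.

(** Unlike integrability, this is closed under products and composition, and against a probability
    measure it suffices for linearity, monotonicity and Fubini. *)
Definition bm f := measurable_fun setT f /\ exists M, forall x, `|f x| <= M.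

Lemma bm_measurable f : bm f -> measurable_fun setT f.
Proof. by case. Qed.

Lemma bm_cst (c : R) : bm (fun=> c).
Proof. by split => //; exists `|c|. Qed.

Lemma bmD f g : bm f -> bm g -> bm (fun x => f x + g x).
Proof.
move=> [mf [M fM]] [mg [N gN]]; split; first exact: measurable_funD.
by exists (M + N) => x; rewrite (le_trans (ler_normD _ _))// lerD.
Qed.

Lemma bmN f : bm f -> bm (fun x => - f x).
Proof.
move=> [mf [M fM]]; split; first exact: measurableT_comp.
by exists M => x; rewrite normrN.
Qed.

Lemma bmB f g : bm f -> bm g -> bm (fun x => f x - g x).
Proof. by move=> bf bg; apply: bmD => //; exact: bmN. Qed.

Lemma bmM f g : bm f -> bm g -> bm (fun x => f x * g x).
Proof.
move=> [mf [M fM]] [mg [N gN]]; split; first exact: measurable_funM.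
by exists (M * N) => x; rewrite normrM ler_pM.
Qed.

Lemma bm_sqr f : bm f -> bm (fun x => f x ^+ 2).
Proof.
move=> bf; rewrite (_ : (fun _ => _) = (fun x => f x * f x)).
  exact: bmM.
by apply/funext => x; rewrite expr2.
Qed.

Lemma bm_norm f : bm f -> bm (fun x => `|f x|).
Proof.
move=> [mf [M fM]]; split; first exact: measurableT_comp.
by exists M => x; rewrite normr_id.
Qed.

Lemma bm_indic (A : set T) : measurable A -> bm (\1_A : T -> R).
Proof.
move=> mA; split; first exact: measurable_indic.
by exists 1 => x; rewrite indicE; case: (_ \in _); rewrite /= ?normr1 ?normr0 ?ler01.
Qed.

Lemma ge0_bm f M : measurable_fun setT f -> (forall x, 0 <= f x <= M) -> bm f.
Proof.
by move=> mf f0; split => //; exists M => x; have /andP[? ?] := f0 x; rewrite ger0_norm.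
Qed.

Lemma bm_cos f : measurable_fun setT f -> bm (fun x => cos (f x)).
Proof.
move=> mf; split.
  apply: measurableT_comp mf; apply: continuous_measurable_fun.
  exact: continuous_cos.
by exists 1 => x; rewrite ler_norml cos_geN1 cos_le1.
Qed.

Lemma bm_sin f : measurable_fun setT f -> bm (fun x => sin (f x)).
Proof.
move=> mf; split.
  apply: measurableT_comp mf; apply: continuous_measurable_fun.
  exact: continuous_sin.
by exists 1 => x; rewrite ler_norml sin_geN1 sin_le1.
Qed.

End bounded_measurable.

Lemma bm_comp d d' (T : measurableType d) (T' : measurableType d') (R : realType)
  (f : T' -> R) (g : T -> T') :
  bm f -> measurable_fun setT g -> bm (fun x => f (g x)).
Proof.
move=> [mf [M fM]] mg; split; first exact: (measurableT_comp mf mg).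
by exists M.
Qed.

Section bounded_integral.
Context d (T : measurableType d) (R : realType) (P : probability T R).
Implicit Types f g : T -> R.

Lemma bm_integrable f : bm f -> P.-integrable setT (EFin \o f).
Proof.
move=> [mf [M fM]]; apply: measurable_bounded_integrable => //.
  exact: fin_num_fun_lty.
exists M; split; first by rewrite num_real.
by move=> N MN x _; rewrite /= (le_trans (fM x))// ltW.
Qed.

Lemma EFin_Rint f : P.-integrable setT (EFin \o f) ->
  (\int[P]_x f x)%:E = (\int[P]_x (f x)%:E)%E.
Proof. by move=> fi; rewrite /Rintegral fineK//; exact: integrable_fin_num. Qed.

Lemma Rint_cst c : (\int[P]_x c)%R = c :> R.
Proof.
rewrite Rintegral_cst//; by have /= -> := @probability_setT _ _ _ P; rewrite mulr1. Qed.

Lemma RintD f g : bm f -> bm g ->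
  \int[P]_x (f x + g x) = \int[P]_x f x + \int[P]_x g x.
Proof. by move=> bf bg; rewrite RintegralD//; exact: bm_integrable. Qed.

Lemma RintB f g : bm f -> bm g ->
  \int[P]_x (f x - g x) = \int[P]_x f x - \int[P]_x g x.
Proof. by move=> bf bg; rewrite RintegralB//; exact: bm_integrable. Qed.

Lemma RintZl c f : bm f -> \int[P]_x (c * f x) = c * \int[P]_x f x.
Proof. by move=> bf; rewrite RintegralZl//; exact: bm_integrable. Qed.

Lemma RintZr c f : bm f -> \int[P]_x (f x * c) = (\int[P]_x f x) * c.
Proof. by move=> bf; rewrite RintegralZr//; exact: bm_integrable. Qed.

Lemma le_Rint f g : bm f -> bm g -> (forall x, f x <= g x) ->
  \int[P]_x f x <= \int[P]_x g x.
Proof. by move=> bf bg fg; apply: le_Rintegral => //; exact: bm_integrable. Qed.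

Lemma norm_Rint f : bm f -> `|\int[P]_x f x| <= \int[P]_x `|f x|.
Proof. by move=> bf; apply: le_normr_Rintegral => //; exact: bm_integrable. Qed.

Lemma Rint_le_cst f M : bm f -> (forall x, f x <= M) -> \int[P]_x f x <= M.
Proof. by move=> bf fM; rewrite -[leRHS](Rint_cst M) le_Rint//; exact: bm_cst. Qed.

Lemma norm_Rint_le f g : bm f -> bm g -> (forall x, `|f x| <= g x) ->
  `|\int[P]_x f x| <= \int[P]_x g x.
Proof.
move=> bf bg fg; apply: le_trans (norm_Rint bf) _.
by apply: le_Rint => //; exact: bm_norm.
Qed.

Lemma norm_Rint_cst f M : bm f -> (forall x, `|f x| <= M) -> `|\int[P]_x f x| <= M.
Proof. by move=> bf fM; rewrite -[leRHS](Rint_cst M) norm_Rint_le//; exact: bm_cst. Qed.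

Lemma eq_Rint f g : f =1 g -> \int[P]_x f x = \int[P]_x g x.
Proof. by move=> fg; apply: eq_Rintegral => x _; exact: fg. Qed.

(* AM-GM form of the Cauchy-Schwarz inequality [(E|f|)^2 <= E f^2]. *)
Lemma mean_norm_le_sqr f v : bm f -> 0 < v -> \int[P]_x f x ^+ 2 <= v ^+ 2 ->
  \int[P]_x `|f x| <= v.
Proof.
move=> bf v0 fv.
apply: (@le_trans _ _ (\int[P]_x ((2 * v)^-1 * f x ^+ 2 + v / 2))).
  apply: le_Rint => [|| x]; first exact: bm_norm.
    by apply: bmD; [apply: bmM; [exact: bm_cst|exact: bm_sqr]|exact: bm_cst].
  rewrite -(ler_pM2l (_ : 0 < 2 * v)) ?mulr_gt0// mulrDr mulrA divff ?mulf_neq0 ?gt_eqF//.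
  rewrite -(real_normK (num_real (f x))).
  have := sqr_ge0 (`|f x| - v); nra.
rewrite RintD; [|by apply: bmM; [exact: bm_cst|exact: bm_sqr]|exact: bm_cst].
rewrite RintZl; last exact: bm_sqr.
rewrite Rint_cst -lerBrDr -(ler_pM2l (_ : 0 < 2 * v)) ?mulr_gt0//.
rewrite mulrA divff ?mulf_neq0 ?gt_eqF// mul1r (le_trans fv)//; nra.
Qed.

End bounded_integral.

Section bounded_fubini.
Context d1 d2 (T1 : measurableType d1) (T2 : measurableType d2) (R : realType).
Variables (P1 : probability T1 R) (P2 : probability T2 R).
Implicit Types f : T1 * T2 -> R.

Lemma bm_slice f x : bm f -> bm (fun y => f (x, y)).
Proof. by move=> bf; apply: (bm_comp bf); exact: pair1_measurable. Qed.

Lemma bm_slice2 f y : bm f -> bm (fun x => f (x, y)).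
Proof. by move=> bf; apply: (bm_comp bf); exact: pair2_measurable. Qed.

Lemma bm_swap f : bm f -> bm (fun z : T2 * T1 => f (z.2, z.1)).
Proof.
move=> bf; apply: (bm_comp bf).
by apply: measurable_fun_pair; [exact: measurable_snd|exact: measurable_fst].
Qed.

Lemma bm_Rint f : bm f -> bm (fun x => \int[P2]_y f (x, y)).
Proof.
move=> bf; split; last first.
  have [_ [M fM]] := bf; exists M => x; apply: norm_Rint_cst => //.
  exact: bm_slice.
have mF : measurable_fun setT (fun x => (\int[P2]_y (f (x, y))%:E)%E).
  apply: (@measurable_fubini_F _ _ _ _ _ P1 P2 (EFin \o f)).
  exact/(@bm_integrable _ _ _ (P1 \x P2)%E).
apply/measurable_EFinP.
rewrite (_ : _ \o _ = fun x => (\int[P2]_y (f (x, y))%:E)%E)//.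
apply/funext => x /=; rewrite EFin_Rint//; apply: bm_integrable; exact: bm_slice.
Qed.

Lemma Rint_prod f : bm f ->
  \int[(P1 \x P2)%E]_z f z = \int[P1]_x \int[P2]_y f (x, y).
Proof.
move=> bf; rewrite {1}/Rintegral -(@integral12_prod_meas1 _ _ _ _ _ _ _ (EFin \o f)).
  congr fine; apply: eq_integral => x _.
  by rewrite /fubini_F EFin_Rint//; apply: bm_integrable; exact: bm_slice.
exact/(@bm_integrable _ _ _ (P1 \x P2)%E).
Qed.

End bounded_fubini.

Section bounded_fubini_swap.
Context d1 d2 (T1 : measurableType d1) (T2 : measurableType d2) (R : realType).
Variables (P1 : probability T1 R) (P2 : probability T2 R).
Implicit Types f : T1 * T2 -> R.

Lemma Rint_swap f : bm f ->
  \int[P1]_x \int[P2]_y f (x, y) = \int[P2]_y \int[P1]_x f (x, y).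
Proof.
move=> bf; rewrite -Rint_prod// {1}/Rintegral.
rewrite -(@integral21_prod_meas1 _ _ _ _ _ _ _ (EFin \o f)).
  congr fine; apply: eq_integral => x _.
  by rewrite /fubini_G EFin_Rint//; apply: bm_integrable; exact: bm_slice2.
exact/(@bm_integrable _ _ _ (P1 \x P2)%E).
Qed.

Lemma bm_Rint2 f : bm f -> bm (fun y => \int[P1]_x f (x, y)).
Proof. by move=> bf; have := bm_Rint P2 P1 (bm_swap bf). Qed.

Lemma Rint_prod_swap f : bm f ->
  \int[(P1 \x P2)%E]_z f z = \int[(P2 \x P1)%E]_z f (z.2, z.1).
Proof.
by move=> bf; rewrite !Rint_prod//; [exact: Rint_swap|exact: bm_swap].
Qed.

Lemma Rint_prod_fst (f : T1 -> R) : bm f ->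
  \int[(P1 \x P2)%E]_z f z.1 = \int[P1]_x f x.
Proof.
move=> bf; rewrite Rint_prod/=; last by apply: (bm_comp bf).
by apply: eq_Rint => x; rewrite Rint_cst.
Qed.

Lemma Rint_prod_snd (f : T2 -> R) : bm f ->
  \int[(P1 \x P2)%E]_z f z.2 = \int[P2]_x f x.
Proof.
move=> bf; rewrite Rint_prod/=; last by apply: (bm_comp bf).
by rewrite Rint_cst.
Qed.

Lemma Rint_outer (f : T1 -> R) (g : T2 -> R) : bm f -> bm g ->
  \int[(P1 \x P2)%E]_z (f z.1 * g z.2) = (\int[P1]_x f x) * \int[P2]_y g y.
Proof.
move=> bf bg; rewrite Rint_prod/=; last first.
  by apply: bmM; [exact: (bm_comp bf)|exact: (bm_comp bg)].
by under eq_Rint do rewrite RintZl//; rewrite RintZr.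
Qed.

End bounded_fubini_swap.

(** The doubling trick: the square of an average over [mu] is an average over two independent
    copies, and Fubini moves the expectation over [P] inside, where only pair correlations remain.
    It serves twice, for two paths and for two pairs of times. *)
Lemma second_moment d1 d2 (T : measurableType d1) (W : measurableType d2)
    (R : realType) (mu : probability T R) (P : probability W R)
    (F : T * W -> R) : bm F ->
  \int[P]_w (\int[mu]_x F (x, w)) ^+ 2 =
  \int[(mu \x mu)%E]_z \int[P]_w (F (z.1, w) * F (z.2, w)).
Proof.
move=> bF.
have mp (g : W * (T * T) -> T) : measurable_fun setT g ->
    bm (fun z : W * (T * T) => F (g z, z.1)).
  move=> mg; apply: (bm_comp bF); apply: measurable_fun_pair => //.
have b1 : bm (fun z : W * (T * T) => F (z.2.1, z.1) * F (z.2.2, z.1)).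
  by apply: bmM; apply: mp; apply: measurableT_comp.
have := Rint_swap P (mu \x mu)%E b1 => /= <-; apply: eq_Rint => w.
rewrite (@Rint_outer _ _ _ _ _ mu mu (fun x => F (x, w)) (fun x => F (x, w))) ?expr2//; exact: bm_slice2.
Qed.

Lemma Rint_pushforward d1 d2 (T : measurableType d1) (W : measurableType d2)
    (R : realType) (P : probability T R) (Q : probability W R) (X : T -> W)
    (f : W -> R) : measurable_fun setT X ->
  (forall A, measurable A -> P (X @^-1` A) = Q A) ->
  bm f -> \int[P]_x f (X x) = \int[Q]_y f y.
Proof.
move=> mX XQ bf; rewrite /Rintegral; congr fine.
have -> : (\int[Q]_y (f y)%:E = \int[pushforward P X]_y (f y)%:E)%E.
  by apply: eq_measure_integral => A mA _; rewrite /pushforward; exact/esym/XQ.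
rewrite (@integral_pushforward _ _ _ _ _ _ mX P setT (EFin \o f))//.
- exact/measurable_EFinP/bm_measurable.
- apply: bm_integrable; exact: (bm_comp bf).
Qed.

Lemma cvg_Rint d (T : measurableType d) (R : realType) (P : probability T R)
    (f_ : nat -> T -> R) (f : T -> R) (M : R) :
  (forall k, measurable_fun setT (f_ k)) ->
  (forall k x, `|f_ k x| <= M) ->
  (forall x, f_ k x @[k --> \oo] --> f x) ->
  \int[P]_x f_ k x @[k --> \oo] --> \int[P]_x f x.
Proof.
move=> mf fM cf.
have b_ k : bm (f_ k) by split => //; exists M.
have mlim : measurable_fun setT f.
  by apply: (measurable_fun_cvg mf) => x _; exact: cf.
have bf : bm f.
  split => //; exists M => x.
  rewrite -(cvg_lim (@Rhausdorff R) (cvg_norm (cf x))); apply: limr_le.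
    by apply/cvg_ex; exists `|f x|; exact: cvg_norm.
  by near=> k; exact: fM.
have : (\int[P]_x (f_ k x)%:E)%E @[k --> \oo] --> (\int[P]_x (f x)%:E)%E.
  apply: (@dominated_cvg _ _ _ P setT measurableT _ _ (cst M%:E)) => //.
  - by move=> k; exact/measurable_EFinP.
  - by move=> x _; apply: cvg_EFin; [near=> k|exact: cf].
  - by apply/finite_measure_integrable_cst.
  - by move=> k x _; rewrite /= lee_fin.
by rewrite -(EFin_Rint (bm_integrable P bf)) => /fine_cvgP[_].
Unshelve. all: by end_near.
Qed.

(** * Lebesgue integrals: translations, densities, integrals of derivatives *)

Section lebesgue_shift.
Context (R : realType) (a : R).
Let shift (x : measurableTypeR R) : measurableTypeR R := x + a.
Let measurable_shift : measurable_fun setT shift.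
Proof. exact: measurable_funD. Qed.
HB.instance Definition _ :=
  isMeasurableFun.Build _ _ _ _ shift measurable_shift.

Lemma pushforward_shift_lebesgue (A : set R) : measurable A ->
  pushforward lebesgue_measure shift A = lebesgue_measure A.
Proof.
move=> mA; apply/esym/lebesgue_measure_unique => //= _ [[b c]] _ <-.
rewrite /pushforward (_ : _ @^-1` _ = `]b - a, c - a]%classic); last first.
  by apply/seteqP; split => x /=; rewrite !in_itv/= ltrBlDr lerBrDr.
rewrite !lebesgue_measure_itv/= !lte_fin ltrD2r -!EFinB.
by rewrite (_ : c - a - (b - a) = c - b)//; ring.
Qed.

Lemma ge0_integral_shift (f : R -> \bar R) :
  measurable_fun setT f -> (forall x, (0 <= f x)%E) ->
  (\int[@lebesgue_measure R]_x f (x + a)%R = \int[lebesgue_measure]_x f x)%E.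
Proof.
move=> mf f0; rewrite -(preimage_setT shift).
rewrite -(@ge0_integral_pushforward _ _ _ _ R _ measurable_shift (@lebesgue_measure R) setT f)//.
apply: eq_measure_integral => A mA _; exact: pushforward_shift_lebesgue.
Qed.

End lebesgue_shift.

Section density.
Context d (T : measurableType d) (R : realType).
Variables (mu : {measure set T -> \bar R}) (nu : {measure set T -> \bar R}) (p : T -> R).
Hypothesis p0 : forall x, 0 <= p x.
Hypothesis mp : measurable_fun setT p.
Hypothesis nuE : forall A, measurable A -> nu A = (\int[mu]_(x in A) (p x)%:E)%E.

Import HBNNSimple.

Let integral_density_nnsfun (f : {nnsfun T >-> R}) :
  (\int[nu]_x (f x)%:E = \int[mu]_x ((f x)%:E * (p x)%:E))%E.
Proof.
under [LHS]eq_integral do rewrite fimfunE -fsumEFin//.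
rewrite [LHS]ge0_integral_fsum//; last 2 first.
  - by move=> r; exact/measurable_EFinP/measurableT_comp.
  - by move=> k x _; rewrite EFinM nnfun_muleindic_ge0.
under [RHS]eq_integral => x _.
  rewrite fimfunE -fsumEFin// ge0_mule_fsuml; last first.
    by move=> r; rewrite EFinM nnfun_muleindic_ge0.
  over.
rewrite [RHS]ge0_integral_fsum//; last 2 first.
  - move=> r; apply/measurable_EFinP; apply: measurable_funM => //.
    exact/measurableT_comp.
  - by move=> r x _; apply: mule_ge0; [rewrite EFinM nnfun_muleindic_ge0|rewrite lee_fin].
apply: eq_fsbigr => r rf.
have r0 : 0 <= r by move: rf; rewrite inE => -[x _ <-].
under eq_integral do rewrite EFinM.
rewrite ge0_integralZl//; last first.
  exact/measurable_EFinP/measurable_indic.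
under [RHS]eq_integral do rewrite EFinM -muleA.
rewrite [RHS]ge0_integralZl//; last 2 first.
  - apply/measurable_EFinP; exact: measurable_funM.
  - by move=> x _; rewrite mule_ge0 ?lee_fin.
congr (_ * _)%E; rewrite integral_indic// setIT nuE//.
rewrite integral_mkcond; apply: eq_integral => x _.
rewrite patchE indicE; case: (x \in _); rewrite ?mul1e ?mul0e//.
Qed.

Lemma ge0_integral_density (f : T -> \bar R) :
  measurable_fun setT f -> (forall x, 0 <= f x)%E ->
  (\int[nu]_x f x = \int[mu]_x (f x * (p x)%:E))%E.
Proof.
move=> mf f0.
pose f_ := nnsfun_approx measurableT mf.
transitivity (lim (\int[nu]_x (f_ n x)%:E @[n --> \oo])%E).
  rewrite -monotone_convergence//=.
  - apply: eq_integral => ? /[!inE] xD; apply/esym/cvg_lim => //=.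
    exact: cvg_nnsfun_approx.
  - by move=> n; exact/measurable_EFinP/measurable_funTS.
  - by move=> n ? _; rewrite lee_fin.
  - by move=> ? _ ? ? mn; rewrite lee_fin; exact/lefP/nd_nnsfun_approx.
rewrite [RHS](_ : _ = lim
    (\int[mu]_x ((f_ n x)%:E * (p x)%:E) @[n --> \oo])%E); last first.
  rewrite -monotone_convergence//=.
  - apply: eq_integral => x /[!inE] xD; apply/esym/cvg_lim => //.
    apply: cvgeZr => //; exact: cvg_nnsfun_approx.
  - move=> n; apply: emeasurable_funM; exact/measurable_EFinP/measurable_funTS.
  - by move=> n x _; rewrite mule_ge0 ?lee_fin.
  - move=> x _ m n mn; rewrite lee_wpmul2r ?lee_fin//; exact/lefP/nd_nnsfun_approx.
by apply: congr_lim; apply/funext => n; rewrite /= integral_density_nnsfun.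
Qed.

(** No integrability is asked: multiplication by [p >= 0] commutes with taking positive and negative
    parts, so each part is transformed separately. *)
Lemma integral_density (f : T -> R) : measurable_fun setT f ->
  (\int[nu]_x (f x)%:E = \int[mu]_x (f x * p x)%:E)%E.
Proof.
move=> mf; have mf' : measurable_fun setT (EFin \o f) by exact/measurable_EFinP.
rewrite integralE [RHS]integralE; congr (_ - _)%E.
  rewrite ge0_integral_density//; last exact: measurable_funepos.
  apply: eq_integral => x _; rewrite funepos.unlock/=.
  by rewrite maxe_pMl ?lee_fin// mul0e.
rewrite ge0_integral_density//; last exact: measurable_funeneg.
apply: eq_integral => x _; rewrite funeneg.unlock/=.
by rewrite maxe_pMl ?lee_fin// mul0e -EFinM mulNr.
Qed.

Lemma integrable_density (f : T -> R) : measurable_fun setT f ->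
  nu.-integrable setT (EFin \o f) <-> mu.-integrable setT (fun x => (f x * p x)%:E).
Proof.
move=> mf.
have e : (\int[nu]_x `|(f x)%:E| = \int[mu]_x `|(f x * p x)%:E|)%E.
  rewrite ge0_integral_density//; last first.
    by apply: measurableT_comp => //; exact/measurable_EFinP.
  by apply: eq_integral => x _; rewrite EFinM abseM (gee0_abs (_ : 0 <= (p x)%:E)%E)// lee_fin.
split=> /integrableP[_ fi]; apply/integrableP; split.
- by apply/measurable_EFinP; exact: measurable_funM.
- by rewrite -e.
- exact/measurable_EFinP.
- by rewrite e.
Qed.

End density.

Lemma integral_derivative0 (R : realType) (F f : R -> R) :
  (forall x : R, is_derive x 1 F (f x)) -> continuous f ->
  (@lebesgue_measure R).-integrable setT (EFin \o f) ->
  F x @[x --> +oo] --> 0 -> F x @[x --> -oo] --> 0 ->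
  (\int[@lebesgue_measure R]_x (f x)%:E = 0)%E.
Proof.
move=> dF cf fi Foo FNoo.
(* The successor keeps the window nondegenerate at [n = 0], where the fundamental theorem needs
   distinct end points. *)
pose A n : set R := `[- n.+1%:R, n.+1%:R]%classic.
pose f_ n x := ((f x)%:E * (\1_(A n) x)%:E)%E.
have I n : (\int[@lebesgue_measure R]_x f_ n x = (F n.+1%:R - F (- n.+1%:R))%:E)%E.
  rewrite (_ : (fun x => _) = (EFin \o f) \_ (A n)); last first.
    apply/funext => x; rewrite /f_ patchE indicE.
    by case: (x \in _); rewrite ?mule1 ?mule0.
  rewrite -integral_mkcond EFinB.
  apply: continuous_FTC2.
  - by rewrite gtrN.
  - exact: continuous_subspaceT.
  - split=> [x _||].
    + by have [] := dF x.
    + apply: cvg_at_right_filter; apply: differentiable_continuous.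
      by apply/derivable1_diffP; have [] := dF (- n.+1%:R).
    + apply: cvg_at_left_filter; apply: differentiable_continuous.
      by apply/derivable1_diffP; have [] := dF n.+1%:R.
  - by move=> x _; rewrite derive1E; exact: derive_val.
have c1 : (\int[@lebesgue_measure R]_x f_ n x)%E @[n --> \oo] -->
    (\int[@lebesgue_measure R]_x (f x)%:E)%E.
  apply: (@dominated_cvg _ _ _ (@lebesgue_measure R) setT measurableT f_ (EFin \o f) (fun x => `|(f x)%:E|%E)) => //.
  - move=> n; apply: emeasurable_funM.
      by apply/measurable_EFinP; apply: continuous_measurable_fun.
    by apply/measurable_EFinP; apply: measurable_indic; exact: measurable_itv.
  - move=> x _; apply: cvg_near_cst.
    near=> n; rewrite /f_ indicE mem_set ?mule1//= /A/= in_itv/=.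
    rewrite -ler_norml; apply: (@le_trans _ _ n%:R); last by rewrite ler_nat.
    by near: n; exact: nbhs_infty_ger.
  - exact: integrable_abse.
  - move=> n x _; rewrite /f_ abseM indicE.
    by case: (x \in A n); rewrite ?abse1 ?abse0 ?mule1 ?mule0.
have c2 : (F n.+1%:R - F (- n.+1%:R))%:E @[n --> \oo] --> (0 - 0)%:E.
  apply: cvg_EFin; first exact: nearW.
  apply: cvgB.
    apply: (cvg_comp (fun n : nat => n.+1%:R) F _ Foo).
    by apply/cvgryPge => M; near=> n; rewrite (@le_trans _ _ n%:R)// ?ler_nat//; near: n; exact: nbhs_infty_ger.
  apply: (cvg_comp (fun n : nat => - n.+1%:R) F _ FNoo).
  apply/cvgrNyPle => M; near=> n; rewrite lerNl (@le_trans _ _ n%:R)// ?ler_nat//; near: n; exact: nbhs_infty_ger.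
rewrite -(cvg_lim _ c1)//; under eq_fun do rewrite I.
by rewrite (cvg_lim _ c2)// subr0.
Unshelve. all: by end_near.
Qed.

Lemma ge0_integral_radial (R : realType) (G : R -> R) :
  continuous G -> (forall u, 0 <= G u) ->
  (\int[@lebesgue_measure R]_x (G `|x|)%:E =
   2%:E * \int[lebesgue_measure]_(x in `[0%R, +oo[) (G x)%:E)%E.
Proof.
move=> cG G0; rewrite ge0_symfun_integralT//.
- congr (_ * _)%E; rewrite -set_itvcy//; apply: eq_integral => x.
  by rewrite inE/= in_itv/= andbT => x0; rewrite ger0_norm.
- move=> x; apply: continuous_comp; first exact: norm_continuous.
  exact: cG.
- by move=> x /=; rewrite normrN.
Qed.

(** * Normal laws *)

Section normal_decay.
Context (R : realType) (m s : R).
Hypothesis s0 : s != 0.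
Local Notation g := (normal_pdf m s).
Local Notation g2 := (normal_pdf m (Num.sqrt 2 * s)).

Let s2_gt0 : 0 < s ^+ 2.
Proof. by rewrite exprn_even_gt0. Qed.

Let r2s0 : Num.sqrt 2 * s != 0.
Proof. by rewrite mulf_neq0// gt_eqF// sqrtr_gt0. Qed.

(** A quadratic factor is absorbed by doubling the variance: with [u = (x - m)^2 / (4 s^2)] the two
    densities decay like [exp (- 2 u)] and [exp (- u)], and [u <= exp u]. *)
Lemma normal_pdf_poly_le : exists K, forall x, (1 + (x - m) ^+ 2) * g x <= K * g2 x.
Proof.
exists ((1 + 4 * s ^+ 2) * (normal_peak s / normal_peak (Num.sqrt 2 * s))) => x.
rewrite /normal_pdf (negbTE s0) (negbTE r2s0) /normal_fun.
have p2 : 0 < normal_peak (Num.sqrt 2 * s) by exact: (normal_peak_gt0 r2s0).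
set u := (x - m) ^+ 2 / (4 * s ^+ 2).
have u0 : 0 <= u by rewrite divr_ge0 ?sqr_ge0// mulr_ge0 ?sqr_ge0.
have e1 : - (x - m) ^+ 2 / (s ^+ 2 *+ 2) = - u + - u.
  rewrite /u; field; rewrite ?s0 ?gt_eqF//.
have e2 : - (x - m) ^+ 2 / ((Num.sqrt 2 * s) ^+ 2 *+ 2) = - u.
  by rewrite exprMn sqr_sqrtr// /u; field; rewrite ?s0 ?gt_eqF//.
have e3 : (x - m) ^+ 2 = 4 * s ^+ 2 * u.
  by rewrite /u; field; rewrite ?s0 ?gt_eqF//.
rewrite e1 e2 e3 expRD mulrA.
rewrite [leRHS](_ : _ = normal_peak s * ((1 + 4 * s ^+ 2) * expR (- u))); last first.
  by field; rewrite ?s0 ?gt_eqF//.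
rewrite mulrACA mulrCA; rewrite [leLHS](_ : _ =
  normal_peak s * ((1 + 4 * s ^+ 2 * u) * expR (- u) * expR (- u))); last by ring.
rewrite ler_wpM2l ?normal_peak_ge0// ler_wpM2r ?expR_ge0//.
rewrite expRN ler_pdivrMr ?expR_gt0//.
have := expR_ge1Dx u.
have := s2_gt0.
nra.
Qed.

Lemma normal_pdf_sqr_bounded : exists D, forall x, (1 + (x - m) ^+ 2) * g x <= D.
Proof.
have [K KP] := normal_pdf_poly_le; exists (`|K| * normal_peak (Num.sqrt 2 * s)) => x.
apply: le_trans (KP x) _; apply: (@le_trans _ _ (`|K| * g2 x)).
  by rewrite ler_wpM2r ?normal_pdf_ge0// ler_norm.
by rewrite ler_wpM2l//; exact: (normal_pdf_ub m x r2s0).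
Qed.

End normal_decay.

Section normal_stein.
Context (R : realType) (m s : R).
Hypothesis s0 : s != 0.
Local Notation g := (normal_pdf m s).
Local Notation g2 := (normal_pdf m (Num.sqrt 2 * s)).

Let s2_gt0 : 0 < s ^+ 2.
Proof. by rewrite exprn_even_gt0. Qed.

Let r2s0 : Num.sqrt 2 * s != 0.
Proof. by rewrite mulf_neq0// gt_eqF// sqrtr_gt0. Qed.

Lemma integrable_poly_normal (h : R -> R) (C : R) : measurable_fun setT h ->
  (forall x, `|h x| <= C * (1 + (x - m) ^+ 2)) ->
  (@lebesgue_measure R).-integrable setT (fun x => (h x * g x)%:E).
Proof.
move=> mh hC; have [K KP] := normal_pdf_poly_le m s0.
have C0 : 0 <= C.
  have := le_trans (normr_ge0 _) (hC m); rewrite subrr expr0n/= addr0 mulr1; exact.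
have i2 : (@lebesgue_measure R).-integrable setT (fun x => ((C * K)%:E * (g2 x)%:E)%E).
  by apply: integrableZl => //; exact: integrable_normal_pdf.
apply: le_integrable i2 => //.
  by apply/measurable_EFinP; apply: measurable_funM => //; exact: measurable_normal_pdf.
move=> x _ /=; rewrite lee_fin normrM (ger0_norm (normal_pdf_ge0 _ _ _)).
rewrite (le_trans _ (ler_norm _))// -mulrA.
apply: (@le_trans _ _ (C * (1 + (x - m) ^+ 2) * g x)).
  by rewrite ler_wpM2r ?normal_pdf_ge0.
by rewrite -mulrA ler_wpM2l.
Qed.

Lemma is_derive_normal_pdf (x : R) : is_derive x 1 g (- ((x - m) / s ^+ 2) * g x).
Proof.
have gE : g = fun x => normal_peak s * normal_fun m s x.
  by rewrite /normal_pdf (negbTE s0).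
rewrite gE /normal_fun.
have d1 : is_derive x 1 (fun x : R => - (x - m) ^+ 2 / (s ^+ 2 *+ 2)) (- ((x - m) / s ^+ 2)).
  apply: is_derive_eq; rewrite /GRing.scale/=; field; rewrite ?s0 ?gt_eqF//.
have d2 := is_derive1_comp (is_derive_expR _) d1.
apply: is_derive_eq; rewrite /GRing.scale/=; ring.
Qed.

Lemma cvg0_sqr_bounded (F : R -> R) (D : R) :
  (forall x, (1 + (x - m) ^+ 2) * `|F x| <= D) ->
  F x @[x --> +oo] --> 0 /\ F x @[x --> -oo] --> 0.
Proof.
move=> FD.
have D0 : 0 <= D by apply: le_trans (FD m); rewrite mulr_ge0 ?addr_ge0 ?sqr_ge0.
have small e x : 0 < e -> D / e < `|x - m| -> `|F x| < e.
  move=> e0; rewrite ltr_pdivrMr// => De.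
  have q0 : 0 < 1 + (x - m) ^+ 2 by rewrite ltr_pwDl ?sqr_ge0.
  rewrite -(ltr_pM2l q0); apply: le_lt_trans (FD x) _.
  apply: lt_le_trans De _; rewrite ler_pM2r// -real_normK ?num_real//.
  have := sqr_ge0 (`|x - m| - 1); have := normr_ge0 (x - m); nra.
split; apply/cvgr0Pnorm_lt => e e0; near=> x; apply: small => //.
- rewrite (lt_le_trans _ (ler_norm _))// ltrBrDr.
  by near: x; apply: nbhs_pinfty_gt; rewrite num_real.
- rewrite distrC (lt_le_trans _ (ler_norm _))// ltrBrDr -ltrBrDl.
  by near: x; apply: nbhs_ninfty_lt; rewrite num_real.
Unshelve. all: by end_near.
Qed.

(** Stein's identity: the integrand is the derivative of [h * g], and the boundary terms vanish
    because [h] grows at most linearly. *)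
Lemma normal_stein (h h' : R -> R) (C : R) :
  (forall x : R, is_derive x 1 h (h' x)) -> continuous h' ->
  (forall x, `|h x| <= C * (1 + `|x - m|)) -> (forall x, `|h' x| <= C) ->
  (\int[@lebesgue_measure R]_x ((h' x - (x - m) / s ^+ 2 * h x) * g x)%:E = 0)%E.
Proof.
move=> dh ch' hC h'C.
have C0 : 0 <= C by exact: le_trans (h'C 0).
have ch : continuous h.
  move=> x; apply: differentiable_continuous; apply/derivable1_diffP.
  by have [] := dh x.
have cf : continuous (fun x => h' x - (x - m) / s ^+ 2 * h x).
  move=> x; apply: cvgB; first exact: ch'.
  apply: cvgM; last exact: ch.
  by apply: cvgM; [apply: cvgB; [exact: cvg_id|exact: cvg_cst]|exact: cvg_cst].
have yb (y : R) : 1 + `|y| <= 2 * (1 + y ^+ 2).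
  rewrite -(real_normK (num_real y)); have := normr_ge0 y; have := sqr_ge0 (`|y| - 1); nra.
(* Two quadratic factors must be absorbed: the one that dominates the linear growth of [h], by
   passing from [g] to [g2], and the one in the claim, by the boundedness of
   [(1 + (x - m)^2) * g2]. *)
have [D hgD] : exists D, forall x, (1 + (x - m) ^+ 2) * `|h x * g x| <= D.
  have [K KP] := normal_pdf_poly_le m s0.
  have [D DP] := normal_pdf_sqr_bounded m r2s0.
  exists (2 * C * (`|K| * D)) => x.
  have g0 := normal_pdf_ge0 m s x; have g20 := normal_pdf_ge0 m (Num.sqrt 2 * s) x.
  rewrite normrM (ger0_norm g0).
  have y1 : 0 <= 1 + (x - m) ^+ 2 by rewrite addr_ge0 ?sqr_ge0.
  apply: (@le_trans _ _ ((1 + (x - m) ^+ 2) * (2 * C * ((1 + (x - m) ^+ 2) * g x)))).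
    rewrite ler_wpM2l// mulrA ler_wpM2r//.
    apply: le_trans (hC x) _; rewrite mulrAC [leRHS]mulrC ler_wpM2l//.
  apply: (@le_trans _ _ ((1 + (x - m) ^+ 2) * (2 * C * (`|K| * g2 x)))).
    rewrite ler_wpM2l// ler_wpM2l ?mulr_ge0//.
    by rewrite (le_trans (KP x))// ler_wpM2r// ler_norm.
  rewrite mulrCA ler_wpM2l ?mulr_ge0// mulrCA ler_wpM2l//.
apply: (@integral_derivative0 _ (fun x => h x * g x)).
- move=> x; have d1 := dh x; have d2 := is_derive_normal_pdf x.
  by apply: is_derive_eq; rewrite /GRing.scale/=; ring.
- move=> x; apply: cvgM; first exact: cf.
  exact: continuous_normal_pdf.
- apply: (@integrable_poly_normal _ (C + 2 * C / s ^+ 2)).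
    exact: continuous_measurable_fun.
  move=> x; apply: (le_trans (ler_normB _ _)).
  rewrite [leRHS]mulrDl lerD//.
    rewrite (le_trans (h'C x))// ler_peMr// lerDl sqr_ge0//.
  rewrite !normrM normfV (ger0_norm (ltW s2_gt0)) mulrAC.
  rewrite -[leRHS]mulrA [s^-2 * _]mulrC mulrA ler_pM2r ?invr_gt0//.
  have := hC x; have := normr_ge0 (x - m); rewrite -(real_normK (num_real (x - m))).
  set y := `|x - m| => y0 hx.
  apply: (@le_trans _ _ (y * (C * (1 + y)))); first by rewrite ler_wpM2l.
  have : y * (1 + y) <= 2 * (1 + y ^+ 2) by have := sqr_ge0 (y - 1); nra.
  by move: C0; nra.
- apply: proj1 (cvg0_sqr_bounded (hgD)).
- apply: proj2 (cvg0_sqr_bounded (hgD)).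
Qed.

End normal_stein.

Section normal_prob_moments.
Context (R : realType) (m s : R).
Hypothesis s0 : s != 0.
Local Notation N := (normal_prob m s).

Lemma normal_prob_integrable (h : R -> R) (C : R) : measurable_fun setT h ->
  (forall x, `|h x| <= C * (1 + (x - m) ^+ 2)) -> N.-integrable setT (EFin \o h).
Proof.
move=> mh hC; apply/(@integrable_density _ _ _ lebesgue_measure N (normal_pdf m s)) => //.
- by move=> x; exact: normal_pdf_ge0.
- exact: measurable_normal_pdf.
- exact: (integrable_poly_normal s0 mh hC).
Qed.

Lemma normal_prob_stein (h h' : R -> R) (C : R) :
  (forall x : R, is_derive x 1 h (h' x)) -> continuous h' ->
  (forall x, `|h x| <= C * (1 + `|x - m|)) -> (forall x, `|h' x| <= C) ->
  \int[N]_x (h' x - (x - m) / s ^+ 2 * h x) = 0.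
Proof.
move=> dh ch' hC h'C; rewrite /Rintegral.
have ch : continuous h.
  move=> x; apply: differentiable_continuous; apply/derivable1_diffP.
  by have [] := dh x.
rewrite (@integral_density _ _ _ lebesgue_measure N (normal_pdf m s)) //.
- by rewrite (normal_stein s0 dh ch' hC h'C).
- by move=> x; exact: normal_pdf_ge0.
- exact: measurable_normal_pdf.
- apply: measurable_funB; first exact: continuous_measurable_fun.
  apply: measurable_funM; last exact: continuous_measurable_fun.
  by apply: measurable_funM => //; exact: measurable_funB.
Qed.

(** Stein's identity with [h = 1]; the variance below takes [h = x - m]. *)
Lemma normal_prob_mean : \int[N]_x (x - m) = 0.
Proof.
have := @normal_prob_stein (fun=> 1) (fun=> 0) 1.
have s20 : s ^+ 2 != 0 by rewrite expf_neq0.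
have i1 : N.-integrable setT (EFin \o (fun x => x - m)).
  apply: (@normal_prob_integrable _ 1); first exact: measurable_funB.
  move=> x; rewrite mul1r -(real_normK (num_real (x - m))).
  have := sqr_ge0 (`|x - m| - 1); have := normr_ge0 (x - m); nra.
rewrite (@eq_Rint _ _ _ N _ (fun x => - (s ^+ 2)^-1 * (x - m))); last first.
  by move=> x; field.
rewrite RintegralZl// => H.
have /eqP : - (s ^+ 2)^-1 * (\int[N]_x (x - m)) = 0.
  apply: H => [x|x|x].
  - exact: cvg_cst.
  - by rewrite normr1 mul1r lerDl.
  - by rewrite normr0 ler01.
by rewrite mulf_eq0 oppr_eq0 invr_eq0 (negbTE s20) => /eqP.
Qed.

Lemma normal_prob_variance : \int[N]_x ((x - m) ^+ 2) = s ^+ 2.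
Proof.
have s20 : s ^+ 2 != 0 by rewrite expf_neq0.
have i2 : N.-integrable setT (EFin \o (fun x => (x - m) ^+ 2)).
  apply: (@normal_prob_integrable _ 1).
    by apply: measurable_funX; exact: measurable_funB.
  by move=> x; rewrite ger0_norm ?sqr_ge0// mul1r lerDr.
have := @normal_prob_stein (fun x => x - m) (fun=> 1) 1.
rewrite (@eq_Rint _ _ _ N _ (fun x => 1 - (s ^+ 2)^-1 * (x - m) ^+ 2)); last first.
  by move=> x; field.
have i3 : N.-integrable setT (EFin \o (fun x => (s ^+ 2)^-1 * (x - m) ^+ 2)).
  by have := integrableZl measurableT (s ^+ 2)^-1 i2.
rewrite RintegralB//; last by apply: bm_integrable; exact: bm_cst.
rewrite RintegralZl// Rint_cst => H.
have /eqP : 1 - (s ^+ 2)^-1 * (\int[N]_x ((x - m) ^+ 2)) = 0.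
  apply: H => [x|x|x|_].
  - by apply: is_derive_eq; rewrite subr0.
  - exact: cvg_cst.
  - by rewrite mul1r lerDr.
  - by rewrite normr1.
by rewrite subr_eq0 => /eqP e; rewrite -[LHS](mulVKf s20) -e mulr1.
Qed.

Let f (th l x : R) := cos (l * (x - m) + th).

Let mf (h : R -> R) (th l : R) : continuous h -> measurable_fun setT (fun x : R => h (l * (x - m) + th)).
Proof.
move=> ch; apply: measurableT_comp; first exact: continuous_measurable_fun.
by apply: measurable_funD => //; apply: measurable_funM => //; exact: measurable_funB.
Qed.

Let df (th l x : R) : is_derive l 1 (fun l => f th l x) (- (x - m) * sin (l * (x - m) + th)).
Proof. by rewrite /f; apply: is_derive_eq; rewrite /GRing.scale/=; ring. Qed.

(** Differentiating under the integral produces [(x - m) sin], which Stein's identity for the sine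
    turns back into a cosine: a linear differential equation in [l]. The phase [th] makes the sine
    transform a special case. *)
Lemma is_derive_normal_char (th l : R) :
  is_derive l 1 (fun l => \int[N]_x f th l x) (- (l * s ^+ 2) * \int[N]_x f th l x).
Proof.
have s20 : s ^+ 2 != 0 by rewrite expf_neq0.
have Ia : `]l - 1, l + 1[%classic l by rewrite /= in_itv/= ltrBlDr ltrDl ltr01.
have intf (l' : R) : `]l - 1, l + 1[%classic l' -> N.-integrable setT (EFin \o f th l').
  by move=> _; apply: bm_integrable; apply: bm_cos; exact: (mf _ _ (fun=> cvg_id)).
have derf (l' x : R) : `]l - 1, l + 1[%classic l' -> setT x -> derivable ((f th)^~ x) l' 1.
  by move=> _ _; have [] := df th l' x.
have iG : N.-integrable setT (EFin \o (fun x => `|x - m|)).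
  apply: (@normal_prob_integrable _ 1).
    by apply: measurableT_comp => //; exact: measurable_funB.
  move=> x; rewrite normr_id mul1r -(real_normK (num_real (x - m))).
  have := sqr_ge0 (`|x - m| - 1); have := normr_ge0 (x - m); nra.
have pE l' x : partial1of2 (f th) l' x = - (x - m) * sin (l' * (x - m) + th).
  by rewrite /partial1of2 derive1E; have := df th l' x => d; rewrite derive_val.
have Gub (l' x : R) : `]l - 1, l + 1[%classic l' -> setT x -> `|partial1of2 (f th) l' x| <= `|x - m|.
  move=> _ _; rewrite pE normrM normrN ler_piMr// ler_norml sin_geN1 sin_le1//.
have dv := @derivable_under_integral R _ _ N (f th) setT measurableT l (l - 1) (l + 1) Ia intf derf (fun x => `|x - m|) (fun=> normr_ge0 _) iG Gub.
have ev := @differentiation_under_integral R _ _ N (f th) setT measurableT l (l - 1) (l + 1) Ia intf derf (fun x => `|x - m|) (fun=> normr_ge0 _) iG Gub.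
have -> : - (l * s ^+ 2) * \int[N]_x f th l x = 'D_1 (fun l => \int[N]_x f th l x) l.
  rewrite -derive1E ev.
  rewrite (@eq_Rint _ _ _ N (fun x => partial1of2 (f th) l x) (fun x => - (x - m) * sin (l * (x - m) + th)))//.
  have i4 : N.-integrable setT (EFin \o (fun x => - (x - m) * sin (l * (x - m) + th))).
    apply: le_integrable iG => //.
      apply/measurable_EFinP; apply: measurable_funM.
        by apply: measurableT_comp => //; exact: measurable_funB.
      by apply: mf; exact: continuous_sin.
    move=> x _ /=; rewrite lee_fin normr_id normrM normrN ler_piMr// ler_norml sin_geN1 sin_le1//.
  have := @normal_prob_stein (fun x => sin (l * (x - m) + th)) (fun x => l * f th l x) (1 + `|l|).
  have i5 : N.-integrable setT (EFin \o (fun x => l * f th l x)).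
    apply: bm_integrable; apply: bmM; first exact: bm_cst.
    by apply: bm_cos; exact: (mf _ _ (fun=> cvg_id)).
  have i6 : N.-integrable setT (EFin \o (fun x => (s ^+ 2)^-1 * (- (x - m) * sin (l * (x - m) + th)))).
    by have := integrableZl measurableT (s ^+ 2)^-1 i4.
  have e1 : \int[N]_x (l * f th l x - (x - m) / s ^+ 2 * sin (l * (x - m) + th)) =
      \int[N]_x (l * f th l x + (s ^+ 2)^-1 * (- (x - m) * sin (l * (x - m) + th))).
    by apply: eq_Rint => x; rewrite /f; field.
  move=> H.
  have : l * \int[N]_x f th l x + (s ^+ 2)^-1 * \int[N]_x (- (x - m) * sin (l * (x - m) + th)) = 0.
    rewrite -[X in X + _](RintZl N l); last first.
      by apply: bm_cos; exact: (mf _ _ (fun=> cvg_id)).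
    rewrite -[X in _ + X]RintegralZl// -RintegralD// -e1.
    apply: H => [x|x|x|x].
    - by apply: is_derive_eq; rewrite /GRing.scale/= /f; ring.
    - apply: cvgM; first exact: cvg_cst.
      apply: continuous_comp; last exact: continuous_cos.
      apply: cvgD; last exact: cvg_cst.
      by apply: cvgM; [exact: cvg_cst|apply: cvgB; [exact: cvg_id|exact: cvg_cst]].
    - apply: (@le_trans _ _ 1); first by rewrite ler_norml sin_geN1 sin_le1.
      by have := normr_ge0 l; have := normr_ge0 (x - m); nra.
    - rewrite normrM; apply: (@le_trans _ _ `|l|); last by rewrite lerDr.
      by rewrite ler_piMr// ler_norml cos_geN1 cos_le1.
  set a := (\int[N]_x f th l x); set b := (X in _ + _ * X = 0) => e.
  have e2 : b = s ^+ 2 * (l * a + (s ^+ 2)^-1 * b) - s ^+ 2 * (l * a) by field.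
  change (- (l * s ^+ 2) * a = b); rewrite e2 e; ring.
exact: DeriveDef.
Qed.

Lemma normal_prob_char (th l : R) :
  \int[N]_x cos (l * (x - m) + th) = cos th * expR (- (l ^+ 2 * s ^+ 2 / 2)).
Proof.
(* The exponential is the integrating factor of that equation, so [Psi] is constant and equal to its
   value [cos th] at [l = 0]. *)
pose Psi (l : R) := expR (l ^+ 2 * s ^+ 2 / 2) * \int[N]_x f th l x.
have dPsi (x : R) : is_derive x 1 Psi 0.
  have d1 := is_derive_normal_char th x.
  have d0 : is_derive x 1 (fun l : R => l ^+ 2 * s ^+ 2 / 2) (x * s ^+ 2).
    by apply: is_derive_eq; rewrite /GRing.scale/=; field.
  have d2 := is_derive1_comp (is_derive_expR _) d0.
  rewrite /Psi; apply: is_derive_eq; rewrite /GRing.scale/=; ring.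
have := @is_derive_0_is_cst _ Psi l 0 dPsi.
rewrite /Psi expr0n/= !mul0r expR0 mul1r {2}/f.
rewrite (@eq_Rint _ _ _ N (fun x => cos (0 * (x - m) + th)) (fun=> cos th)); last first.
  by move=> x; rewrite mul0r add0r.
by rewrite Rint_cst => <-; rewrite expRN mulrAC divff ?gt_eqF ?expR_gt0// mul1r.
Qed.

End normal_prob_moments.

Lemma Rint_law d1 d2 (T : measurableType d1) (W : measurableType d2)
    (R : realType) (P : probability T R) (Q : probability W R) (X : T -> W)
    (f : W -> R) : measurable_fun setT X ->
  (forall A, measurable A -> P (X @^-1` A) = Q A) ->
  measurable_fun setT f -> P.-integrable setT (EFin \o (f \o X)) ->
  \int[P]_x f (X x) = \int[Q]_y f y.
Proof.
move=> mX XQ mf fi; rewrite /Rintegral; congr fine.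
have -> : (\int[Q]_y (f y)%:E = \int[pushforward P X]_y (f y)%:E)%E.
  by apply: eq_measure_integral => A mA _; rewrite /pushforward; exact/esym/XQ.
rewrite (@integral_pushforward _ _ _ _ _ _ mX P setT (EFin \o f))//.
exact/measurable_EFinP.
Qed.

Section normal_laws.
Context (R : realType).
Implicit Types m s : R.

(** Mirrors the case split of [normal_law], so that zero time increments and degenerate linear
    combinations need no separate treatment. *)
Definition normal0_prob m s : probability (measurableTypeR R) R :=
  if s == 0 then [the probability (measurableTypeR R) R of \d_(m : measurableTypeR R)]
  else [the probability (measurableTypeR R) R of normal_prob m s].

Lemma normal0_prob_integrable m s (h : R -> R) (C : R) : measurable_fun setT h ->
  (forall x, `|h x| <= C * (1 + (x - m) ^+ 2)) ->
  (normal0_prob m s).-integrable setT (EFin \o h).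
Proof.
move=> mh hC; rewrite /normal0_prob; case: eqP => [_|/eqP s0]; last first.
  exact: normal_prob_integrable hC.
apply/integrableP; split; first exact/measurable_EFinP.
rewrite integral_dirac//; first by rewrite diracT mul1e /= ltry.
by apply: measurableT_comp => //; exact/measurable_EFinP.
Qed.

Lemma normal0_prob_mean m s : \int[normal0_prob m s]_x (x - m) = 0.
Proof.
rewrite /normal0_prob; case: eqP => [_|/eqP s0]; last exact: normal_prob_mean.
rewrite /Rintegral integral_dirac ?diracT ?mul1e ?subrr//.
by apply/measurable_EFinP; exact: measurable_funB.
Qed.

Lemma normal0_prob_variance m s : \int[normal0_prob m s]_x ((x - m) ^+ 2) = s ^+ 2.
Proof.
rewrite /normal0_prob; case: eqP => [->|/eqP s0]; last exact: normal_prob_variance.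
rewrite /Rintegral integral_dirac ?diracT ?mul1e ?subrr//.
by apply/measurable_EFinP; apply: measurable_funX; exact: measurable_funB.
Qed.

Lemma normal0_prob_cos m s (l th : R) :
  \int[normal0_prob m s]_x cos (l * (x - m) + th) =
  cos th * expR (- (l ^+ 2 * s ^+ 2 / 2)).
Proof.
rewrite /normal0_prob; case: eqP => [->|/eqP s0]; last exact: normal_prob_char.
rewrite expr0n/= mulr0 mul0r oppr0 expR0 mulr1.
rewrite /Rintegral integral_dirac ?diracT ?mul1e//= ?subrr ?mulr0 ?add0r//.
apply/measurable_EFinP; apply: measurableT_comp.
  by apply: continuous_measurable_fun; exact: continuous_cos.
by apply: measurable_funD => //; apply: measurable_funM => //; exact: measurable_funB.
Qed.

Context d (T : measurableType d) (P : probability T R).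

Lemma normal_law_Rint m s (X : T -> R) (h : R -> R) : normal_law P m s X ->
  bm h -> \int[P]_x h (X x) = \int[normal0_prob m s]_y h y.
Proof.
move=> [mX XE] bh; apply: Rint_pushforward => // A mA.
by rewrite XE// /normal0_prob; case: ifP.
Qed.

(* The moments identify the parameters: [m = E X] and [m ^ 2 + s ^ 2 = E X ^ 2]. *)
Lemma normal_law_parameters m s (X : T -> R) : normal_law P m s X ->
  P.-integrable setT (EFin \o X) ->
  P.-integrable setT (EFin \o (fun w => X w ^+ 2)) ->
  \int[P]_w X w = 0 -> m = 0 /\ s ^+ 2 = \int[P]_w X w ^+ 2.
Proof.
move=> [mX XE] i1 i2 e1.
have tr (h : R -> R) : measurable_fun setT h -> P.-integrable setT (EFin \o (h \o X)) ->
    \int[P]_x h (X x) = \int[normal0_prob m s]_y h y.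
  move=> mh ih; apply: Rint_law => // A mA.
  by rewrite XE// /normal0_prob; case: ifP.
have yb (y : R) : `|y| <= 1 * (1 + y ^+ 2).
  rewrite mul1r -(real_normK (num_real y)).
  have := sqr_ge0 (`|y| - 1); have := normr_ge0 y; nra.
have j1 : (normal0_prob m s).-integrable setT (EFin \o (fun x => x - m)).
  by apply: (@normal0_prob_integrable _ _ _ 1) => //; exact: measurable_funB.
have m0 : m = 0.
  have : \int[normal0_prob m s]_y (y - m + m) = m.
    rewrite RintegralD//; last by apply: bm_integrable; exact: bm_cst.
    by rewrite normal0_prob_mean Rint_cst add0r.
  rewrite (@eq_Rint _ _ _ (normal0_prob m s) _ id) => [|x]; last by rewrite subrK.
  by rewrite -(tr id)// e1.
split=> //; rewrite (tr (fun x => x ^+ 2))//.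
by rewrite -(normal0_prob_variance m s) m0; apply: eq_Rint => x; rewrite subr0.
Qed.

Lemma normal_law_cos s (X : T -> R) (l : R) : normal_law P 0 s X ->
  \int[P]_w cos (l * X w) = expR (- (l ^+ 2 * s ^+ 2 / 2)).
Proof.
move=> nX; rewrite (normal_law_Rint (h := fun x => cos (l * x)) nX); last first.
  by apply: bm_cos; exact: measurable_funM.
have := normal0_prob_cos 0 s l 0; rewrite cos0 mul1r => <-.
by apply: eq_Rint => x; rewrite subr0 addr0.
Qed.

End normal_laws.

(** * Gaussian averages of the decay profile *)

Section power_profile.
Context (R : realType).
Implicit Types k q u v a t : R.

(** [k] is the length scale: [e] for the profile in space, [e ^ 2] for the one it induces in time,
    in accordance with Brownian scaling. *)
Definition pw k q u := (1 + u / k) `^ q.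

Lemma pw_base k u : 0 < k -> 0 <= u -> 1 <= 1 + u / k.
Proof. by move=> k0 u0; rewrite lerDl divr_ge0// ltW. Qed.

Lemma pw_ge0 k q u : 0 <= pw k q u.
Proof. exact: powR_ge0. Qed.

Lemma pw0 k q : pw k q 0 = 1.
Proof. by rewrite /pw mul0r addr0 powR1. Qed.

Lemma pw_anti k q u v : 0 < k -> q <= 0 -> 0 <= u -> u <= v -> pw k q v <= pw k q u.
Proof.
move=> k0 q0 u0 uv; rewrite -[q]opprK /pw !(powRN _ (- q)).
have b1 := pw_base k0 u0; have b2 := pw_base k0 (le_trans u0 uv).
rewrite lef_pV2 ?posrE ?powR_gt0//; try by rewrite (lt_le_trans ltr01).
apply: ge0_ler_powR; rewrite ?nnegrE ?oppr_ge0//; try by rewrite (le_trans ler01).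
by rewrite lerD2l ler_pM2r ?invr_gt0.
Qed.

Lemma pw_le1 k q u : 0 < k -> q <= 0 -> 0 <= u -> pw k q u <= 1.
Proof. by move=> k0 q0 u0; rewrite -(pw0 k q) pw_anti. Qed.

Lemma is_derive_pw k q u : 0 < k -> 0 < 1 + u / k ->
  is_derive u 1 (pw k q) (q / k * pw k (q - 1) u).
Proof.
move=> k0 b0.
have d1 : is_derive u 1 (fun u : R => 1 + u / k) (k^-1).
  by apply: is_derive_eq; rewrite /GRing.scale/=; ring.
have d2 := @is_derive1_comp _ (fun x => x `^ q) (fun u => 1 + u / k) u _ _ (is_derive1_powR q b0) d1.
by apply: (is_derive_eq d2); rewrite /pw; ring.
Qed.

Lemma continuous_pw_norm k q : 0 < k -> continuous (fun u : R => pw k q `|u|).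
Proof.
move=> k0 x; apply: continuous_comp; first exact: norm_continuous.
apply: differentiable_continuous; apply/derivable1_diffP.
have b0 : 0 < 1 + `|x| / k by rewrite (lt_le_trans ltr01)// pw_base.
by have [] := is_derive_pw q k0 b0.
Qed.

Lemma continuous_within_pw k q a : 0 < k -> 0 <= a ->
  {within `[0, +oo[, continuous (fun u => pw k q (a + u))}.
Proof.
move=> k0 a0.
(* The absolute values keep the base at least 1, which gives continuity on the whole line before
   restricting. *)
have c : continuous (fun u => pw k q `|a + `|u| |).
  move=> x; apply: (@continuous_comp _ _ _ (fun u => a + `|u|) (fun u => pw k q `|u|)).
    by apply: cvgD; [exact: cvg_cst|exact: norm_continuous].
  exact: continuous_pw_norm.
have := continuous_subspaceT (A := `[(0 : R), +oo[%classic) c.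
apply: subspace_eq_continuous => x; rewrite inE/= in_itv/= andbT => x0.
by rewrite /from_subspace/= (ger0_norm x0) ger0_norm// addr_ge0.
Qed.

(** Integration raises the exponent by one; this is the origin of [1 - p], and in the end of the
    exponent of the rate. *)
Lemma integral_pw_tail k p a : 0 < k -> 1 < p -> 0 <= a ->
  (\int[lebesgue_measure]_(u in `[0%R, +oo[) (pw k (- p) (a + u))%:E =
   (k / (p - 1) * pw k (1 - p) a)%:E)%E.
Proof.
move=> k0 p1 a0.
have p10 : p - 1 != 0 by rewrite subr_eq0 gt_eqF.
have dF (x : R) : 0 <= x -> is_derive x 1 (fun u => - (k / (p - 1)) * pw k (1 - p) (a + u)) (pw k (- p) (a + x)).
  move=> x0.
  have b0 : 0 < 1 + (a + x) / k by rewrite (lt_le_trans ltr01)// pw_base// addr_ge0.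
  have d0 : is_derive x 1 (fun u : R => a + u) 1 by apply: is_derive_eq; ring.
  have d1 := is_derive1_comp (is_derive_pw (1 - p) k0 b0) d0.
  apply: is_derive_eq; rewrite /GRing.scale/= (_ : 1 - p - 1 = - p); last by ring.
  by field; rewrite gt_eqF.
rewrite (ge0_continuous_FTC2y (F := fun u => - (k / (p - 1)) * pw k (1 - p) (a + u)) (l := 0)).
- by rewrite addr0 add0e -EFinN; congr (_%:E); ring.
- by move=> x _; exact: pw_ge0.
- exact: continuous_within_pw.
- rewrite -(mulr0 (- (k / (p - 1)))); apply: cvgM; first exact: cvg_cst.
  apply/cvgr0Pnorm_lt => e e0.
  near=> u.
  have u0 : 0 <= u by near: u; apply: nbhs_pinfty_ge; rewrite num_real.
  have b0 : 0 < 1 + (a + u) / k by rewrite (lt_le_trans ltr01)// pw_base// addr_ge0.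
  rewrite ger0_norm ?pw_ge0// /pw -(opprB p) powRN invf_plt ?posrE ?powR_gt0//.
  have p1' : 0 < p - 1 by rewrite subr_gt0.
  have -> : e^-1 = (e^-1 `^ (p - 1)^-1) `^ (p - 1).
    by rewrite -powRrM mulVf// powRr1// invr_ge0 ltW.
  rewrite gt0_ltr_powR ?nnegrE ?powR_ge0 ?(ltW b0)//.
  rewrite (@lt_le_trans _ _ (u / k))//; last by rewrite mulrDl addrA lerDr addr_ge0// divr_ge0// ltW.
  rewrite ltr_pdivlMr//; near: u; apply: nbhs_pinfty_gt; rewrite num_real//.
- by move=> x x0; have [] := dF x (ltW x0).
- have dc : {for 0, continuous (fun u => - (k / (p - 1)) * pw k (1 - p) (a + u))}.
    apply: differentiable_continuous.
    by apply/derivable1_diffP; have [] := dF 0 (lexx _).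
  by apply: cvg_at_right_filter; exact: dc.
- move=> x; rewrite in_itv/= andbT => x0; rewrite derive1E.
  by have d := dF x (ltW x0); rewrite derive_val.
Unshelve. all: by end_near.
Qed.

Lemma integral_pw_segment k q t : 0 < k -> q + 1 != 0 -> 0 < t ->
  (\int[lebesgue_measure]_(u in `[0%R, t]) (pw k q u)%:E =
   (k / (q + 1) * (pw k (q + 1) t - 1))%:E)%E.
Proof.
move=> k0 q1 t0.
have dF (x : R) : 0 <= x -> is_derive x 1 (fun u => (k / (q + 1)) * pw k (q + 1) u) (pw k q x).
  move=> x0.
  have b0 : 0 < 1 + x / k by rewrite (lt_le_trans ltr01)// pw_base.
  have d1 := is_derive_pw (q + 1) k0 b0.
  apply: is_derive_eq; rewrite /GRing.scale/= addrK.
  by field; rewrite q1 gt_eqF.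
rewrite (continuous_FTC2 (F := fun u => (k / (q + 1)) * pw k (q + 1) u))//.
- by rewrite pw0 -EFinB; congr (_%:E); ring.
- have c := @continuous_within_pw k q 0 k0 (lexx 0).
  have s : `[0, t]%classic `<=` `[0, +oo[%classic by apply: subset_itvl.
  have := continuous_subspaceW s c.
  by rewrite (_ : (fun u => pw k q (0 + u)) = pw k q)//; apply/funext => u; rewrite add0r.
- have dc (x : R) : 0 <= x -> {for x, continuous (fun u => (k / (q + 1)) * pw k (q + 1) u)}.
    move=> x0; apply: differentiable_continuous.
    by apply/derivable1_diffP; have [] := dF x x0.
  split=> [x|| ].
  + by rewrite in_itv/= => /andP[x0 _]; have [] := dF x (ltW x0).
  + by apply: cvg_at_right_filter; exact: dc.
  + by apply: cvg_at_left_filter; apply: dc; exact: ltW.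
- move=> x; rewrite in_itv/= => /andP[x0 _]; rewrite derive1E.
  by have d := dF x (ltW x0); rewrite derive_val.
Qed.

(* Truncating at height [r ^ (- al)] splits the profile into a small part and an integrable peak. *)
Lemma normal_decay (al : R) : 0 < al < 1 -> exists K : R, 0 < K /\
  forall e s y, 0 < e -> 0 <= s ->
  \int[normal0_prob 0 (Num.sqrt s)]_z pw e (- al) `|y + z| <=
  K * pw (e ^+ 2) (- (al / 2)) s.
Proof.
(* The factor 2 is the price of [low] below; inside the bracket, 1 accounts for the truncated part
   and [4 / (1 - al)] for the peak. *)
move=> /andP[al0 al1]; exists (2 * (1 + 4 / (1 - al))).
have al10 : 0 < 1 - al by rewrite subr_gt0.
have c0 : 0 <= 4 / (1 - al) by rewrite divr_ge0// ltW.
split; first by rewrite mulr_gt0// ltr_pwDl.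
move=> e s y e0 s0.
have e20 : 0 < e ^+ 2 by rewrite exprn_gt0.
set N := normal0_prob _ _.
have mb : measurable_fun setT (fun z : R => pw e (- al) `|z|).
  by apply: continuous_measurable_fun; exact: continuous_pw_norm.
have bb : bm (fun z : measurableTypeR R => pw e (- al) `|y + z|).
  apply: (@ge0_bm _ _ _ _ 1).
    by apply: (measurableT_comp mb); exact: measurable_funD.
  by move=> z; rewrite pw_ge0 pw_le1// oppr_le0 ltW.
set rho := Num.sqrt s / e.
have rho2 : rho ^+ 2 = s / e ^+ 2 by rewrite /rho exprMn sqr_sqrtr// exprVn.
(* For [q >= 1] one has [1 + q <= 2 q], and [2 ^ (al / 2) <= 2]: this trades [q] for [1 + q] at the
   cost of a factor 2. *)
have low (q : R) : 0 < q -> 1 <= q -> 2 * (1 + q) `^ (- (al / 2)) >= q `^ (- (al / 2)).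
  move=> q0 q1; rewrite !powRN ler_pdivlMr ?powR_gt0 ?ltr_pwDl ?(ltW q0)//.
  rewrite mulrC ler_pdivrMr ?powR_gt0//.
  apply: (@le_trans _ _ ((2 * q) `^ (al / 2))).
    by apply: ge0_ler_powR; rewrite ?nnegrE ?mulr_ge0 ?addr_ge0 ?divr_ge0 ?(ltW q0) ?(ltW al0)//; lra.
  rewrite powRM ?(ltW q0)// ler_wpM2r ?powR_ge0//.
  by apply: ler1_powR; lra.
(* When the standard deviation is at most [e], the right-hand side is bounded below and the trivial
   bound 1 suffices. *)
have [r1|r1] := leP rho 1.
  apply: (@le_trans _ _ 1).
    by apply: Rint_le_cst => // z; rewrite pw_le1// oppr_le0 ltW.
  apply: (@le_trans _ _ (2 * pw (e ^+ 2) (- (al / 2)) s)); last first.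
    by rewrite ler_wpM2r ?pw_ge0// ler_peMr// lerDl.
  have := low 1 ltr01 (lexx _); rewrite powR1 => h1; apply: le_trans h1 _.
  rewrite ler_pM2l// /pw !powRN lef_pV2 ?posrE ?powR_gt0//; last first.
  - by rewrite (lt_le_trans ltr01)// pw_base.
  apply: ge0_ler_powR; rewrite ?nnegrE ?divr_ge0 ?addr_ge0 ?invr_ge0 ?(ltW al0) ?(ltW e20)//.
    by rewrite divr_ge0// ltW.
  by rewrite lerD2l -rho2 expr_le1// /rho divr_ge0 ?sqrtr_ge0 ?(ltW e0).
have s1 : 0 < Num.sqrt s.
  rewrite lt_neqAle sqrtr_ge0 andbT; apply/eqP => s00.
  by move: r1; rewrite /rho -s00 mul0r ltr10.
have rho0 : 0 < rho by exact: lt_trans r1.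
pose c := rho `^ (- al).
(* The part of the profile above height [c]. It vanishes for [|u| >= Num.sqrt s], so its integral is
   over a bounded window, and [al < 1] makes that integral of order [e * rho ^ (1 - al)]. *)
pose G (u : R) : R := Num.max 0 (pw e (- al) `|u| - c).
have G0 u : 0 <= G u by rewrite /G le_max lexx.
have cG : continuous G.
  move=> x; apply: (@continuous_max _ _ (fun=> 0) (fun u : R => pw e (- al) `|u| - c)); first exact: cvg_cst.
  by apply: cvgB; [exact: continuous_pw_norm|exact: cvg_cst].
have GN u : G `|u| = G u by rewrite /G normr_id.
have mG : measurable_fun setT G by exact: continuous_measurable_fun.
have c00 : 0 <= c by exact: powR_ge0.
have bG : bm (fun z : measurableTypeR R => G (z + y)).
  apply: (@ge0_bm _ _ _ _ 1).
    by apply: (measurableT_comp mG); exact: measurable_funD.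
  move=> z; rewrite G0 /G ge_max ler01/= lerBlDr (@le_trans _ _ 1)//.
    by rewrite pw_le1// oppr_le0 ltW.
  by rewrite lerDl.
have split_le : \int[N]_z pw e (- al) `|y + z| <= c + \int[N]_z G (z + y).
  rewrite -[X in X + _](Rint_cst N c) -RintD//; last exact: bm_cst.
  apply: le_Rint => //; first by apply: bmD => //; exact: bm_cst.
  by move=> z; rewrite -lerBlDl /G (addrC (z : R) y) le_max lexx orbT.
have Gint : (\int[@lebesgue_measure R]_u (G u)%:E <= (2 * (e / (1 - al) * (2 * rho) `^ (1 - al)))%:E)%E.
  under eq_integral do rewrite -GN.
  rewrite ge0_integral_radial// EFinM lee_pmul2l//.
  have -> : e / (1 - al) * (2 * rho) `^ (1 - al) = e / (- al + 1) * (2 * rho) `^ (- al + 1) by rewrite addrC.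
  apply: (@le_trans _ _ (\int[lebesgue_measure]_(u in `[0%R, Num.sqrt s]) (pw e (- al) u)%:E)%E).
    rewrite integral_mkcond [leRHS]integral_mkcond; apply: ge0_le_integral => //.
    - by move=> u _; apply: erestrict_ge0 => v _; rewrite lee_fin.
    - apply/(measurable_restrictT _ _).1 => //; apply: measurable_funTS; exact/measurable_EFinP.
    - apply/(measurable_restrictT _ _).1 => //.
      apply: (@eq_measurable_fun _ _ _ _ _ (fun u => (pw e (- al) `|u|)%:E)).
        by move=> u; rewrite inE/= in_itv/= => /andP[u0 _]; rewrite ger0_norm.
      by apply: measurable_funTS; exact/measurable_EFinP.
    move=> u _; rewrite !patchE.
    have -> : (u \in `[0%R, +oo[%classic) = (0 <= u) by apply/idP/idP; rewrite inE/= in_itv/= andbT.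
    have -> : (u \in `[0%R, Num.sqrt s]%classic) = (0 <= u <= Num.sqrt s) by apply/idP/idP; rewrite inE/= in_itv/=.
    have [u0|u0] //= := leP 0 u.
    have [us|us] := leP u (Num.sqrt s).
      by rewrite lee_fin /G ge_max pw_ge0/= ger0_norm// lerBlDr lerDl.
    rewrite lee_fin /G ge_max lexx/= subr_le0 ger0_norm// /pw /c !powRN.
    rewrite lef_pV2 ?posrE ?powR_gt0//; last first.
      by rewrite (lt_le_trans ltr01)// pw_base.
    apply: ge0_ler_powR; rewrite ?nnegrE ?(ltW al0) ?(ltW rho0) ?addr_ge0 ?divr_ge0 ?(ltW e0)//.
    rewrite (@le_trans _ _ (u / e))//; first by rewrite /rho ler_pM2r ?invr_gt0// ltW.
    by rewrite lerDr.
  rewrite integral_pw_segment//; last by rewrite addrC gt_eqF.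
  rewrite lee_fin ler_wpM2l//; first by rewrite divr_ge0 ?(ltW e0)// addrC ltW.
  apply: (@le_trans _ _ (pw e (- al + 1) (Num.sqrt s))); first by rewrite lerBlDr lerDl.
  rewrite /pw -/rho; apply: ge0_ler_powR; rewrite ?nnegrE.
  - by rewrite addrC ltW.
  - by rewrite addr_ge0// ltW.
  - by rewrite mulr_ge0// ltW.
  - by rewrite mulr_natl mulr2n lerD2r ltW.
have s1n : Num.sqrt s != 0 by rewrite gt_eqF.
have peak_le : normal_peak (Num.sqrt s) <= (Num.sqrt s)^-1.
  rewrite /normal_peak lef_pV2 ?posrE//; last first.
    by rewrite sqrtr_gt0 pmulrn_lgt0// mulr_gt0 ?pi_gt0// exprn_gt0.
  rewrite -[leLHS]ger0_norm ?sqrtr_ge0// -sqrtr_sqr; apply: ler_wsqrtr.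
  have := pi_ge2 R; have := sqr_ge0 (Num.sqrt s); rewrite mulr2n; nra.
(* The normal density is at most the inverse standard deviation, and translation invariance of
   Lebesgue measure removes [y]. This is where uniformity in [y] comes from. *)
have Nle : \int[N]_z G (z + y) <= (Num.sqrt s)^-1 * (2 * (e / (1 - al) * (2 * rho) `^ (1 - al))).
  rewrite -lee_fin EFin_Rint; last exact: bm_integrable.
  rewrite /N /normal0_prob (negbTE s1n).
  rewrite (@ge0_integral_density _ _ _ lebesgue_measure _ (normal_pdf 0 (Num.sqrt s)))//; last 4 first.
  - by move=> z; exact: normal_pdf_ge0.
  - exact: measurable_normal_pdf.
  - by apply/measurable_EFinP; exact: bm_measurable bG.
  - by move=> z; rewrite lee_fin.
  apply: (@le_trans _ _ (\int[lebesgue_measure]_z (((Num.sqrt s)^-1)%:E * (G (z + y))%:E))%E).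
    apply: ge0_le_integral => //.
    - by move=> z _; rewrite mule_ge0 ?lee_fin ?normal_pdf_ge0.
    - apply: emeasurable_funM; apply/measurable_EFinP; first exact: bm_measurable bG.
      exact: measurable_normal_pdf.
    - apply: emeasurable_funM => //; apply/measurable_EFinP; exact: bm_measurable bG.
    - move=> z _; rewrite muleC lee_wpmul2r ?lee_fin// (le_trans _ peak_le)//.
      exact: normal_pdf_ub.
  rewrite ge0_integralZl//; last 2 first.
  - by apply/measurable_EFinP; exact: bm_measurable bG.
  - by move=> z _; rewrite lee_fin.
  rewrite [leRHS]EFinM; apply: lee_wpmul2l; first by rewrite lee_fin invr_ge0 ltW.
  rewrite (@ge0_integral_shift _ y (fun u => (G u)%:E))//.
  exact/measurable_EFinP.
apply: (le_trans split_le); apply: (@le_trans _ _ (c * (1 + 4 / (1 - al)))).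
  rewrite mulrDr mulr1 lerD2l; apply: (le_trans Nle).
  rewrite powRM ?(ltW rho0)//.
  have -> : rho `^ (1 - al) = rho * c.
    by rewrite /c powRD ?powRr1 ?(ltW rho0)//; apply/implyP => _; rewrite gt_eqF.
  rewrite [leLHS](_ : _ = c * (2 / (1 - al) * 2 `^ (1 - al))); last first.
    by rewrite /rho; field; rewrite !gt_eqF.
  rewrite ler_wpM2l// [leRHS](_ : _ = 2 / (1 - al) * 2); last by field; rewrite gt_eqF.
  rewrite ler_wpM2l ?divr_ge0// ?(ltW al10)//.
  by apply: ler1_powR; lra.
have cE : c = (rho ^+ 2) `^ (- (al / 2)).
  by rewrite -powR_mulrn ?(ltW rho0)// -powRrM /c; congr (_ `^ _); field.
have l : (rho ^+ 2) `^ (- (al / 2)) <= 2 * (1 + rho ^+ 2) `^ (- (al / 2)).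
  by apply: low; [exact: exprn_gt0|rewrite exprn_ege1// ltW].
rewrite cE /pw -rho2; apply: le_trans (ler_wpM2r _ l) _; first by rewrite addr_ge0.
by rewrite mulrAC.
Qed.

End power_profile.

(** * Laws on row vectors and Gaussian vectors with independent coordinates *)

Definition push d d' (T : measurableType d) (W : measurableType d') (R : realType)
    (P : probability T R) (f : T -> W) (mf : measurable_fun setT f) : probability W R :=
  [the probability W R of distribution P
    (HB.pack_for {mfun T >-> W} f (isMeasurableFun.Build _ _ _ _ f mf))].

Lemma pushE d d' (T : measurableType d) (W : measurableType d') (R : realType)
    (P : probability T R) (f : T -> W) (mf : measurable_fun setT f) A :
  push P mf A = P (f @^-1` A).
Proof. by []. Qed.

Lemma Rint_push d d' (T : measurableType d) (W : measurableType d') (R : realType)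
    (P : probability T R) (f : T -> W) (mf : measurable_fun setT f) (h : W -> R) :
  bm h -> \int[push P mf]_y h y = \int[P]_x h (f x).
Proof.
move=> bh; apply/esym.
by apply: (@Rint_pushforward _ _ _ _ _ P (push P mf) f h mf).
Qed.

Definition rV_box (R : realType) n (A : 'I_n -> set R) : set 'rV[R]_n :=
  [set x | forall i, A i (x ord0 i)].

Lemma measurable_rV_box (R : realType) n (A : 'I_n -> set R) :
  (forall i, measurable (A i)) -> measurable (rV_box A).
Proof.
move=> mA; rewrite (_ : rV_box A = \bigcap_(i in [set: 'I_n])
    (fun x : 'rV[R]_n => x ord0 i) @^-1` A i); last first.
  by apply/seteqP; split => x /= Ax i => [_|]; exact: Ax.
apply: fin_bigcap_measurable => // i _.
by rewrite -[X in measurable X]setTI; exact: measurable_coord.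
Qed.

(** Boxes are stable under intersection and generate the product sigma-algebra. *)
Lemma rV_law_unique (R : realType) n (m1 m2 : probability 'rV[R]_n R) :
  (forall A : 'I_n -> set R, (forall i, measurable (A i)) ->
    m1 (rV_box A) = m2 (rV_box A)) ->
  forall X, measurable X -> m1 X = m2 X.
Proof.
move=> m12.
pose G : set (set 'rV[R]_n) := [set B | exists A : 'I_n -> set R,
  (forall i, measurable (A i)) /\ B = rV_box A].
apply: (@measure_unique _ _ _ G (fun=> setT)) => //.
- apply/seteqP; split; last first.
    apply: smallest_sub; first exact: sigma_algebra_measurable.
    by move=> _ [A [mA ->]]; exact: measurable_rV_box.
  apply: smallest_sub; first exact: smallest_sigma_algebra.
  case: n => [|n] in m1 m2 m12 G *; first by rewrite big_ord0.
  rewrite -bigcup_mkord_ord; apply: bigcup_sub => i Ii.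
  move=> _ [B mB <-]; apply: sub_sigma_algebra.
  exists (fun j : 'I_n.+1 => if j == inord i then B else setT); split.
    by move=> j; case: ifP.
  apply/seteqP; split => x /=.
    by move=> [_ Bx] j; case: eqP => // ->.
  by move=> /(_ (inord i)); rewrite eqxx.
- move=> _ _ [A [mA ->]] [A' [mA' ->]].
  exists (fun i => A i `&` A' i); split; first by move=> i; exact: measurableI.
  apply/seteqP; split => x /=; first by move=> [? ?] i.
  by move=> xAA; split=> i; have [] := xAA i.
- move=> _; exists (fun=> setT); split => //.
  by apply/seteqP; split.
- by rewrite bigcup_const.
- by move=> _ [A [mA ->]]; exact: m12.
- by move=> _; rewrite -ge0_fin_numE// fin_num_measure.
Qed.

Section gaussian_vector.
Context (R : realType).
Implicit Types s : R.

(** The centred Gaussian law with covariance [s] times the identity. It follows the recursion of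
    [lebesgue_rV], so that Fubini peels off one coordinate at a time. *)
Fixpoint gauss_rV n s : probability 'rV[R]_n R :=
  if n is n'.+1 then
    push (normal0_prob 0 (Num.sqrt s) \x gauss_rV n' s)%E (@measurable_rV_cons R n')
  else [the probability _ _ of \d_(0 : 'rV[R]_0)].

Lemma gauss_rV_box n s (A : 'I_n -> set R) : (forall i, measurable (A i)) ->
  gauss_rV n s (rV_box A) =
  (\big[*%E/1%E]_(i < n) normal0_prob 0 (Num.sqrt s) (A i))%E.
Proof.
elim: n A => [|n IH] A mA.
  by rewrite big_ord0 /= diracE mem_set// => -[].
have -> : gauss_rV n.+1 s (rV_box A) =
    (normal0_prob 0 (Num.sqrt s) \x gauss_rV n s)%E (@rV_cons R n @^-1` rV_box A) by [].
rewrite big_ord_recl -IH//.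
rewrite -product_measure1E; [|exact: mA|exact: measurable_rV_box].
congr (_ _); apply/seteqP; split => -[a y] /=.
  move=> Aay; split; first by have := Aay ord0; rewrite rV_cons0.
  by move=> i; have := Aay (lift ord0 i); rewrite rV_consS.
move=> [Aa Ay] i; have [->|] := eqVneq i ord0; first by rewrite rV_cons0.
by rewrite eq_sym => /unlift_some[j -> _]; rewrite rV_consS; exact: Ay.
Qed.

Lemma Rint_gauss_rVS n s (h : 'rV[R]_n.+1 -> R) : bm h ->
  \int[gauss_rV n.+1 s]_z h z =
  \int[normal0_prob 0 (Num.sqrt s)]_a \int[gauss_rV n s]_z h (rV_cons (a, z)).
Proof.
move=> bh.
have -> : gauss_rV n.+1 s =
  push (normal0_prob 0 (Num.sqrt s) \x gauss_rV n s)%E (@measurable_rV_cons R n) by [].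
rewrite Rint_push// Rint_prod//.
by apply: (bm_comp bh); exact: measurable_rV_cons.
Qed.

Lemma bm_prod_coord n (g : 'I_n -> R -> R) : (forall i, bm (g i)) ->
  bm (fun z : 'rV[R]_n => \prod_(i < n) g i (z ord0 i)).
Proof.
move=> bg; elim: (index_enum _) => [|i r IH].
  under eq_fun do rewrite big_nil; exact: bm_cst.
under eq_fun do rewrite big_cons; apply: bmM => //.
by apply: (bm_comp (bg i)); exact: measurable_coord.
Qed.

Lemma Rint_gauss_rV_prod n s (g : 'I_n -> R -> R) : (forall i, bm (g i)) ->
  \int[gauss_rV n s]_z \prod_(i < n) g i (z ord0 i) =
  \prod_(i < n) \int[normal0_prob 0 (Num.sqrt s)]_a g i a.
Proof.
elim: n g => [|n IH] g bg.
  rewrite big_ord0; under eq_Rint do rewrite big_ord0; exact: Rint_cst.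
rewrite Rint_gauss_rVS ?big_ord_recl; last exact: bm_prod_coord.
rewrite -IH//.
under eq_Rint => a.
  under eq_Rint => z.
    rewrite big_ord_recl rV_cons0/=.
    under eq_bigr do rewrite rV_consS/=.
    over.
  rewrite RintZl; last exact: (bm_prod_coord (g := fun i => g (lift ord0 i))).
  over.
by rewrite RintZr//; exact: bg.
Qed.

Lemma measurable_dot n (xi : 'rV[R]_n) : measurable_fun setT (fun z : 'rV[R]_n => dot xi z).
Proof.
rewrite /dot; elim: (index_enum _) => [|i r IH].
  under eq_fun do rewrite big_nil; exact: measurable_cst.
under eq_fun do rewrite big_cons; apply: measurable_funD => //.
by apply: measurable_funM => //; exact: measurable_coord.
Qed.

Lemma dot_rV_cons n (xi : 'rV[R]_n.+1) (a : R) (z : 'rV[R]_n) :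
  dot xi (rV_cons (a, z)) =
  xi ord0 ord0 * a + dot (\row_i xi ord0 (lift ord0 i)) z.
Proof.
rewrite /dot big_ord_recl rV_cons0; congr (_ + _).
by apply: eq_bigr => i _; rewrite rV_consS mxE.
Qed.

(** The cosine and the sine go together because the addition formulas mix them in the induction
    step. *)
Lemma gauss_rV_char n s (xi : 'rV[R]_n) : 0 <= s ->
  \int[gauss_rV n s]_z cos (dot xi z) = expR (- (s * dot xi xi / 2)) /\
  \int[gauss_rV n s]_z sin (dot xi z) = 0.
Proof.
move=> s0; elim: n xi => [|n IH] xi.
  have e (z : 'rV[R]_0) : dot xi z = 0 by rewrite /dot big_ord0.
  under eq_Rint do rewrite e cos0; rewrite Rint_cst e mulr0 mul0r oppr0 expR0; split => //.
  by under eq_Rint do rewrite e sin0; rewrite Rint_cst.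
rewrite !Rint_gauss_rVS; [|by apply: bm_sin; exact: measurable_dot|by apply: bm_cos; exact: measurable_dot].
set N := normal0_prob _ _; set Q := gauss_rV _ _.
pose xi' : 'rV[R]_n := \row_i xi ord0 (lift ord0 i); set l := xi ord0 ord0.
have bc : bm (fun z : 'rV[R]_n => cos (dot xi' z)) by apply: bm_cos; exact: measurable_dot.
have bs : bm (fun z : 'rV[R]_n => sin (dot xi' z)) by apply: bm_sin; exact: measurable_dot.
have ml : measurable_fun setT (fun a : measurableTypeR R => l * a) by exact: measurable_funM.
have [IHc IHs] := IH xi'.
have nc : \int[N]_a cos (l * a) = expR (- (l ^+ 2 * s / 2)).
  have := normal0_prob_cos 0 (Num.sqrt s) l 0; rewrite cos0 mul1r sqr_sqrtr// => <-.
  by apply: eq_Rint => a; rewrite subr0 addr0.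
have ns : \int[N]_a sin (l * a) = 0.
  have := normal0_prob_cos 0 (Num.sqrt s) l (- (pi / 2)).
  rewrite cosN cos_pihalf mul0r => h; rewrite -[RHS]h.
  by apply: eq_Rint => x; rewrite subr0 -sinDpihalf subrK.
split.
  transitivity (\int[N]_a (cos (l * a) * expR (- (s * dot xi' xi' / 2)))).
    apply: eq_Rint => a.
    under eq_Rint do rewrite dot_rV_cons -/xi' cosD.
    rewrite RintB; [|by apply: bmM => //; exact: bm_cst|by apply: bmM => //; exact: bm_cst].
    by rewrite !RintZl// IHc IHs mulr0 subr0.
  rewrite RintZr; last exact: bm_cos.
  rewrite nc -expRD; congr expR.
  rewrite {2}/dot big_ord_recl /xi' /dot.
  under eq_bigr do rewrite !mxE.
  by rewrite /l; field.
transitivity (\int[N]_a (sin (l * a) * expR (- (s * dot xi' xi' / 2)))).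
  apply: eq_Rint => a.
  under eq_Rint do rewrite dot_rV_cons -/xi' sinD.
  rewrite RintD; [|by apply: bmM => //; exact: bm_cst|by apply: bmM => //; exact: bm_cst].
  by rewrite !RintZl// IHc IHs mulr0 addr0.
by rewrite RintZr ?ns ?mul0r//; exact: bm_sin.
Qed.

(** The coordinates are independent and the profile is a product, so the one dimensional bounds
    multiply and the exponents [al / 2] add up. *)
Lemma gauss_rV_decay n (al : R) : 0 < al < 1 -> exists K : R, 0 < K /\
  forall e s (y : 'rV[R]_n), 0 < e -> 0 <= s ->
  \int[gauss_rV n s]_z \prod_(i < n) pw e (- al) `|(y + z) ord0 i| <=
  K * pw (e ^+ 2) (- (al * n%:R / 2)) s.
Proof.
move=> al01; have /andP[al0 _] := al01; have [K [K0 KP]] := normal_decay al01.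
exists (K ^+ n); split; first exact: exprn_gt0.
move=> e s y e0 s0.
have bg i : bm (fun a : R => pw e (- al) `|y ord0 i + a|).
  apply: (@ge0_bm _ _ _ _ 1); last first.
    by move=> a; rewrite pw_ge0 pw_le1// oppr_le0 ltW.
  have c := @continuous_pw_norm R e (- al) e0.
  apply: (measurableT_comp (continuous_measurable_fun c)).
  exact: measurable_funD.
under eq_Rint do under eq_bigr do rewrite mxE.
rewrite (Rint_gauss_rV_prod s bg).
have -> : pw (e ^+ 2) (- (al * n%:R / 2)) s = pw (e ^+ 2) (- (al / 2)) s ^+ n.
  by rewrite /pw -powR_mulrn ?powR_ge0// -powRrM; congr (_ `^ _); field.
rewrite -exprMn -[n in _ ^+ n]card_ord -prodr_const; apply: ler_prod => i _.
rewrite KP// andbT.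
by apply: Rintegral_ge0 => a _; exact: pw_ge0.
Qed.

End gaussian_vector.

(** * Brownian paths *)

Lemma prod3_law_unique d1 d2 d3 (T1 : measurableType d1) (T2 : measurableType d2)
    (T3 : measurableType d3) (R : realType) (m1 m2 : probability (T1 * (T2 * T3))%type R) :
  (forall A B C, measurable A -> measurable B -> measurable C ->
    m1 (A `*` (B `*` C)) = m2 (A `*` (B `*` C))) ->
  forall X, measurable X -> m1 X = m2 X.
Proof.
move=> m12.
pose G : set (set (T1 * (T2 * T3))) := [set X | exists A B C,
  [/\ measurable A, measurable B, measurable C & X = A `*` (B `*` C)]].
apply: (@measure_unique _ _ _ G (fun=> setT)) => //.
- apply/seteqP; split; last first.
    apply: smallest_sub; first exact: sigma_algebra_measurable.
    by move=> _ [A [B [C [mA mB mC ->]]]]; do 2 apply: measurableX => //.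
  have m1' : measurable_fun setT ((fun x => x.1) : g_sigma_algebraType G -> T1).
    move=> _ Y mY; rewrite setTI; apply: sub_sigma_algebra.
    by exists Y, setT, setT; split => //; apply/seteqP; split => -[a [b c]]//= [].
  have m2' : measurable_fun setT ((fun x => x.2.1) : g_sigma_algebraType G -> T2).
    move=> _ Y mY; rewrite setTI; apply: sub_sigma_algebra.
    by exists setT, Y, setT; split => //; apply/seteqP; split => -[a [b c]]//= [_ []].
  have m3' : measurable_fun setT ((fun x => x.2.2) : g_sigma_algebraType G -> T3).
    move=> _ Y mY; rewrite setTI; apply: sub_sigma_algebra.
    by exists setT, setT, Y; split => //; apply/seteqP; split => -[a [b c]]//= [_ []].
  have mid : measurable_fun setT
      ((fun x => (x.1, (x.2.1, x.2.2))) : g_sigma_algebraType G -> (T1 * (T2 * T3))%type).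
    by apply: measurable_fun_pair => //; exact: measurable_fun_pair.
  move=> X mX; have := mid measurableT X mX; rewrite setTI.
  by rewrite (_ : _ @^-1` X = X)//; apply/seteqP; split => -[a [b c]].
- move=> _ _ [A [B [C [mA mB mC ->]]]] [A' [B' [C' [mA' mB' mC' ->]]]].
  exists (A `&` A'), (B `&` B'), (C `&` C'); split; try exact: measurableI.
  apply/seteqP; split => -[a [b c]] /=; first by move=> [[? [? ?]] [? [? ?]]].
  by move=> [[? ?] [[? ?] [? ?]]].
- by move=> _; exists setT, setT, setT; split => //; apply/seteqP; split.
- by rewrite bigcup_const.
- by move=> _ [A [B [C [mA mB mC ->]]]]; exact: m12.
- by move=> _; rewrite -ge0_fin_numE// fin_num_measure.
Qed.

Section clamp.
Context (R : realType).
Implicit Types t s : R.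

(** Extends a path on [[0, t]] to all real times by constants, so that time averages are integrals
    of total functions and negative times never occur. *)
Definition clamp t s := Num.max 0 (Num.min s t).

Lemma clamp_ge0 t s : 0 <= clamp t s.
Proof. by rewrite /clamp le_max lexx. Qed.

Lemma clamp_le t s : 0 <= t -> clamp t s <= t.
Proof. by move=> t0; rewrite /clamp ge_max t0 ge_min lexx orbT. Qed.

Lemma clamp_id t s : 0 <= s <= t -> clamp t s = s.
Proof. by move=> /andP[s0 st]; rewrite /clamp min_l// max_r. Qed.

Lemma measurable_clamp t : measurable_fun setT (clamp t : R -> R).
Proof. by apply: measurable_maxr => //; exact: measurable_minr. Qed.

(** Rounding goes down, which keeps grid times nonnegative and no later than the clamped time. *)
Definition grid_index t (N : nat) s : nat := Num.truncn (clamp t s * N.+1%:R).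

Definition grid t (N : nat) s : R := (grid_index t N s)%:R / N.+1%:R.

Lemma grid_ge0 t N s : 0 <= grid t N s.
Proof. exact: divr_ge0. Qed.

Lemma grid_le t N s : grid t N s <= clamp t s.
Proof.
rewrite /grid ler_pdivrMr//; rewrite truncn_le.
by rewrite mulr_ge0// clamp_ge0.
Qed.

Lemma grid_gt t N s : clamp t s - N.+1%:R^-1 < grid t N s.
Proof.
rewrite ltrBlDr /grid -[X in _ + X]mul1r -mulrDl ltr_pdivlMr// natr1.
exact: truncnS_gt.
Qed.

Lemma grid_cvg t s : grid t N s @[N --> \oo] --> clamp t s.
Proof.
apply: (@squeeze_cvgr _ _ _ _ (fun N => clamp t s - N.+1%:R^-1) (fun=> clamp t s)).
- by near=> N; rewrite grid_le (ltW (grid_gt _ _ _)).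
- rewrite -[X in _ --> X]subr0; apply: cvgB; first exact: cvg_cst.
  exact: cvg_harmonic.
- exact: cvg_cst.
Unshelve. all: by end_near.
Qed.

Lemma measurable_grid_index t N k : measurable (grid_index t N @^-1` [set k]).
Proof.
have m : measurable_fun setT (fun s : R => clamp t s * N.+1%:R).
  by apply: measurable_funM => //; exact: measurable_clamp.
rewrite (_ : _ @^-1` _ = (fun s : R => clamp t s * N.+1%:R) @^-1` `[k%:R, k.+1%:R[).
  by rewrite -[X in measurable X]setTI; apply: m => //; exact: measurable_itv.
apply/seteqP; split => s /=.
  move=> <-; rewrite in_itv/= truncnS_gt andbT; rewrite truncn_le.
  by rewrite mulr_ge0// clamp_ge0.
rewrite in_itv/= => ?; exact: truncn_def.
Qed.

End clamp.

Lemma measurable_countable_index d1 d2 d3 (T1 : measurableType d1)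
    (T2 : measurableType d2) (T3 : measurableType d3) (k : T1 -> nat)
    (F : nat -> T2 -> T3) :
  (forall i, measurable (k @^-1` [set i])) ->
  (forall i, measurable_fun setT (F i)) ->
  measurable_fun setT (fun x : T1 * T2 => F (k x.1) x.2).
Proof.
move=> mk mF _ Y mY; rewrite setTI.
rewrite (_ : _ @^-1` Y = \bigcup_i (k @^-1` [set i] `*` F i @^-1` Y)); last first.
  apply/seteqP; split => -[a b] /=; first by move=> Yab; exists (k a).
  by move=> [i _ /= [<-]].
apply: bigcupT_measurable => i; apply: measurableX => //.
by rewrite -[X in measurable X]setTI; exact: mF.
Qed.

Section brownian_paths.
Context (R : realType) (n : nat) (d : measure_display) (T : measurableType d).
Variables (PB : probability T R) (B : R -> T -> 'rV[R]_n).
Hypothesis hB : standard_brownian PB B.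

Lemma brownian_cvg (x_ : nat -> R) (x : R) (b : T) (i : 'I_n) : (forall N, 0 <= x_ N) -> 0 <= x ->
  x_ N @[N --> \oo] --> x -> B (x_ N) b ord0 i @[N --> \oo] --> B x b ord0 i.
Proof.
move=> x_0 x0 xx.
have /subspace_continuousP c := @brownian_continuous _ _ _ _ _ _ hB b.
have : B (x_ N) b @[N --> \oo] --> B x b.
  apply: (@cvg_comp _ _ _ x_ (fun y => B y b) _ (within [set t | 0 <= t] (nbhs x))); last exact: c.
  move=> A wA.
  have h : \forall N \near \oo, (0 <= x_ N -> A (x_ N)) by exact: (xx _ wA).
  by change (\forall N \near \oo, A (x_ N)); apply: filterS h => N; apply; exact: x_0.
move=> h; apply: (@cvg_comp _ _ _ _ (fun M : 'rV[R]_n => M ord0 i) _ (nbhs (B x b))) h _.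
exact: coord_continuous.
Qed.

(** Joint measurability in time and chance: by continuity of paths, [B] is the limit of its values
    on the grids, each of which takes one of countably many measurable maps. *)
Lemma measurable_brownian_path t : measurable_fun setT
  (fun z : measurableTypeR R * T => B (clamp t z.1) z.2).
Proof.
apply: measurable_fun_rVP => i.
apply: (@measurable_fun_cvg _ _ _ _ (fun N z => B (grid t N z.1) z.2 ord0 i)).
  move=> N; apply: (@measurable_countable_index _ _ _ _ _ _ (grid_index t N)
    (fun k b => B (k%:R / N.+1%:R) b ord0 i)).
    by move=> k; exact: measurable_grid_index.
  move=> k; apply: (measurableT_comp (@measurable_coord _ R n i)).
  by apply: (brownian_measurable hB); rewrite divr_ge0.
move=> [s b] _ /=; apply: brownian_cvg; rewrite ?clamp_ge0//; last exact: grid_cvg.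
by move=> N; exact: grid_ge0.
Qed.

Lemma measurable_increment r v : 0 <= r -> 0 <= v ->
  measurable_fun setT (fun b => B v b - B r b).
Proof.
move=> r0 v0; apply: measurable_fun_rVP => i.
under eq_fun do rewrite !mxE.
by apply: measurable_funB; apply: (measurableT_comp (@measurable_coord _ R n i));
  exact: (brownian_measurable hB).
Qed.

Lemma increment_law r v : 0 <= r <= v -> forall A, measurable A ->
  PB ((fun b => B v b - B r b) @^-1` A) = gauss_rV n (v - r) A.
Proof.
move=> rv A mA; have /andP[r0 rv'] := rv.
have mi := measurable_increment r0 (le_trans r0 rv').
rewrite -(pushE PB mi); apply: (rV_law_unique _ mA) => {A mA} A mA.
rewrite gauss_rV_box// pushE.
have := brownian_coords hB rv mA.
rewrite (_ : \bigcap_i _ = (fun b => B v b - B r b) @^-1` rV_box A) => [->|]; last first.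
  by apply/seteqP; split => b /= h i => [|_]; exact: h.
apply: eq_bigr => i _; have [_ ->//] := brownian_normal hB i rv.
by rewrite /normal0_prob; case: ifP.
Qed.

Lemma Rint_increment r v (h : 'rV[R]_n -> R) : 0 <= r <= v -> bm h ->
  \int[PB]_b h (B v b - B r b) = \int[gauss_rV n (v - r)]_z h z.
Proof.
move=> rv bh; have /andP[r0 rv'] := rv; apply: Rint_pushforward => //.
  exact: measurable_increment (le_trans r0 rv').
exact: increment_law.
Qed.

(** The end points of two time intervals delimit three consecutive increments, so this single joint
    law serves disjoint, overlapping and nested intervals. *)
Lemma increments3_law r v s u : 0 <= r -> r <= v -> v <= s -> s <= u ->
  forall X, measurable X ->
  PB ((fun b => (B v b - B r b, (B s b - B v b, B u b - B s b))) @^-1` X) =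
  (gauss_rV n (v - r) \x (gauss_rV n (s - v) \x gauss_rV n (u - s)))%E X.
Proof.
move=> r0 rv vs su X mX.
have v0 := le_trans r0 rv; have s0 := le_trans v0 vs; have u0 := le_trans s0 su.
have m3 : measurable_fun setT (fun b => (B v b - B r b, (B s b - B v b, B u b - B s b))).
  by apply: measurable_fun_pair; [|apply: measurable_fun_pair]; exact: measurable_increment.
rewrite -(pushE PB m3).
apply: (@prod3_law_unique _ _ _ _ _ _ _ _ (gauss_rV n (v - r) \x (gauss_rV n (s - v) \x gauss_rV n (u - s)))%E _ X mX) => A1 A2 A3 mA1 mA2 mA3.
have e1 := @product_measure1E _ _ _ _ R (gauss_rV n (v - r))
  [the probability _ R of (gauss_rV n (s - v) \x gauss_rV n (u - s))%E] _ _ mA1 (measurableX mA2 mA3).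
have e2 := @product_measure1E _ _ _ _ R (gauss_rV n (s - v)) (gauss_rV n (u - s)) _ _ mA2 mA3.
rewrite pushE; apply: etrans (esym e1).
apply: etrans (congr1 (fun z => gauss_rV n (v - r) A1 * z)%E (esym e2)).
(* The default [u] keeps [tt] constant after its fourth entry, hence monotone on all of [nat], as
   [brownian_independent] asks. *)
pose tt (i : nat) := nth u [:: r; v; s; u] i.
have ttm : {homo tt : i j / (i <= j)%N >-> i <= j}.
  apply: homo_leq; [exact: lexx|exact: le_trans|].
  by move=> [|[|[|[|i]]]]; rewrite /tt/= ?nth_nil.
pose AA (i : 'I_3) := nth setT [:: A1; A2; A3] i.
have mAA i : measurable (AA i) by case: i => -[|[|[|]]].
have := @brownian_independent _ _ _ _ _ _ hB 3 tt r0 ttm AA mAA.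
rewrite !big_ord_recl big_ord0 mule1 /AA/= /tt/=.
rewrite -!increment_law ?r0 ?v0 ?s0// => <-; congr (PB _).
apply/seteqP; split => b /=.
  by move=> [? [? ?]] [[|[|[|]]]].
by move=> h; split; [exact: (h ord0)|split; [exact: (h (lift ord0 ord0))|exact: (h (lift ord0 (lift ord0 ord0)))]].
Qed.

Lemma Rint_increments3 r v s u (h : 'rV[R]_n * ('rV[R]_n * 'rV[R]_n) -> R) :
  0 <= r -> r <= v -> v <= s -> s <= u -> bm h ->
  \int[PB]_b h (B v b - B r b, (B s b - B v b, B u b - B s b)) =
  \int[gauss_rV n (v - r)]_x \int[(gauss_rV n (s - v) \x gauss_rV n (u - s))%E]_z h (x, z).
Proof.
move=> r0 rv vs su bh.
have v0 := le_trans r0 rv; have s0 := le_trans v0 vs; have u0 := le_trans s0 su.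
rewrite -Rint_prod//; apply: Rint_pushforward => //.
  by apply: measurable_fun_pair; [|apply: measurable_fun_pair]; exact: measurable_increment.
exact: increments3_law.
Qed.

End brownian_paths.

(** * Spectral representation of the covariance *)

Section spectral_covariance.
Context (R : realType) (n : nat).
Variables (cov spec : 'rV[R]_n -> R).
Hypothesis hspec : power_spectrum cov spec.
Local Notation leb := (lebesgue_rV R n).

Lemma spec_ge0 xi : 0 <= spec xi.
Proof. by case: hspec. Qed.

Lemma spec_integrable : leb.-integrable setT (EFin \o spec).
Proof. by case: hspec. Qed.

Lemma measurable_spec : measurable_fun setT spec.
Proof. by have /integrableP[/measurable_EFinP] := spec_integrable. Qed.

Lemma spec_mul_integrable (f : 'rV[R]_n -> R) : bm f ->
  leb.-integrable setT (EFin \o (fun xi => f xi * spec xi)).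
Proof.
move=> [mf [M fM]].
have := integrableZl measurableT M spec_integrable.
apply: le_integrable => //.
  by apply/measurable_EFinP; apply: measurable_funM => //; exact: measurable_spec.
move=> xi _ /=; rewrite lee_fin normrM (le_trans _ (ler_norm _))//.
by rewrite (ger0_norm (spec_ge0 _)) ler_wpM2r ?spec_ge0.
Qed.

Lemma cov_cos x : cov x = (2 * pi) ^- n * \int[leb]_xi (cos (dot xi x) * spec xi).
Proof.
have [_ _ /(_ x) /(congr1 (@complex.Re R))] := hspec.
rewrite /= mul0r subr0 => ->; congr (_ * _).
apply: eq_Rintegral => xi _ /=; ring.
Qed.

Lemma dotNr (x y : 'rV[R]_n) : dot x (- y) = - dot x y.
Proof. by rewrite /dot -sumrN; apply: eq_bigr => i _; rewrite mxE mulrN. Qed.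

Lemma dotZr a (x y : 'rV[R]_n) : dot x (a *: y) = a * dot x y.
Proof. by rewrite /dot mulr_sumr; apply: eq_bigr => i _; rewrite mxE mulrCA. Qed.

Lemma dotZl a (x y : 'rV[R]_n) : dot (a *: x) y = a * dot x y.
Proof. by rewrite /dot mulr_sumr; apply: eq_bigr => i _; rewrite mxE mulrA. Qed.

Lemma dot_ge0 (x : 'rV[R]_n) : 0 <= dot x x.
Proof. by rewrite /dot; apply: sumr_ge0 => i _; rewrite -expr2 sqr_ge0. Qed.

Lemma measurable_dot2 d (T : measurableType d) (f g : T -> 'rV[R]_n) :
  measurable_fun setT f -> measurable_fun setT g ->
  measurable_fun setT (fun z => dot (f z) (g z)).
Proof.
move=> mf mg; rewrite /dot; elim: (index_enum _) => [|i r IH].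
  under eq_fun do rewrite big_nil; exact: measurable_cst.
under eq_fun do rewrite big_cons; apply: measurable_funD => //.
by apply: measurable_funM; apply: (measurableT_comp (@measurable_coord _ R n i)).
Qed.

Lemma cov_even x : cov (- x) = cov x.
Proof. by rewrite !cov_cos; congr (_ * _); apply: eq_Rintegral => xi _; rewrite dotNr cosN. Qed.

Lemma pin_ge0 : 0 <= (2 * pi : R) ^- n.
Proof. by rewrite invr_ge0 exprn_ge0// mulr_ge0// pi_ge0. Qed.

Lemma Rint_cos_spec (f : 'rV[R]_n -> R) : measurable_fun setT f ->
  `|\int[leb]_xi (cos (f xi) * spec xi)| <= \int[leb]_xi spec xi.
Proof.
move=> mf; have bc := bm_cos mf; have i1 := spec_mul_integrable bc.
apply: le_trans (le_normr_Rintegral measurableT i1) _.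
apply: le_Rintegral => //; last 2 first.
- exact: spec_integrable.
- by move=> xi _; rewrite normrM (ger0_norm (spec_ge0 _)) ler_piMl ?spec_ge0// ler_norml cos_geN1 cos_le1.
- by have := integrable_norm i1.
Qed.

Lemma cov0 : cov 0 = (2 * pi) ^- n * \int[leb]_xi spec xi.
Proof.
rewrite cov_cos; congr (_ * _); apply: eq_Rintegral => xi _.
by rewrite (_ : dot xi 0 = 0) ?cos0 ?mul1r// -[0]oppr0 -(scale0r 0) dotNr dotZr mul0r oppr0.
Qed.

Lemma cov0_ge0 : 0 <= cov 0.
Proof. by rewrite cov0 mulr_ge0 ?pin_ge0//; apply: Rintegral_ge0 => xi _; exact: spec_ge0. Qed.

Lemma norm_cov_le x : `|cov x| <= cov 0.
Proof.
rewrite cov0 cov_cos normrM (ger0_norm pin_ge0) ler_wpM2l ?pin_ge0//.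
by apply: Rint_cos_spec; apply: measurable_dot2 => //; exact: measurable_cst.
Qed.

Lemma measurable_cov : measurable_fun setT cov.
Proof.
(* Adding 1 to the cosine makes the integrand nonnegative, so that Tonelli gives measurability; the
   excess is [cov 0]. *)
pose F (z : 'rV[R]_n * 'rV[R]_n) := ((1 + cos (dot z.2 z.1)) * spec z.2)%:E.
have mF : measurable_fun setT F.
  apply/measurable_EFinP; apply: measurable_funM; last first.
    by apply: (measurableT_comp measurable_spec); exact: measurable_snd.
  apply: measurable_funD => //; apply: bm_measurable; apply: bm_cos.
  by apply: measurable_dot2; [exact: measurable_snd|exact: measurable_fst].
have F0 z : (0 <= F z)%E.
  by rewrite lee_fin mulr_ge0 ?spec_ge0// -lerBlDl sub0r cos_geN1.
have m1 := measurable_fun_fubini_tonelli_F (m2 := leb) F mF F0.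
have e x : cov x = (2 * pi) ^- n * fine (\int[leb]_xi F (x, xi))%E - cov 0.
  rewrite cov_cos cov0 -mulrBr; congr (_ * _).
  have bc : bm (fun xi : 'rV[R]_n => cos (dot xi x)).
    by apply: bm_cos; apply: measurable_dot2 => //; exact: measurable_cst.
  have i1 := spec_mul_integrable bc.
  have -> : fine (\int[leb]_xi F (x, xi))%E = \int[leb]_xi (spec xi + cos (dot xi x) * spec xi).
    by rewrite /Rintegral; congr fine; apply: eq_integral => xi _; rewrite /F/= mulrDl mul1r.
  by rewrite RintegralD//; [ring|exact: spec_integrable].
rewrite (_ : cov = fun x => (2 * pi) ^- n * fine (\int[leb]_xi F (x, xi))%E - cov 0); last exact/funext.
apply: measurable_funB => //; apply: measurable_funM => //.
exact: (measurableT_comp (fine_measurable measurableT) m1).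
Qed.

Lemma bm_cov : bm cov.
Proof. by split; [exact: measurable_cov|exists (cov 0); exact: norm_cov_le]. Qed.

(** Stated along sequences and coordinatewise, which is how paths sampled on the time grids
    converge. *)
Lemma cov_cvg (x_ : nat -> 'rV[R]_n) (x : 'rV[R]_n) :
  (forall i, x_ k ord0 i @[k --> \oo] --> x ord0 i) ->
  cov (x_ k) @[k --> \oo] --> cov x.
Proof.
move=> cx.
have cd xi : dot xi (x_ k) @[k --> \oo] --> dot xi x.
  rewrite /dot; elim: (index_enum _) => [|i r IH].
    by rewrite big_nil; under eq_fun do rewrite big_nil; exact: cvg_cst.
  rewrite big_cons; under eq_fun do rewrite big_cons.
  by apply: cvgD => //; apply: cvgM; [exact: cvg_cst|exact: cx].
have mc k : measurable_fun setT (fun xi => cos (dot xi (x_ k)) * spec xi).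
  apply: measurable_funM; last exact: measurable_spec.
  apply: bm_measurable; apply: bm_cos.
  by apply: measurable_dot2 => //; exact: measurable_cst.
have i1 : leb.-integrable setT (EFin \o (fun xi => cos (dot xi x) * spec xi)).
  apply: spec_mul_integrable; apply: bm_cos.
  by apply: measurable_dot2 => //; exact: measurable_cst.
have := @dominated_cvg _ _ _ leb setT measurableT
  (fun k xi => (cos (dot xi (x_ k)) * spec xi)%:E) (fun xi => (cos (dot xi x) * spec xi)%:E)
  (EFin \o spec).
have ifin : (\int[leb]_xi (cos (dot xi x) * spec xi)%:E)%E =
    (\int[leb]_xi (cos (dot xi x) * spec xi))%:E.
  by rewrite /Rintegral fineK//; exact: integrable_fin_num.
rewrite ifin => H.
have /fine_cvgP[_ h] : (\int[leb]_xi (cos (dot xi (x_ k)) * spec xi)%:E)%E @[k --> \oo]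
    --> (\int[leb]_xi (cos (dot xi x) * spec xi))%:E.
  apply: H => //.
  - by move=> k; exact/measurable_EFinP.
  - move=> xi _; apply: cvg_EFin; first exact: nearW.
    apply: cvgM; last exact: cvg_cst.
    apply: (@cvg_comp _ _ _ (fun k => dot xi (x_ k)) cos _ (nbhs (dot xi x))); first exact: cd.
    exact: continuous_cos.
  - exact: spec_integrable.
  - move=> k xi _ /=; rewrite lee_fin normrM (ger0_norm (spec_ge0 _)).
    by rewrite ler_piMl ?spec_ge0// ler_norml cos_geN1 cos_le1.
rewrite cov_cos; under eq_fun do rewrite cov_cos.
by apply: cvgM; [exact: cvg_cst|exact: h].
Qed.

(** Spectral form of the mean of [cov (e^-1 z)] under [gauss_rV n s]. In this form it is visibly
    nonnegative and its integral over time is explicit. *)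
Definition gcov (e s : R) : R :=
  (2 * pi) ^- n * \int[leb]_xi (expR (- (s * (e^-1 ^+ 2 * dot xi xi) / 2)) * spec xi).

Lemma bm_gauss_weight (e s : R) : 0 <= s ->
  bm (fun xi : 'rV[R]_n => expR (- (s * (e^-1 ^+ 2 * dot xi xi) / 2))).
Proof.
move=> s0; apply: (@ge0_bm _ _ _ _ 1).
  apply: (measurableT_comp (@measurable_expR R)).
  apply: measurableT_comp => //; apply: measurable_funM => //.
  apply: measurable_funM => //; apply: measurable_funM => //.
  by apply: measurable_dot2.
move=> xi; rewrite expR_ge0 -expR0 ler_expR oppr_le0.
by rewrite divr_ge0// mulr_ge0// mulr_ge0 ?sqr_ge0 ?dot_ge0.
Qed.

Lemma gcov_ge0 e s : 0 <= gcov e s.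
Proof.
rewrite mulr_ge0 ?pin_ge0//; apply: Rintegral_ge0 => xi _.
by rewrite mulr_ge0 ?expR_ge0 ?spec_ge0.
Qed.

Lemma measurable_scale (a : R) : measurable_fun setT (fun z : 'rV[R]_n => a *: z).
Proof.
apply: measurable_fun_rVP => i; under eq_fun do rewrite mxE.
by apply: measurable_funM => //; exact: measurable_coord.
Qed.

Lemma Rint_gauss_cov e s : 0 <= s ->
  \int[gauss_rV n s]_z cov (e^-1 *: z) = gcov e s.
Proof.
move=> s0; set G := gauss_rV n s.
pose F (z : 'rV[R]_n * 'rV[R]_n) := (cos (dot z.2 (e^-1 *: z.1)) * spec z.2)%:E.
have mF : measurable_fun setT F.
  apply/measurable_EFinP; apply: measurable_funM; last first.
    by apply: (measurableT_comp measurable_spec); exact: measurable_snd.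
  apply: bm_measurable; apply: bm_cos.
  apply: measurable_dot2; first exact: measurable_snd.
  by apply: (measurableT_comp (measurable_scale _)); exact: measurable_fst.
have bc z : bm (fun xi : 'rV[R]_n => cos (dot xi (e^-1 *: z))).
  by apply: bm_cos; apply: measurable_dot2 => //; exact: measurable_cst.
have iF : (G \x leb)%E.-integrable setT F.
  apply/integrable12ltyP => //.
  apply: (@le_lt_trans _ _ (\int[G]_x (\int[leb]_xi (spec xi)%:E))%E).
    apply: ge0_le_integral => //.
    - by move=> z _; exact: integral_ge0.
    - apply: (@measurable_fun_fubini_tonelli_F _ _ _ _ _ _ (fun z => `|F z|%E)) => //.
      exact: measurableT_comp.
    - move=> z _; apply: ge0_le_integral => //.
      + by apply/measurable_EFinP; apply: measurableT_comp => //;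
          apply: measurable_funM; [exact: bm_measurable (bc z)|exact: measurable_spec].
      + by apply/measurable_EFinP; exact: measurable_spec.
      + move=> xi _; rewrite /F/= lee_fin normrM (ger0_norm (spec_ge0 _)).
        by rewrite ler_piMl ?spec_ge0// ler_norml cos_geN1 cos_le1.
  rewrite integral_cst//; have /= -> := @probability_setT _ _ _ G; rewrite mule1.
  have /integrableP[_] := spec_integrable.
  by under eq_integral do rewrite /= ger0_norm ?spec_ge0//.
have cE z : cov (e^-1 *: z) = (2 * pi) ^- n * fine (\int[leb]_xi F (z, xi))%E.
  by rewrite cov_cos /Rintegral.
have bcov : bm (fun z => fine (\int[leb]_xi F (z, xi))%E).
  split.
    exact: (measurableT_comp (fine_measurable measurableT) (measurable_fubini_F iF)).
  exists (\int[leb]_xi spec xi) => z; apply: Rint_cos_spec.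
  by apply: (measurable_dot2 (f := id) (g := fun=> e^-1 *: z)) => //; exact: measurable_cst.
under eq_Rint do rewrite cE.
rewrite RintZl// /gcov; congr (_ * _).
rewrite {1}/Rintegral.
transitivity (fine (\int[leb]_xi \int[G]_z F (z, xi))%E).
  congr fine; rewrite -(Fubini iF); apply: eq_integral => z _.
  by rewrite fineK//; apply: integrable_fin_num => //; exact: (spec_mul_integrable (bc z)).
rewrite /Rintegral; congr fine; apply: eq_integral => xi _.
have bz : bm (fun z : 'rV[R]_n => cos (dot (e^-1 *: xi) z)).
  by apply: bm_cos; exact: measurable_dot.
transitivity (\int[G]_z (cos (dot (e^-1 *: xi) z) * spec xi))%:E.
  rewrite EFin_Rint; last by apply: bm_integrable; apply: bmM => //; exact: bm_cst.
  by apply: eq_integral => z _; rewrite /F/= dotZr dotZl.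
rewrite RintZr// (proj1 (gauss_rV_char _ s0)) dotZl dotZr expr2 !mulrA.
by [].
Qed.

Hypothesis n0 : (0 < n)%N.
Variable beta : R.
Hypothesis beta0 : 0 < beta.
Hypothesis hcov : asymp_infty cov (fun x => enorm x `^ (- beta)).

Local Notation al := (beta / n%:R).

Let al0 : 0 < al.
Proof. by rewrite divr_gt0// ltr0n. Qed.

Lemma coord_le_enorm (x : 'rV[R]_n) i : `|x ord0 i| <= enorm x.
Proof.
rewrite -sqrtr_sqr; apply: ler_wsqrtr; rewrite /dot (bigD1 i)//= -expr2 lerDl.
by apply: sumr_ge0 => j _; rewrite -expr2 sqr_ge0.
Qed.

Lemma prod_pw_ge (x : 'rV[R]_n) (A : R) : (forall i, `|x ord0 i| <= A) ->
  (1 + A) `^ (- beta) <= \prod_(i < n) pw 1 (- al) `|x ord0 i|.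
Proof.
move=> xA; have -> : (1 + A) `^ (- beta) = \prod_(i < n) pw 1 (- al) A.
  rewrite prodr_const card_ord -powR_mulrn ?pw_ge0// /pw -powRrM divr1.
  by congr (_ `^ _); field; rewrite pnatr_eq0 -lt0n.
apply: ler_prod => i _; rewrite pw_ge0/=; apply: pw_anti => //.
by rewrite oppr_le0 ltW.
Qed.

(** Each coordinate is at most [enorm x] in absolute value and the exponents add up to [beta], so
    the product is at least [(1 + enorm x) ^ (- beta)]. Far away the asymptotics, with ratio at most
    2, conclude; near the origin the bound [cov 0] does. The two summands of the constant correspond
    to these regions. *)
Lemma cov_decay : exists K : R, 0 < K /\ forall x,
  `|cov x| <= K * \prod_(i < n) pw 1 (- al) `|x ord0 i|.
Proof.
have [M hM] : exists M, forall x, M < enorm x -> `|cov x| <= 2 * enorm x `^ (- beta).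
  have b1 : nbhs (1 : R) (ball (1 : R) 1) by exact: nbhsx_ballx.
  have [M hM] := hcov b1; exists (Num.max M 1) => x; rewrite gt_max => /andP[Mx x1].
  have := hM x Mx; rewrite /= /ball/= => h.
  have q0 : 0 < enorm x `^ (- beta) by rewrite powR_gt0// (lt_trans ltr01).
  have : `|cov x / enorm x `^ (- beta)| <= 2.
    rewrite -[X in `|X|](subrK 1) (le_trans (ler_normD _ _))// normr1.
    by rewrite -[leRHS]/(1 + 1) lerD2r distrC ltW.
  by rewrite normrM normfV (gtr0_norm q0) ler_pdivrMr.
pose M1 := Num.max M 1.
have M10 : 0 <= M1 by rewrite /M1 le_max ler01 orbT.
have two0 : 0 < (2 : R) `^ beta by rewrite powR_gt0.
have k1 : 0 <= cov 0 * (1 + M1) `^ beta by rewrite mulr_ge0 ?cov0_ge0 ?powR_ge0.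
exists (2 * 2 `^ beta + cov 0 * (1 + M1) `^ beta); split.
  by rewrite ltr_pwDl// mulr_gt0.
move=> x; set q := \prod_(i < n) _.
have q0 : 0 <= q by apply: prodr_ge0 => i _; exact: pw_ge0.
rewrite mulrDl; have [xM|xM] := leP (enorm x) M1.
  apply: (@le_trans _ _ (cov 0 * (1 + M1) `^ beta * q)); last first.
    by rewrite lerDr !mulr_ge0// ltW.
  apply: le_trans (norm_cov_le x) _.
  have : (1 + M1) `^ (- beta) <= q.
    by apply: prod_pw_ge => i; exact: le_trans (coord_le_enorm _ _) xM.
  rewrite powRN => h; rewrite -mulrA ler_peMr ?cov0_ge0//.
  by rewrite -ler_pdivrMl ?mulr1// powR_gt0// ltr_pwDl.
have x1 : 1 < enorm x by apply: le_lt_trans xM; rewrite /M1 le_max lexx orbT.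
have x0 : 0 < enorm x by exact: lt_trans x1.
apply: (@le_trans _ _ (2 * 2 `^ beta * q)); last by rewrite lerDl mulr_ge0.
apply: le_trans (hM x _) _; first by apply: le_lt_trans xM; rewrite /M1 le_max lexx.
rewrite -mulrA ler_pM2l//.
have h : (2 * enorm x) `^ (- beta) <= q.
  apply: (@le_trans _ _ ((1 + enorm x) `^ (- beta))).
    rewrite !powRN lef_pV2 ?posrE ?powR_gt0 ?mulr_gt0 ?addr_gt0//.
    apply: ge0_ler_powR; rewrite ?nnegrE ?mulr_ge0 ?addr_ge0 ?(ltW x0) ?(ltW beta0)//.
    by rewrite mulr_natl mulr2n lerD2r ltW.
  by apply: prod_pw_ge => i; exact: coord_le_enorm.
rewrite -ler_pdivrMl// -powRN -powRM ?(ltW x0)//.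
Qed.

(** [beta < n] is used to make the exponent [beta / n] of each coordinate smaller than 1. *)
Lemma gauss_cov_le : beta < n%:R -> exists K : R, 0 < K /\
  forall e s (y : 'rV[R]_n), 0 < e -> 0 <= s ->
  \int[gauss_rV n s]_z `|cov (e^-1 *: (y + z))| <= K * pw (e ^+ 2) (- (beta / 2)) s.
Proof.
move=> bn; have [K1 [K10 K1P]] := cov_decay.
have al1 : 0 < al < 1 by rewrite al0 ltr_pdivrMr ?ltr0n// mul1r.
have [K2 [K20 K2P]] := gauss_rV_decay n al1.
exists (K1 * K2); split; first exact: mulr_gt0.
move=> e s y e0 s0.
have ms : measurable_fun setT (fun z : 'rV[R]_n => e^-1 *: (y + z)).
  apply: measurable_fun_rVP => i; under eq_fun do rewrite !mxE.
  by apply: measurable_funM => //; apply: measurable_funD => //; exact: measurable_coord.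
have bp : bm (fun z : 'rV[R]_n => \prod_(i < n) pw e (- al) `|(y + z) ord0 i|).
  rewrite (_ : (fun _ => _) = (fun z : 'rV[R]_n =>
      \prod_(i < n) (fun (i : 'I_n) a => pw e (- al) `|y ord0 i + a|) i (z ord0 i))).
    apply: (bm_prod_coord (g := fun i a => pw e (- al) `|y ord0 i + a|)) => i.
    apply: (@ge0_bm _ _ _ _ 1); last first.
      by move=> a; rewrite pw_ge0 pw_le1// oppr_le0 ltW.
    apply: (measurableT_comp (continuous_measurable_fun (@continuous_pw_norm R e (- al) e0))).
    exact: measurable_funD.
  by apply/funext => z; apply: eq_bigr => i _; rewrite mxE.
apply: (@le_trans _ _ (\int[gauss_rV n s]_z (K1 * \prod_(i < n) pw e (- al) `|(y + z) ord0 i|))).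
  apply: le_Rint.
  - by apply: bm_norm; exact: (bm_comp bm_cov).
  - by apply: bmM => //; exact: bm_cst.
  (* Rescaling the argument by [e^-1] turns the profile of scale 1 into the one of scale [e]. *)
  move=> z; apply: le_trans (K1P _) _; rewrite ler_pM2l//.
  rewrite le_eqVlt; apply/orP; left; apply/eqP; apply: eq_bigr => i _.
  by rewrite mxE /pw divr1 normrM gtr0_norm ?invr_gt0// mulrC.
rewrite RintZl// -mulrA ler_pM2l//.
have := K2P e s y e0 s0; rewrite (_ : al * n%:R / 2 = beta / 2)//.
by rewrite divfK// pnatr_eq0 -lt0n.
Qed.

End spectral_covariance.

(** * The effective variance as an integral over time *)

Lemma integral_expR_decay (R : realType) (c : R) : 0 < c ->
  (\int[lebesgue_measure]_(s in `[0%R, +oo[) (expR (- (s * c)))%:E = (c^-1)%:E)%E.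
Proof.
move=> c0; have := integral_exponential_pdf c0.
have -> : (\int[lebesgue_measure]_x (exponential_pdf c x)%:E =
    \int[lebesgue_measure]_(x in `[0%R, +oo[) (c * expR (- c * x))%:E)%E.
  rewrite [RHS]integral_mkcond; apply: eq_integral => x _.
  by rewrite /exponential_pdf !patchE; case: ifP.
rewrite (_ : (fun s => (c * expR (- c * s))%:E) = (fun s => c%:E * (expR (- (s * c)))%:E)%E); last first.
  by apply/funext => s; rewrite -EFinM mulNr mulrC [c * s]mulrC mulrC.
have m : measurable_fun setT (fun s : R => expR (- (s * c))).
  apply: (measurableT_comp (@measurable_expR R)).
  by apply: measurableT_comp => //; exact: measurable_funM.
rewrite ge0_integralZl//; last 2 first.
- by apply/measurable_EFinP; exact: measurable_funTS.
- by rewrite lee_fin ltW.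
move=> h; have cn : c != 0 by rewrite gt_eqF.
rewrite -[LHS]mul1e -[in LHS](_ : (c^-1 * c)%:E = 1%E); last by rewrite mulVf.
by rewrite EFinM -muleA h mule1.
Qed.

Section spectral_variance.
Context (R : realType) (n : nat).
Variables (cov spec : 'rV[R]_n -> R) (beta : R).
Hypothesis hspec : power_spectrum cov spec.
Hypothesis hcov : asymp_infty cov (fun x => enorm x `^ (- beta)).
Hypothesis hbeta : 2 < beta < n%:R.
Local Notation leb := (lebesgue_rV R n).

Lemma beta_dim_gt0 : (0 < n)%N.
Proof.
have /andP[b2 bn] := hbeta; rewrite -(ltr0n R); apply: lt_trans bn.
exact: lt_trans b2.
Qed.

Lemma lebesgue_rV0 : leb [set 0] = 0%E.
Proof.
have h := @lebesgue_rV_box R n (fun=> [set 0]) (fun i => measurable_set1 0).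
apply: (etrans _ (etrans h _)).
  congr (leb _); apply/seteqP; split => x /=; first by move=> -> i; rewrite mxE.
  by move=> x0; apply/rowP => i; rewrite mxE x0.
case: n beta_dim_gt0 => // m _.
by rewrite big_ord_recl lebesgue_measure_set1 mul0e.
Qed.

Lemma measurable_rV0 : measurable [set 0 : 'rV[R]_n].
Proof.
rewrite (_ : [set 0] = rV_box (fun i : 'I_n => [set (0 : R)])).
  by apply: measurable_rV_box => i; exact: measurable_set1.
apply/seteqP; split => x /=; first by move=> -> i; rewrite mxE.
by move=> x0; apply/rowP => i; rewrite mxE x0.
Qed.

Lemma dot_enorm (x : 'rV[R]_n) : dot x x = enorm x ^+ 2.
Proof. by rewrite /enorm sqr_sqrtr// dot_ge0. Qed.

Lemma dot_gt0 (x : 'rV[R]_n) : x != 0 -> 0 < dot x x.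
Proof.
move=> x0; rewrite lt_neqAle dot_ge0 andbT eq_sym; apply: contra x0 => /eqP d0.
apply/eqP/rowP => i; rewrite mxE; apply/eqP; rewrite -normr_le0.
by rewrite (le_trans (coord_le_enorm _ _))// /enorm d0 sqrtr0.
Qed.

Lemma measurable_spec_over_sqr :
  measurable_fun setT (fun xi : 'rV[R]_n => spec xi / enorm xi ^+ 2).
Proof.
apply: measurable_funM; first exact: measurable_spec hspec.
rewrite (_ : (fun _ => _) = fun xi => (dot xi xi) `^ (-1)).
  by apply: (measurableT_comp (measurable_powR (-1))); exact: measurable_dot2.
by apply/funext => xi; rewrite powR_inv1 ?dot_ge0// dot_enorm.
Qed.

(** The integral of [expR (- s |xi|^2 / (2 e^2)) * spec xi] over all times [s >= 0]. *)
Let E e (xi : 'rV[R]_n) := (spec xi * (2 * e ^+ 2 / enorm xi ^+ 2))%:E.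

Let E_q e xi : E e xi = ((2 * e ^+ 2)%:E * (spec xi / enorm xi ^+ 2)%:E)%E.
Proof. by rewrite /E -EFinM; congr (_%:E); ring. Qed.

Let q_ge0 xi : 0 <= spec xi / enorm xi ^+ 2.
Proof. by rewrite divr_ge0 ?sqr_ge0 ?(spec_ge0 hspec). Qed.

Let measurable_E e : measurable_fun setT (E e).
Proof.
rewrite (_ : E e = fun xi => ((2 * e ^+ 2)%:E * (spec xi / enorm xi ^+ 2)%:E)%E); last exact/funext.
by apply: measurable_funeM; apply/measurable_EFinP; exact: measurable_spec_over_sqr.
Qed.

Let integral_E e : (\int[leb]_xi E e xi =
  (2 * e ^+ 2)%:E * \int[leb]_xi (spec xi / enorm xi ^+ 2)%:E)%E.
Proof.
under eq_integral do rewrite E_q.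
rewrite ge0_integralZl//.
- by apply/measurable_EFinP; exact: measurable_spec_over_sqr.
- by move=> xi _; rewrite lee_fin.
- by rewrite lee_fin mulr_ge0 ?sqr_ge0.
Qed.

Lemma measurable_gcov_norm (e : R) : measurable_fun setT (fun s : R => gcov spec e `|s|).
Proof.
pose F (z : measurableTypeR R * 'rV[R]_n) :=
  (expR (- (`|z.1| * (e^-1 ^+ 2 * dot z.2 z.2) / 2)) * spec z.2)%:E.
have F0 z : (0 <= F z)%E by rewrite lee_fin mulr_ge0 ?expR_ge0 ?(spec_ge0 hspec).
have mF : measurable_fun setT F.
  apply/measurable_EFinP; apply: measurable_funM; last first.
    by apply: (measurableT_comp (measurable_spec hspec)); exact: measurable_snd.
  apply: (measurableT_comp (@measurable_expR R)).
  apply: measurableT_comp => //; apply: measurable_funM => //.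
  apply: measurable_funM; first by apply: measurableT_comp => //; exact: measurable_fst.
  by apply: measurable_funM => //; apply: measurable_dot2; exact: measurable_snd.
apply: measurable_funM => //.
exact: (measurableT_comp (fine_measurable measurableT)
  (measurable_fun_fubini_tonelli_F (m2 := leb) F mF F0)).
Qed.

(** Stays in the extended reals because it is what proves the right-hand side finite. *)
Lemma integral_gcov_ereal (e : R) : 0 < e ->
  (\int[lebesgue_measure]_(s in `[0%R, +oo[) (gcov spec e s)%:E =
   ((2 * pi) ^- n)%:E * \int[leb]_xi E e xi)%E.
Proof.
move=> e0.
pose A : set R := `[0%R, +oo[%classic.
pose w (s : R) (xi : 'rV[R]_n) := expR (- (s * (e^-1 ^+ 2 * dot xi xi) / 2)) * spec xi.
pose F (z : measurableTypeR R * 'rV[R]_n) := (\1_A z.1 * w z.1 z.2)%:E.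
have w0 s xi : 0 <= w s xi by rewrite mulr_ge0 ?expR_ge0 ?(spec_ge0 hspec).
have F0 z : (0 <= F z)%E by rewrite lee_fin mulr_ge0.
have mF : measurable_fun setT F.
  apply/measurable_EFinP; apply: measurable_funM.
    have m1 : measurable_fun setT (fun s : measurableTypeR R => \1_A s : R).
      by apply: measurable_indic; exact: measurable_itv.
    by apply: (measurableT_comp m1); exact: measurable_fst.
  apply: measurable_funM; last first.
    by apply: (measurableT_comp (measurable_spec hspec)); exact: measurable_snd.
  apply: (measurableT_comp (@measurable_expR R)).
  apply: measurableT_comp => //; apply: measurable_funM => //.
  apply: measurable_funM; first exact: measurable_fst.
  by apply: measurable_funM => //; apply: measurable_dot2; exact: measurable_snd.
transitivity (((2 * pi) ^- n)%:E * \int[lebesgue_measure]_s \int[leb]_xi F (s, xi))%E.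
  rewrite -ge0_integralZl//; last 3 first.
  - exact: measurable_fun_fubini_tonelli_F.
  - by move=> s _; exact: integral_ge0.
  - by rewrite lee_fin pin_ge0.
  rewrite [LHS]integral_mkcond; apply: eq_integral => s _; rewrite patchE.
  rewrite /F/= indicE; case: ifPn => sA; last first.
    under eq_integral do rewrite mul0r.
    by rewrite integral0 mule0.
  have s0 : 0 <= s by move: sA; rewrite inE/= in_itv/= andbT.
  under eq_integral do rewrite mul1r.
  rewrite /gcov EFinM; congr (_ * _)%E; rewrite /Rintegral fineK//.
  apply: integrable_fin_num => //; apply: (spec_mul_integrable hspec).
  exact: bm_gauss_weight.
congr (_ * _)%E; rewrite (fubini_tonelli F mF F0).
apply: ae_eq_integral => //.
- exact: measurable_fun_fubini_tonelli_G.
(* At the origin the weight does not decay in time, while [E] takes the value 0 by the convention on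
   division; the identity is only claimed elsewhere. *)
- exists [set 0]; split; [exact: measurable_rV0|exact: lebesgue_rV0|].
  move=> xi /=; apply: contra_notP => /eqP xi0 _.
  have d0 := dot_gt0 xi0.
  pose c := e^-1 ^+ 2 * dot xi xi / 2.
  have c0 : 0 < c by rewrite divr_gt0// mulr_gt0// exprn_gt0// invr_gt0.
  transitivity ((spec xi)%:E * (c^-1)%:E)%E; last first.
    rewrite /E -EFinM -dot_enorm; congr (_ * _)%:E.
    by rewrite /c; field; rewrite !gt_eqF.
  rewrite -integral_expR_decay// -ge0_integralZl//; last 2 first.
  - apply: measurable_funTS; apply/measurable_EFinP.
    apply: (measurableT_comp (@measurable_expR R)).
    by apply: measurableT_comp => //; exact: measurable_funM.
  - by rewrite lee_fin (spec_ge0 hspec).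
  rewrite [RHS]integral_mkcond; apply: eq_integral => s _.
  rewrite /F/= patchE indicE; case: ifPn => _; last by rewrite mul0r.
  by rewrite mul1r -EFinM /w mulrC /c !mulrA.
Qed.

Variables (K e : R).
Hypothesis e0 : 0 < e.
Hypothesis K0 : 0 < K.
Local Notation p := (beta / 2).
Hypothesis gauss_le : forall s (y : 'rV[R]_n), 0 <= s ->
  \int[gauss_rV n s]_z `|cov (e^-1 *: (y + z))| <= K * pw (e ^+ 2) (- p) s.

Lemma gcov_le s : 0 <= s -> gcov spec e s <= K * pw (e ^+ 2) (- p) s.
Proof.
move=> s0; rewrite -(Rint_gauss_cov hspec)//; apply: le_trans (gauss_le 0 s0).
have b : bm (fun z : 'rV[R]_n => cov (e^-1 *: z)).
  by apply: (bm_comp (bm_cov hspec)); exact: measurable_scale.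
apply: le_Rint => //.
- by under eq_fun do rewrite add0r; exact: bm_norm.
- by move=> z; rewrite add0r ler_norm.
Qed.

(** No estimate of [spec] near the origin is made: up to a positive factor the integral is the time
    integral of [gcov], whose decay exponent [beta / 2] exceeds 1. *)
Lemma integral_spec_over_sqr_finite :
  (\int[leb]_xi (spec xi / enorm xi ^+ 2)%:E < +oo)%E.
Proof.
have /andP[b2 bn] := hbeta.
have e20 : 0 < e ^+ 2 by rewrite exprn_gt0.
have pn0 : 0 < (2 * pi : R) ^- n by rewrite invr_gt0 exprn_gt0// mulr_gt0 ?pi_gt0.
have pull (c : R) (X : \bar R) : 0 < c -> (c%:E * X < +oo -> X < +oo)%E.
  by move=> c0; rewrite !ltey; apply: contra_neq => ->; rewrite gt0_muley.
apply: (pull (2 * e ^+ 2)); first by rewrite mulr_gt0.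
rewrite -integral_E; apply: pull pn0 _.
have mpw : measurable_fun `[(0 : R), +oo[ (fun s : R => (pw (e ^+ 2) (- p) (0 + s))%:E).
  apply/measurable_EFinP; apply: subspace_continuous_measurable_fun => //.
  exact: continuous_within_pw.
rewrite -integral_gcov_ereal//.
apply: (@le_lt_trans _ _ (\int[lebesgue_measure]_(s in `[0%R, +oo[) (K%:E * (pw (e ^+ 2) (- p) (0 + s))%:E))%E).
  apply: ge0_le_integral => //.
  - by move=> s _; rewrite lee_fin (gcov_ge0 hspec).
  - apply: (@eq_measurable_fun _ _ _ _ _ (fun s : R => (gcov spec e `|s|)%:E)).
      by move=> s; rewrite inE/= in_itv/= andbT => s0; rewrite ger0_norm.
    by apply: measurable_funTS; apply/measurable_EFinP; exact: measurable_gcov_norm.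
  - exact: measurable_funeM.
  - move=> s /=; rewrite in_itv/= andbT => s0.
    by rewrite -EFinM lee_fin add0r gcov_le.
rewrite ge0_integralZl//; last 2 first.
- by move=> s _; rewrite lee_fin pw_ge0.
- by rewrite lee_fin ltW.
rewrite integral_pw_tail//; first by rewrite -EFinM ltry.
by rewrite ltr_pdivlMr// mul1r.
Qed.

(** This is where the 4 in [sigma2] is matched: half of it is the 2 in the time integral
    [2 e^2 / |xi|^2], and the other half is the 2 dividing the right-hand side. *)
Lemma integral_gcov : (\int[lebesgue_measure]_(s in `[0%R, +oo[) (gcov spec e s)%:E =
  (e ^+ 2 * sigma2 spec / 2)%:E)%E.
Proof.
rewrite integral_gcov_ereal// integral_E.
rewrite -[X in (_ * (_ * X))%E]fineK; last first.
  rewrite ge0_fin_numE; first exact: integral_spec_over_sqr_finite.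
  by apply: integral_ge0 => xi _; rewrite lee_fin.
rewrite -!EFinM /sigma2 /Rintegral; congr (_%:E).
by set a := (2 * pi) ^- n; field.
Qed.

End spectral_variance.

(** * Time averages *)

Lemma ge0_integral_norm (R : realType) (h : R -> R) :
  measurable_fun setT (fun u : R => h `|u|) -> (forall u : R, 0 <= h `|u|) ->
  (\int[@lebesgue_measure R]_x (h `|x|)%:E =
   2%:E * \int[lebesgue_measure]_(x in `[0%R, +oo[) (h `|x|)%:E)%E.
Proof.
move=> mh h0; have mE : measurable_fun setT (fun u : R => (h `|u|)%:E) by exact/measurable_EFinP.
have -> : [set: R] = `[0, +oo[%classic `|` `]-oo, 0[%classic.
  apply/seteqP; split => x //= _; rewrite !in_itv/= andbT.
  by have [|] := leP 0 x; [left|right].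
rewrite ge0_integral_setU//; last 3 first.
- by apply: measurable_funTS.
- by move=> x _; rewrite lee_fin.
- apply/disj_setPS => x /=; rewrite !in_itv/= andbT => -[x0 x1].
  by move: (lt_le_trans x1 x0); rewrite ltxx.
rewrite mule_natl mule2n; congr (_ + _)%E.
rewrite integral_itv_bndo_bndc; last exact: measurable_funTS.
rewrite [RHS](@ge0_integration_by_substitution0 _ (fun x => (h `|x|)%:E))//.
by apply: eq_integral => x _; rewrite normrN.
Qed.

Definition unif (R : realType) (t : R) (t0 : 0 < t) : probability (measurableTypeR R) R :=
  [the probability (measurableTypeR R) R of uniform_prob t0].

Section uniform_time.
Context (R : realType) (t k p : R).
Hypotheses (t0 : 0 < t) (k0 : 0 < k) (p1 : 1 < p).
Local Notation U := (unif t0).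
Local Notation cl := (clamp t).

Lemma measurable_pw q : measurable_fun setT (pw k q).
Proof.
apply: (measurableT_comp (measurable_powR q)).
by apply: measurable_funD => //; exact: measurable_funM.
Qed.

Lemma bm_pw d (T : measurableType d) q (g : T -> R) : q <= 0 ->
  measurable_fun setT g -> (forall x, 0 <= g x) -> bm (fun x => pw k q (g x)).
Proof.
move=> q0 mg g0; apply: (@ge0_bm _ _ _ _ 1).
  exact: (measurableT_comp (measurable_pw q)).
by move=> x; rewrite pw_ge0 pw_le1.
Qed.

Local Notation phi := (pw k (- p)).
Local Notation chi := (pw k (1 - p)).

Let p0 : - p <= 0.
Proof. by rewrite oppr_le0 (le_trans _ (ltW p1)). Qed.

Let p10 : 1 - p <= 0.
Proof. by rewrite subr_le0 ltW. Qed.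

(** The integral of [phi] over [[0, +oo[], by [integral_pw_tail] at [a = 0]. *)
Definition mass : R := k / (p - 1).

Lemma mass_gt0 : 0 < mass.
Proof. by rewrite divr_gt0// subr_gt0. Qed.

(** [t * ell] is the integral of [chi] over [[0, t]]; with [k = e ^ 2] and [p = beta / 2] it has the
    size of the squared rate. *)
Definition ell : R := \int[U]_s chi (cl s).

Lemma bm_clamp (h : R -> R) : measurable_fun setT h ->
  (exists M, forall s, 0 <= s <= t -> `|h s| <= M) -> bm (fun s : measurableTypeR R => h (cl s)).
Proof.
move=> mh [M hM]; split; first exact: (measurableT_comp mh (measurable_clamp t)).
by exists M => s; apply: hM; rewrite clamp_ge0 clamp_le// ltW.
Qed.

Lemma mean_clamp (h : R -> R) : measurable_fun setT h -> (forall s, 0 <= h s) ->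
  bm (fun s : measurableTypeR R => h (cl s)) ->
  (\int[U]_s h (cl s))%:E = ((t^-1)%:E * \int[lebesgue_measure]_(s in `[0%R, t]) (h s)%:E)%E.
Proof.
move=> mh h0 bh; rewrite EFin_Rint; last exact: bm_integrable.
rewrite (@integral_uniform _ _ _ t0)//; last first.
- by move=> s; rewrite lee_fin.
- by apply/measurable_EFinP; exact: bm_measurable bh.
rewrite subr0; congr (_ * _)%E; apply: eq_integral => s.
by rewrite inE/= in_itv/= => st; rewrite clamp_id.
Qed.

Lemma ell_ge0 : 0 <= ell.
Proof. by apply: Rintegral_ge0 => s _; exact: pw_ge0. Qed.

Lemma mean_clamp_le (h : R -> R) (b : R) : measurable_fun setT h -> (forall s, 0 <= h s) ->
  bm (fun s : measurableTypeR R => h (cl s)) ->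
  (\int[@lebesgue_measure R]_s (h s)%:E <= b%:E)%E ->
  \int[U]_s h (cl s) <= b / t.
Proof.
move=> mh h0 bh hb; rewrite -lee_fin mean_clamp// [leRHS]EFinM muleC.
apply: lee_pmul => //.
- by apply: integral_ge0 => s _; rewrite lee_fin.
- by rewrite lee_fin invr_ge0 ltW.
apply: le_trans hb; apply: ge0_subset_integral => //.
- exact/measurable_EFinP.
- by move=> s _; rewrite lee_fin.
Qed.

Let mnorm (a b : R) : measurable_fun setT (fun s : R => a + `|s - b|).
Proof.
apply: measurable_funD => //; apply: measurableT_comp => //.
exact: measurable_funB.
Qed.

Lemma integral_phi_shift (a b : R) : 0 <= a ->
  (\int[@lebesgue_measure R]_s (phi (a + `|s - b|))%:E = (2 * mass * chi a)%:E)%E.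
Proof.
move=> a0.
have m0 : measurable_fun setT (fun s : R => phi (a + `|s|)).
  apply: (measurableT_comp (measurable_pw (- p))).
  by apply: measurable_funD => //; exact: measurableT_comp.
rewrite (@ge0_integral_shift _ (- b) (fun s => (phi (a + `|s|))%:E)); last 2 first.
- exact/measurable_EFinP.
- by move=> s; rewrite lee_fin pw_ge0.
rewrite (@ge0_integral_norm _ (fun u => phi (a + u)))//; last by move=> u; exact: pw_ge0.
rewrite -mulrA EFinM /mass -(integral_pw_tail k0 p1 a0); congr (_ * _)%E.
apply: eq_integral => s; rewrite inE/= in_itv/= andbT => s0; rewrite ger0_norm//.
Qed.

(** One average over time gains [mass / t] and leaves the weaker profile [chi] of the offset [a], to
    be averaged in turn. *)
Lemma mean_phi_sum (a b : R) : 0 <= a ->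
  \int[U]_s phi (a + `|cl s - b|) <= 2 * mass / t * chi a.
Proof.
move=> a0; rewrite -mulrA [_^-1 * _]mulrC mulrA.
have mphi : measurable_fun setT (fun s : R => phi (a + `|s - b|)).
  by apply: (measurableT_comp (measurable_pw (- p))); exact: mnorm.
apply: (@mean_clamp_le (fun s => phi (a + `|s - b|))) => //.
- by move=> s; exact: pw_ge0.
- apply: (@bm_clamp (fun s => phi (a + `|s - b|))) => //; exists 1 => s _.
  by rewrite ger0_norm ?pw_ge0// pw_le1// addr_ge0.
- by rewrite integral_phi_shift.
Qed.

Lemma mean_phi (b : R) : \int[U]_s phi `|cl s - b| <= 2 * mass / t.
Proof.
have := mean_phi_sum b (lexx 0); rewrite pw0 mulr1.
by under eq_Rint do rewrite add0r.
Qed.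

(** Unlike [phi], [chi] need not be integrable on the line, so the window cannot be dropped. Instead
    [chi |s - b|] is dominated by a translate of [g], which lives on [[0, t]], plus a reflected
    translate. *)
Lemma mean_chi (b : R) : 0 <= b <= t -> \int[U]_s chi `|cl s - b| <= 2 * ell.
Proof.
move=> /andP[b0 bt].
pose g (u : R) : \bar R := (\1_(`[0, t]%classic : set R) u * chi `|u|)%:E.
have mg : measurable_fun setT g.
  apply/measurable_EFinP; apply: measurable_funM.
    by apply: measurable_indic; exact: measurable_itv.
  by apply: (measurableT_comp (measurable_pw (1 - p))); exact: normr_measurable.
have g0 u : (0 <= g u)%E by rewrite lee_fin mulr_ge0 ?pw_ge0.
have ge : (\int[@lebesgue_measure R]_u g u = t%:E * ell%:E)%E.
  rewrite /ell mean_clamp; last 3 first.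
  - exact: measurable_pw.
  - by move=> s; exact: pw_ge0.
  - apply: (@ge0_bm _ _ _ _ 1).
      by apply: (measurableT_comp (measurable_pw (1 - p))); exact: measurable_clamp.
    by move=> s; rewrite pw_ge0 pw_le1// clamp_ge0.
  rewrite muleA -EFinM divff ?gt_eqF// mul1e [RHS]integral_mkcond.
  apply: eq_integral => u _; rewrite /g patchE indicE.
  case: ifPn; last by rewrite mul0r.
  by rewrite inE/= in_itv/= => /andP[u0 _]; rewrite mul1r ger0_norm.
have mc : measurable_fun setT (fun s : R => chi `|s - b|).
  apply: (measurableT_comp (measurable_pw (1 - p))); apply: measurableT_comp => //.
  exact: measurable_funB.
rewrite -lee_fin (@mean_clamp (fun s => chi `|s - b|))//; last 2 first.
- by move=> s; exact: pw_ge0.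
- apply: (@bm_clamp (fun s => chi `|s - b|)) => //; exists 1 => s _.
  by rewrite ger0_norm ?pw_ge0// pw_le1.
have -> : (2 * ell)%:E = ((t^-1)%:E * (t%:E * ell%:E + t%:E * ell%:E))%E.
  by rewrite -[(t%:E * ell%:E)%E]EFinM -EFinD -EFinM; congr (_%:E); field; rewrite gt_eqF.
rewrite lee_wpmul2l ?lee_fin ?invr_ge0 ?(ltW t0)//.
have mg1 : measurable_fun setT (fun s : R => g (s - b)).
  by apply: (measurableT_comp mg); exact: measurable_funB.
have mg2 : measurable_fun setT (fun s : R => g (- (s - b))).
  by apply: (measurableT_comp mg); apply: measurableT_comp => //; exact: measurable_funB.
have gN : (\int[@lebesgue_measure R]_u g (- u)%R = \int[lebesgue_measure]_u g u)%E.
  have mo : measurable_fun setT ((fun u => - u) : measurableTypeR R -> measurableTypeR R).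
    exact: oppr_measurable.
  have := @ge0_integral_pushforward _ _ (measurableTypeR R) (measurableTypeR R) R _ mo
    (@lebesgue_measure R) setT g measurableT mg (fun x _ => g0 x).
  rewrite preimage_setT => <-; apply: eq_measure_integral => A mA _.
  exact: lebesgue_measureN.
have mgN : measurable_fun setT (fun u : R => g (- u)).
  by apply: (measurableT_comp mg); exact: oppr_measurable.
have gsum : (\int[@lebesgue_measure R]_s (g (s - b)%R + g (- (s - b))%R) =
    t%:E * ell%:E + t%:E * ell%:E)%E.
  rewrite ge0_integralD; [|by []..].
  rewrite (@ge0_integral_shift _ (- b) g mg g0).
  by rewrite (@ge0_integral_shift _ (- b) (fun u => g (- u)) mgN (fun u => g0 _)) gN ge.
rewrite -gsum {gsum gN ge mgN}.
rewrite integral_mkcond; apply: ge0_le_integral => //.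
- by move=> s _; apply: erestrict_ge0 => u _; rewrite lee_fin pw_ge0.
- by apply/(measurable_restrictT _ _).1 => //; apply: measurable_funTS; exact/measurable_EFinP.
- exact: emeasurable_funD.
move=> s _; rewrite patchE; case: ifPn => [|_]; last by rewrite adde_ge0.
rewrite inE/= in_itv/= => /andP[s0 st]; rewrite /g normrN.
have [sb|sb] := leP b s.
  have i1 : \1_(`[0, t]%classic : set R) (s - b) = 1 :> R.
    rewrite indicE mem_set//= in_itv/= subr_ge0 sb/= lerBlDr.
    by rewrite (le_trans st)// lerDl.
  by rewrite i1 mul1r leeDl// lee_fin mulr_ge0 ?pw_ge0.
have i2 : \1_(`[0, t]%classic : set R) (- (s - b)) = 1 :> R.
  rewrite indicE mem_set//= in_itv/= opprB subr_ge0 (ltW sb)/= lerBlDr.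
  by rewrite (le_trans bt)// lerDl.
by rewrite i2 mul1r leeDr// lee_fin mulr_ge0 ?pw_ge0.
Qed.

Lemma mean_chi_end : \int[U]_s chi (t - cl s) <= 2 * ell.
Proof.
have := @mean_chi t; rewrite lexx (ltW t0) => /(_ isT); apply: le_trans.
rewrite le_eqVlt; apply/orP; left; apply/eqP; apply: eq_Rint => s.
by rewrite distrC ger0_norm// subr_ge0 clamp_le// ltW.
Qed.

(* [S - t * g-mean] is the mass of [g] outside the window [0, t], seen from a point of the window. *)
Lemma mean_bias (g : R -> R) (S K : R) : 0 <= K -> measurable_fun setT (fun u : R => g `|u|) ->
  (forall u, 0 <= u -> 0 <= g u <= K * phi u) ->
  (\int[lebesgue_measure]_(u in `[0%R, +oo[) (g u)%:E = (S / 2)%:E)%E ->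
  `|t * \int[(U \x U)%E]_z g `|cl z.2 - cl z.1| - S| <= 6 * K * mass * ell.
Proof.
move=> K0 mg gK gS.
have g0 (u : R) : 0 <= g `|u| by have /andP[] := gK `|u| (normr_ge0 u).
have mgb (b : R) : measurable_fun setT (fun s : R => g `|s - b|).
  by apply: (measurableT_comp mg); exact: measurable_funB.
have gle (u : R) : g `|u| <= K.
  have /andP[_ /le_trans->//] := gK `|u| (normr_ge0 u).
  by rewrite ler_piMr// pw_le1.
have gT (b : R) : (\int[@lebesgue_measure R]_s (g `|s - b|)%:E = S%:E)%E.
  rewrite (@ge0_integral_shift _ (- b) (fun s => (g `|s|)%:E)); last 2 first.
  - exact/measurable_EFinP.
  - by move=> s; rewrite lee_fin.
  rewrite ge0_integral_norm// (_ : S = 2 * (S / 2)); last by field.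
  rewrite EFinM -gS; congr (_ * _)%E; apply: eq_integral => s.
  by rewrite inE/= in_itv/= andbT => s0; rewrite ger0_norm.
have bgb (b : R) : bm (fun s : measurableTypeR R => g `|cl s - b|).
  apply: (@bm_clamp (fun s => g `|s - b|)) => //; exists K => s _.
  by rewrite ger0_norm.
have up (b : R) : t * \int[U]_s g `|cl s - b| <= S.
  have := @mean_clamp_le (fun s => g `|s - b|) S (mgb b) (fun s => g0 (s - b)) (bgb b).
  rewrite gT lexx => /(_ isT) h; rewrite mulrC -ler_pdivlMr//.
(* Outside the window the distance to [b] is [b + |s|] on the left and [t - b + |s - t|] on the
   right; each tail is then extended to the whole line. *)
have low (b : R) : 0 <= b <= t ->
    S <= t * (\int[U]_s g `|cl s - b|) + K * (2 * mass * chi b + 2 * mass * chi (t - b)).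
  move=> /andP[b0 bt].
  rewrite -lee_fin EFinD EFinM (@mean_clamp (fun s => g `|s - b|))// muleA -EFinM divff ?gt_eqF// mul1e.
  have tb0 : 0 <= t - b by rewrite subr_ge0.
  rewrite [X in (_ <= _ + X)%E]EFinM EFinD -(integral_phi_shift 0 b0) -(integral_phi_shift t tb0).
  have mphi (a c : R) : measurable_fun setT (fun s : R => (phi (a + `|s - c|))%:E).
    by apply/measurable_EFinP; apply: (measurableT_comp (measurable_pw (- p))); exact: mnorm.
  have phi0 (a c s : R) : (0 <= (phi (a + `|s - c|))%:E)%E by rewrite lee_fin pw_ge0.
  have mS : measurable_fun setT
      (fun s : R => ((phi (b + `|s - 0|))%:E + (phi (t - b + `|s - t|))%:E)%E).
    by apply: emeasurable_funD; exact: mphi.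
  have e1 : (K%:E * (\int[@lebesgue_measure R]_s (phi (b + `|s - 0|))%:E +
      \int[@lebesgue_measure R]_s (phi (t - b + `|s - t|))%:E) =
      \int[@lebesgue_measure R]_s (K%:E * ((phi (b + `|s - 0|))%:E + (phi (t - b + `|s - t|))%:E)))%E.
    rewrite [RHS]ge0_integralZl//; last first.
      by move=> s _; rewrite adde_ge0.
    by congr (_ * _)%E; rewrite ge0_integralD//; exact: mphi.
  rewrite e1 [X in (_ <= X + _)%E]integral_mkcond -ge0_integralD//; last 4 first.
  - by move=> s _; apply: erestrict_ge0 => u _; rewrite lee_fin.
  - by apply/(measurable_restrictT _ _).1 => //; apply: measurable_funTS; apply/measurable_EFinP; exact: mgb.
  - by move=> s _; apply: mule_ge0; rewrite lee_fin// addr_ge0 ?pw_ge0.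
  - by apply: measurable_funeM; exact: mS.
  rewrite -(gT b); apply: ge0_le_integral => //.
  - by move=> s _; rewrite lee_fin.
  - by apply/measurable_EFinP; exact: mgb.
  - apply: emeasurable_funD.
      by apply/(measurable_restrictT _ _).1 => //; apply: measurable_funTS; apply/measurable_EFinP; exact: mgb.
    by apply: measurable_funeM; exact: mS.
  move=> s _; rewrite patchE; case: ifPn => [_|].
    by rewrite leeDl//; apply: mule_ge0; rewrite lee_fin// addr_ge0 ?pw_ge0.
  rewrite add0e -EFinD -EFinM lee_fin => sA.
  have /andP[_ h] := gK `|s - b| (normr_ge0 _); apply: le_trans h _.
  rewrite ler_wpM2l//.
  have : (s < 0) || (t < s).
    apply: contraR sA; rewrite negb_or -!leNgt => /andP[s0 st].
    by rewrite inE/= in_itv/= s0.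
  move=> /orP[sneg|st].
    rewrite [X in phi X](_ : _ = b + `|s - 0|) ?lerDl ?pw_ge0//.
    by rewrite subr0 distrC ger0_norm ?subr_ge0 ?(le_trans (ltW sneg))// ltr0_norm.
  rewrite [X in phi X](_ : _ = t - b + `|s - t|) ?lerDr ?pw_ge0//.
  rewrite ger0_norm ?subr_ge0 ?(le_trans bt (ltW st))// ger0_norm ?subr_ge0 ?(ltW st)//; ring.
have bz : bm (fun z : measurableTypeR R * measurableTypeR R => g `|cl z.2 - cl z.1|).
  split; last by exists K => z; rewrite ger0_norm.
  apply: (measurableT_comp mg); apply: measurable_funB;
    by apply: (measurableT_comp (measurable_clamp t)).
have bI := bm_Rint U U bz.
rewrite Rint_prod//= distrC ger0_norm ?subr_ge0; last first.
  rewrite mulrC -ler_pdivlMr//; apply: Rint_le_cst => // s.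
  by rewrite ler_pdivlMr// mulrC up.
have bc1 : bm (fun s : measurableTypeR R => chi (cl s)).
  by apply: bm_pw => //; [exact: measurable_clamp|move=> s; exact: clamp_ge0].
have bc2 : bm (fun s : measurableTypeR R => chi (t - cl s)).
  apply: bm_pw => //; first by apply: measurable_funB => //; exact: measurable_clamp.
  by move=> s; rewrite subr_ge0 clamp_le// ltW.
have b2 : bm (fun s : measurableTypeR R => 2 * K * mass * (chi (cl s) + chi (t - cl s))).
  by apply: bmM; [exact: bm_cst|exact: bmD].
rewrite lerBlDl.
apply: (@le_trans _ _ (\int[U]_s (t * (\int[U]_y g `|cl y - cl s|) + 2 * K * mass * (chi (cl s) + chi (t - cl s))))).
  rewrite -[leLHS](Rint_cst U); apply: le_Rint; first exact: bm_cst.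
    by apply: bmD => //; apply: bmM => //; exact: bm_cst.
  move=> s; have := low (cl s); rewrite clamp_ge0 clamp_le ?(ltW t0)// => /(_ isT).
  by move/le_trans; apply; rewrite le_eqVlt; apply/orP; left; apply/eqP; ring.
rewrite RintD//; last by apply: bmM => //; exact: bm_cst.
rewrite RintZl// lerD2l RintZl; last exact: bmD.
rewrite RintD//.
have Xl := mean_chi_end.
have := mass_gt0; have := ell_ge0.
move=> l0 M0.
(* The left tail averages to [ell] and the right one to at most [2 * ell], whence 6 = 2 * (1 +
   2). *)
rewrite (_ : 6 * K * mass * ell = 2 * K * mass * (ell + 2 * ell)); last by ring.
rewrite -/ell; apply: ler_wpM2l; last by rewrite lerD2l.
by apply: mulr_ge0; [exact: mulr_ge0|exact: ltW].
Qed.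

End uniform_time.

(** Bundled as a probability so that the Fubini lemmas can be iterated on products of products. *)
Definition pairp d1 d2 (T1 : measurableType d1) (T2 : measurableType d2) (R : realType)
    (P1 : probability T1 R) (P2 : probability T2 R) : probability (T1 * T2)%type R :=
  [the probability (T1 * T2)%type R of (P1 \x P2)%E].

Lemma Rint_pair d1 d2 (T1 : measurableType d1) (T2 : measurableType d2) (R : realType)
    (P1 : probability T1 R) (P2 : probability T2 R) (f : T1 * T2 -> R) : bm f ->
  \int[pairp P1 P2]_z f z = \int[P1]_x \int[P2]_y f (x, y).
Proof. exact: Rint_prod. Qed.

Lemma measurable_dist d (T : measurableType d) (R : realType) (f g : T -> R) :
  measurable_fun setT f -> measurable_fun setT g ->
  measurable_fun setT (fun z => `|f z - g z|).
Proof. by move=> mf mg; apply: measurableT_comp => //; exact: measurable_funB. Qed.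

(** The larger of [a] and [b] is at least their mean, and halving the argument costs [2 ^ p]. Two
    separate bounds thus become one kernel in which both lengths can be integrated. *)
Lemma le_pw_sum (R : realType) (k p X C a b : R) : 0 < k -> 0 <= p -> 0 <= C ->
  0 <= a -> 0 <= b -> X <= C * pw k (- p) a -> X <= C * pw k (- p) b ->
  X <= C * 2 `^ p * pw k (- p) (a + b).
Proof.
move=> k0 p0 C0 a0 b0 Xa Xb.
have Xm : X <= C * pw k (- p) (Num.max a b) by have [|] := leP a b.
apply: (le_trans Xm); rewrite -mulrA ler_wpM2l//.
have ab0 : 0 <= (a + b) / 2 by rewrite divr_ge0// addr_ge0.
apply: (@le_trans _ _ (pw k (- p) ((a + b) / 2))).
  apply: pw_anti; rewrite ?oppr_le0// ler_pdivrMr// mulr_natr mulr2n.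
  by rewrite lerD// le_max lexx ?orbT.
rewrite /pw !powRN -ler_pdivrMl ?powR_gt0// -invfM lef_pV2 ?posrE; last 2 first.
- by rewrite mulr_gt0 ?powR_gt0// ltr_pwDl// divr_ge0 ?(ltW k0).
- by rewrite powR_gt0// ltr_pwDl// divr_ge0 ?(ltW k0)// addr_ge0.
have q0 : 0 <= 1 + (a + b) / 2 / k by rewrite addr_ge0// divr_ge0 ?(ltW k0).
rewrite -powRM//; apply: ge0_ler_powR; rewrite ?nnegrE ?mulr_ge0//.
  by rewrite addr_ge0// divr_ge0 ?(ltW k0)// addr_ge0.
rewrite (_ : 2 * (1 + _) = 2 + (a + b) / k); last by field; rewrite gt_eqF.
by rewrite lerD2r ler1n.
Qed.

(** * Averages of the covariance kernels over two or four times *)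

Section time_kernels.
Context (R : realType) (t k p : R).
Hypotheses (t0 : 0 < t) (k0 : 0 < k) (p1 : 1 < p).
Local Notation U := (unif t0).
Local Notation cl := (clamp t).
Local Notation phi := (pw k (- p)).
Local Notation chi := (pw k (1 - p)).
Local Notation M := (2 * mass k p / t).
Local Notation ell := (ell k p t0).
Local Notation RR := (measurableTypeR R).

Let p0 : - p <= 0.
Proof. by rewrite oppr_le0 (le_trans _ (ltW p1)). Qed.

Let p10 : 1 - p <= 0.
Proof. by rewrite subr_le0 ltW. Qed.

Let M0 : 0 <= M.
Proof. by rewrite divr_ge0 ?(ltW t0)// mulr_ge0// ltW// mass_gt0. Qed.

Let mc d (T : measurableType d) (g : T -> R) :
  measurable_fun setT g -> measurable_fun setT (fun z => cl (g z)).
Proof. by move=> mg; apply: (measurableT_comp (measurable_clamp t)). Qed.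

Let m1 : measurable_fun setT (fun z : RR * RR => cl z.1).
Proof. by apply: mc; exact: measurable_fst. Qed.

Let m2 : measurable_fun setT (fun z : RR * RR => cl z.2).
Proof. by apply: mc; exact: measurable_snd. Qed.

Let m11 : measurable_fun setT (fun z : (RR * RR) * (RR * RR) => cl z.1.1).
Proof. by apply: mc; apply: measurableT_comp; [exact: measurable_fst|exact: measurable_fst]. Qed.
Let m12 : measurable_fun setT (fun z : (RR * RR) * (RR * RR) => cl z.1.2).
Proof. by apply: mc; apply: measurableT_comp; [exact: measurable_snd|exact: measurable_fst]. Qed.
Let m21 : measurable_fun setT (fun z : (RR * RR) * (RR * RR) => cl z.2.1).
Proof. by apply: mc; apply: measurableT_comp; [exact: measurable_fst|exact: measurable_snd]. Qed.
Let m22 : measurable_fun setT (fun z : (RR * RR) * (RR * RR) => cl z.2.2).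
Proof. by apply: mc; apply: measurableT_comp; [exact: measurable_snd|exact: measurable_snd]. Qed.

Lemma bm_phi d (T : measurableType d) (g : T -> R) :
  measurable_fun setT g -> (forall x, 0 <= g x) -> bm (fun x => phi (g x)).
Proof. exact: bm_pw. Qed.

Lemma bm_chi d (T : measurableType d) (g : T -> R) :
  measurable_fun setT g -> (forall x, 0 <= g x) -> bm (fun x => chi (g x)).
Proof. exact: bm_pw. Qed.

Let cl_in s : 0 <= cl s <= t.
Proof. by rewrite clamp_ge0 clamp_le// ltW. Qed.

Lemma mean_phi_pair (v u : R) : 0 <= v <= t ->
  \int[pairp U U]_z phi (`|cl z.1 - v| + `|cl z.2 - u|) <= 2 * M * ell.
Proof.
move=> vt.
have b : bm (fun z : RR * RR => phi (`|cl z.1 - v| + `|cl z.2 - u|)).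
  apply: bm_phi; last by move=> z; exact: addr_ge0.
  by apply: measurable_funD; apply: measurable_dist.
rewrite Rint_pair//=.
have bc : bm (fun r : RR => chi `|cl r - v|).
  by apply: bm_chi => //; apply: measurable_dist => //; exact: mc.
apply: (@le_trans _ _ (\int[U]_r (M * chi `|cl r - v|))).
  apply: le_Rint; first exact: (bm_Rint U U b).
    by apply: bmM => //; exact: bm_cst.
  by move=> r; exact: mean_phi_sum.
rewrite RintZl; last exact: bc.
by rewrite (mulrC 2 M) -(mulrA M 2 ell); apply: ler_wpM2l => //; exact: mean_chi.
Qed.

Lemma mean_phi_chain (v : R) : 0 <= v <= t ->
  \int[pairp U U]_z phi (`|cl z.1 - v| + `|cl z.2 - cl z.1|) <= 2 * M * ell.
Proof.
move=> vt.
have b : bm (fun z : RR * RR => phi (`|cl z.1 - v| + `|cl z.2 - cl z.1|)).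
  apply: bm_phi; last by move=> z; exact: addr_ge0.
  by apply: measurable_funD; apply: measurable_dist.
rewrite Rint_pair//=.
have bc : bm (fun r : RR => chi `|cl r - v|).
  by apply: bm_chi => //; apply: measurable_dist => //; exact: mc.
apply: (@le_trans _ _ (\int[U]_r (M * chi `|cl r - v|))).
  apply: le_Rint; first exact: (bm_Rint U U b).
    by apply: bmM => //; exact: bm_cst.
  by move=> r; exact: mean_phi_sum.
rewrite RintZl; last exact: bc.
by rewrite (mulrC 2 M) -(mulrA M 2 ell); apply: ler_wpM2l => //; exact: mean_chi.
Qed.

(* [kern1] bounds the covariance of overlapping increments, [kern2] that of nested ones. *)
Definition kern1 (z : (RR * RR) * (RR * RR)) : R :=
  phi `|cl z.1.1 - cl z.2.1| * phi (`|cl z.1.2 - cl z.2.1| + `|cl z.2.2 - cl z.1.2|).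

Definition kern2 (z : (RR * RR) * (RR * RR)) : R :=
  phi (`|cl z.1.1 - cl z.2.1| + `|cl z.1.2 - cl z.2.2|) * phi `|cl z.2.2 - cl z.2.1|.

Lemma bm_kern1 : bm kern1.
Proof.
apply: bmM; apply: bm_phi => //; first exact: measurable_dist.
by apply: measurable_funD; exact: measurable_dist.
Qed.

Lemma bm_kern2 : bm kern2.
Proof.
apply: bmM; apply: bm_phi => //; last exact: measurable_dist.
by apply: measurable_funD; exact: measurable_dist.
Qed.

Local Notation UU := (pairp U U).

(** With the second pair of times fixed, the first pair averages to at most [2 * M * ell]; the
    remaining [phi] of the second pair gives one more [M]. *)
Lemma integral_kern2 : \int[(UU \x UU)%E]_z kern2 z <= 2 * M ^+ 2 * ell.
Proof.
rewrite Rint_prod_swap; last exact: bm_kern2.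
have bs := bm_swap bm_kern2; rewrite Rint_prod//.
have bq : bm (fun q : RR * RR => phi `|cl q.2 - cl q.1|).
  by apply: bm_phi => //; exact: measurable_dist.
apply: (@le_trans _ _ (\int[UU]_q (2 * M * ell * phi `|cl q.2 - cl q.1|))).
  apply: le_Rint; first exact: (bm_Rint UU UU bs).
    by apply: bmM => //; exact: bm_cst.
  move=> q; rewrite /kern2/= RintZr; last first.
    apply: bm_phi; last by move=> z; exact: addr_ge0.
    by apply: measurable_funD; apply: measurable_dist.
  by rewrite ler_wpM2r ?pw_ge0// mean_phi_pair.
rewrite RintZl// (_ : 2 * M ^+ 2 * ell = 2 * M * ell * M); last by ring.
apply: ler_wpM2l; first by rewrite mulr_ge0 ?ell_ge0// mulr_ge0.
rewrite Rint_pair//=; apply: Rint_le_cst; first exact: (bm_Rint U U bq).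
by move=> s; exact: mean_phi.
Qed.

(** The first time occurs only in the first factor and gives [M]. The other three form a chain v, s,
    u, averaged from its far end by [mean_phi_chain]. *)
Lemma integral_kern1 : \int[(UU \x UU)%E]_z kern1 z <= 2 * M ^+ 2 * ell.
Proof.
rewrite Rint_prod_swap; last exact: bm_kern1.
have bs := bm_swap bm_kern1; rewrite Rint_prod//.
pose H (q : RR * RR) := \int[U]_s phi (`|cl s - cl q.1| + `|cl q.2 - cl s|).
have b3 : bm (fun z : (RR * RR) * RR => phi (`|cl z.2 - cl z.1.1| + `|cl z.1.2 - cl z.2|)).
  apply: bm_phi; last by move=> z; exact: addr_ge0.
  have n1 : measurable_fun setT (fun z : (RR * RR) * RR => cl z.1.1).
    by apply: mc; apply: measurableT_comp; [exact: measurable_fst|exact: measurable_fst].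
  have n2 : measurable_fun setT (fun z : (RR * RR) * RR => cl z.1.2).
    by apply: mc; apply: measurableT_comp; [exact: measurable_snd|exact: measurable_fst].
  have n3 : measurable_fun setT (fun z : (RR * RR) * RR => cl z.2).
    by apply: mc; exact: measurable_snd.
  by apply: measurable_funD; apply: measurable_dist.
have bH : bm H by exact: (bm_Rint UU U b3).
apply: (@le_trans _ _ (\int[UU]_q (M * H q))).
  apply: le_Rint; first exact: (bm_Rint UU UU bs).
    by apply: bmM => //; exact: bm_cst.
  move=> q; rewrite /kern1/=.
  change (\int[(U \x U)%E]_z (phi `|cl z.1 - cl q.1| * phi (`|cl z.2 - cl q.1| + `|cl q.2 - cl z.2|))
    <= M * H q).
  rewrite (@Rint_outer _ _ _ _ _ U U (fun r => phi `|cl r - cl q.1|)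
    (fun s => phi (`|cl s - cl q.1| + `|cl q.2 - cl s|))).
  - by apply: ler_wpM2r; [apply: Rintegral_ge0 => s _; exact: pw_ge0|exact: mean_phi].
  - by apply: bm_phi => //; apply: measurable_dist => //; exact: mc.
  - exact: (bm_slice q b3).
rewrite RintZl// (_ : 2 * M ^+ 2 * ell = M * (2 * M * ell)); last by ring.
apply: ler_wpM2l => //; rewrite Rint_pair//=.
apply: Rint_le_cst; first exact: (bm_Rint U U bH).
move=> v; rewrite /H/=.
have b2 : bm (fun z : RR * RR => phi (`|cl z.1 - cl v| + `|cl z.2 - cl z.1|)).
  apply: bm_phi; last by move=> z; exact: addr_ge0.
  by apply: measurable_funD; apply: measurable_dist.
rewrite -(@Rint_swap _ _ _ _ _ U U (fun z => phi (`|cl z.1 - cl v| + `|cl z.2 - cl z.1|)))//.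
by rewrite -(Rint_pair U U b2) mean_phi_chain.
Qed.

Lemma mean_phi_sum2 : \int[UU]_z phi (cl z.1 + cl z.2) <= M * ell.
Proof.
have b : bm (fun z : RR * RR => phi (cl z.1 + cl z.2)).
  apply: bm_phi; last by move=> z; rewrite addr_ge0 ?clamp_ge0.
  exact: measurable_funD.
rewrite Rint_pair//=.
have bc : bm (fun r : RR => chi (cl r)).
  by apply: bm_chi => [|s]; [exact: mc|exact: clamp_ge0].
rewrite /ell -RintZl//; apply: le_Rint; first exact: (bm_Rint U U b).
  by apply: bmM => //; exact: bm_cst.
move=> r; have := @mean_phi_sum _ _ _ _ t0 k0 p1 (cl r) 0 (clamp_ge0 _ _).
by under eq_Rint do rewrite subr0 (ger0_norm (clamp_ge0 _ _)).
Qed.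

End time_kernels.

(** * The three regimes of the rate *)

Section mean_chi_rate.
Context (R : realType).

Lemma ell_lebesgue (t k p : R) (t0 : 0 < t) : 0 < k -> 1 < p ->
  (t * ell k p t0)%:E =
  (\int[lebesgue_measure]_(s in `[0%R, t]) (pw k (1 - p) s)%:E)%E.
Proof.
move=> k0 p1; rewrite EFinM /ell (mean_clamp t0).
- by rewrite muleA -EFinM divff ?gt_eqF// mul1e.
- exact: measurable_pw.
- by move=> s; exact: pw_ge0.
- apply: bm_pw => //; first by rewrite subr_le0 ltW.
    exact: measurable_clamp.
  by move=> s; exact: clamp_ge0.
Qed.

(** The integral of [(1 + s / e^2) ^ (1 - p)] over [[0, t]] is dominated by large times when
    [p < 2], converges when [p > 2], and is logarithmic when [p = 2]. *)
Lemma mean_chi_rate (beta : R) : 2 < beta -> exists C : R, 0 < C /\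
  forall (e t : R) (t0 : 0 < t), 0 < e <= 1 / 2 ->
  t * ell (e ^+ 2) (beta / 2) t0 <= C * (1 + t) * rate_high beta e ^+ 2.
Proof.
move=> b2; set p := beta / 2.
have p1 : 1 < p by rewrite ltr_pdivlMr// mul1r.
(* The first summand serves [p <> 2] and vanishes at [p = 2], the inverse of 0 being 0; the other
   two serve the logarithmic case. *)
pose C1 := `|2 - p|^-1 + 2 + (ln (2 : R))^-1.
have ln20 : 0 < ln (2 : R) by rewrite ln_gt0// ltr1n.
have c0 : 0 <= `|2 - p|^-1 by rewrite invr_ge0.
have l0 : 0 < (ln (2 : R))^-1 by rewrite invr_gt0.
exists C1; split; first by rewrite /C1 ltr_pwDr// addr_ge0.
move=> e t t0 /andP[e0 eh].
have k0 : 0 < e ^+ 2 by rewrite exprn_gt0.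
have e1 : e <= 1 by rewrite (le_trans eh)// ler_pdivrMr// mul1r ler1n.
have k1 : e ^+ 2 <= 1 by rewrite expr_le1// ltW.
have t1 : 1 <= 1 + t by rewrite lerDl ltW.
have C1a : `|2 - p|^-1 <= C1 by rewrite /C1; lra.
have C1b : 2 + (ln 2)^-1 <= C1 by rewrite /C1; lra.
set rt := rate_high beta e.
have fin (Y : R) : Y <= `|2 - p|^-1 * ((1 + t) * rt ^+ 2) -> Y <= C1 * (1 + t) * rt ^+ 2.
  move=> h; apply: (le_trans h); rewrite -mulrA ler_wpM2r// mulr_ge0 ?sqr_ge0//.
  exact: le_trans t1.
rewrite -lee_fin ell_lebesgue//.
have [b4|b4|b4] := ltgtP beta 4.
- have p2 : p < 2 by rewrite ltr_pdivrMr// -natrM.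
  have p20 : 0 < 2 - p by rewrite subr_gt0.
  rewrite integral_pw_segment//; last by rewrite addrAC gt_eqF.
  rewrite lee_fin; apply: fin; rewrite (_ : 1 - p + 1 = 2 - p); last by ring.
  rewrite gtr0_norm//.
  rewrite [_ / _]mulrC -mulrA ler_pM2l ?invr_gt0//.
  apply: (@le_trans _ _ (e ^+ 2 * pw (e ^+ 2) (2 - p) t)).
    by rewrite ler_pM2l// lerBlDr lerDl.
  rewrite /rt /rate_high b4 -/p.
  have q0 : 0 < 1 + t / e ^+ 2 by rewrite ltr_pwDl// divr_ge0 ?(ltW t0)// ltW.
  (* The powers of [e] combine to [2 - 2 (2 - p) = 2 (p - 1)], the square of the rate. *)
  have -> : e ^+ 2 * pw (e ^+ 2) (2 - p) t = (e `^ (p - 1)) ^+ 2 * (e ^+ 2 + t) `^ (2 - p).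
    rewrite /pw (_ : e ^+ 2 + t = e ^+ 2 * (1 + t / e ^+ 2)); last by field; rewrite gt_eqF.
    rewrite powRM ?(ltW k0) ?(ltW q0)// mulrA; congr (_ * _).
    rewrite -!powR_mulrn ?powR_ge0 ?(ltW e0)// -!powRrM -powRD; last by apply/implyP => _; rewrite gt_eqF.
    by congr (_ `^ _); ring.
  rewrite mulrC ler_wpM2r ?sqr_ge0//.
  apply: (@le_trans _ _ ((1 + t) `^ (2 - p))).
    apply: ge0_ler_powR; rewrite ?nnegrE.
    - exact: ltW.
    - by apply: addr_ge0; exact: ltW.
    - by apply: addr_ge0 => //; exact: ltW.
    - by rewrite lerD2r.
  by apply: ler1_powR => //; lra.
- have p2 : 2 < p by rewrite ltr_pdivlMr// -natrM.
  have p20 : 2 - p < 0 by rewrite subr_lt0.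
  rewrite integral_pw_segment//; last by rewrite addrAC lt_eqF.
  rewrite lee_fin; apply: fin; rewrite (_ : 1 - p + 1 = 2 - p); last by ring.
  rewrite ltr0_norm// /rt /rate_high ltNge (ltW b4)/= gt_eqF//.
  rewrite (_ : e ^+ 2 / (2 - p) * _ = (- (2 - p))^-1 * (e ^+ 2 * (1 - pw (e ^+ 2) (2 - p) t))); last first.
    by field; rewrite lt_eqF.
  rewrite ler_pM2l; last by rewrite invr_gt0 oppr_gt0.
  apply: (@le_trans _ _ (e ^+ 2)); last by rewrite ler_peMl// ltW.
  by rewrite ler_piMr ?(ltW k0)// lerBlDr lerDl pw_ge0.
- have p2 : p = 2 by rewrite /p b4; field.
  have L0 : ln 2 <= `|ln e|.
    rewrite ltr0_norm; last by rewrite ln_lt0// e0 (le_lt_trans eh)// ltr_pdivrMr// mul1r ltr1n.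
    rewrite -lnV ?posrE// ler_ln ?posrE ?invr_gt0//.
    by rewrite -[leLHS]invrK lef_pV2 ?posrE// ?invr_gt0// -[2^-1]mul1r.
  rewrite /rt /rate_high b4 ltxx eqxx exprMn sqr_sqrtr//.
  have -> : 1 - p = -1 by rewrite p2; ring.
  have dF (x : R) : 0 <= x -> is_derive x 1 (fun s => e ^+ 2 * ln (1 + s / e ^+ 2)) (pw (e ^+ 2) (-1) x).
    move=> x0.
    have b0 : 0 < 1 + x / e ^+ 2 by rewrite (lt_le_trans ltr01)// pw_base.
    have d1 : is_derive x 1 (fun u : R => 1 + u / e ^+ 2) ((e ^+ 2)^-1).
      by apply: is_derive_eq; rewrite /GRing.scale/=; ring.
    have d2 := @is_derive1_comp _ (fun x => ln x) (fun u => 1 + u / e ^+ 2) x _ _ (is_derive1_ln b0) d1.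
    have d3 := @is_deriveZ _ _ _ _ (e ^+ 2) _ _ _ d2.
    apply: (is_derive_eq d3); rewrite /pw powR_inv1 ?(ltW b0)// /GRing.scale/=.
    by rewrite mulrCA divff ?mulr1// gt_eqF.
  rewrite (continuous_FTC2 (F := fun s => e ^+ 2 * ln (1 + s / e ^+ 2)))//; last 3 first.
  + have c := @continuous_within_pw R (e ^+ 2) (-1) 0 k0 (lexx 0).
    have sub : `[(0 : R), t]%classic `<=` `[0, +oo[%classic by apply: subset_itvl.
    have := continuous_subspaceW sub c.
    by rewrite (_ : (fun u => pw (e ^+ 2) (-1) (0 + u)) = pw (e ^+ 2) (-1))//; apply/funext => u; rewrite add0r.
  + have dc (x : R) : 0 <= x -> {for x, continuous (fun s : R => e ^+ 2 * ln (1 + s / e ^+ 2))}.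
      move=> x0; apply: differentiable_continuous.
      by apply/derivable1_diffP; have [] := dF x x0.
    split=> [x|| ].
    * by rewrite in_itv/= => /andP[x0 _]; have [] := dF x (ltW x0).
    * by apply: cvg_at_right_filter; exact: dc.
    * by apply: cvg_at_left_filter; apply: dc; exact: ltW.
  + move=> x; rewrite in_itv/= => /andP[x0 _]; rewrite derive1E.
    by have d := dF x (ltW x0); rewrite derive_val.
  rewrite mul0r addr0 ln1 mulr0 sube0 lee_fin.
  rewrite [leRHS](_ : _ = e ^+ 2 * (C1 * ((1 + t) * `|ln e|))); last by ring.
  rewrite ler_pM2l//.
  have -> : 1 + t / e ^+ 2 = (e ^+ 2 + t) * (e ^+ 2)^-1 by field; rewrite gt_eqF.
  rewrite lnM ?posrE ?invr_gt0 ?addr_gt0// lnV ?posrE// lnXn//.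
  have h1 : ln (e ^+ 2 + t) <= t.
    apply: (@le_trans _ _ (ln (1 + t))).
      by rewrite ler_ln ?posrE ?lerD2r ?addr_gt0.
    by apply: le_ln1Dx; rewrite (lt_trans _ t0)// ltrN10.
  have h2 : - ln e <= `|ln e| by rewrite -normrN ler_norm.
  (* Since [e <= 1 / 2], [|ln e|] is at least [ln 2], so the term [t] left by the logarithm is
     absorbed into [|ln e| * t]. *)
  have h3 : t <= (ln 2)^-1 * `|ln e| * t.
    by rewrite ler_peMl ?(ltW t0)// mulrC ler_pdivlMr// mul1r.
  have h4 : 0 <= `|ln e| by [].
  have h5 : (2 + (ln 2)^-1) * ((1 + t) * `|ln e|) <= C1 * ((1 + t) * `|ln e|).
    by rewrite ler_wpM2r// mulr_ge0// (le_trans _ t1).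
  apply: le_trans h5; rewrite mulr2n.
  have h6 : 0 <= (ln 2)^-1 * `|ln e| by rewrite mulr_ge0// ltW.
  have h7 : 0 <= `|ln e| * t by rewrite mulr_ge0// ltW.
  move: (ln (2 : R))^-1 h3 h6 => a h3 h6; nra.
Qed.

End mean_chi_rate.

(** * Moments of the phase variance *)

Lemma measurable_rVD (R : realType) n d (T : measurableType d) (f g : T -> 'rV[R]_n) :
  measurable_fun setT f -> measurable_fun setT g -> measurable_fun setT (fun z => f z + g z).
Proof.
move=> mf mg; apply: measurable_fun_rVP => i; under eq_fun do rewrite mxE.
by apply: measurable_funD; apply: (measurableT_comp (@measurable_coord _ R n i)).
Qed.

Section brownian_covariance.
Context (R : realType) (n : nat).
Variables (h : 'rV[R]_n -> R).
Hypothesis bh : bm h.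
Hypothesis h_even : forall x, h (- x) = h x.
Variables (k p K : R).
Hypotheses (k0 : 0 < k) (p0 : 0 <= p) (K0 : 0 < K).
Local Notation phi := (pw k (- p)).
Hypothesis gauss_le : forall s (y : 'rV[R]_n), 0 <= s ->
  \int[gauss_rV n s]_z `|h (y + z)| <= K * phi s.
Local Notation V := 'rV[R]_n.

Let bnh : bm (fun x => `|h x|).
Proof. exact: bm_norm. Qed.

Let gauss_le0 s : 0 <= s -> \int[gauss_rV n s]_z `|h z| <= K * phi s.
Proof. by move=> s0; have := gauss_le 0 s0; under eq_Rint do rewrite add0r. Qed.

Let gauss_ler s (y : V) : 0 <= s -> \int[gauss_rV n s]_z `|h (z + y)| <= K * phi s.
Proof. by move=> s0; have := gauss_le y s0; under eq_Rint do rewrite addrC. Qed.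

Let mD1 : measurable_fun setT (fun z : V * V => z.1 + z.2).
Proof. by apply: measurable_rVD. Qed.

Context (d : measure_display) (T : measurableType d).
Variables (PB : probability T R) (B : R -> T -> V).
Hypothesis hB : standard_brownian PB B.

Let tel (a b c : V) : (c - b) + (a - c) = a - b.
Proof. by rewrite addrC addrA subrK. Qed.

(** For [h = cov (e^-1 .)], the covariance of the potential at two points of a frozen path. *)
Definition path_cov r s b : R := h (B s b - B r b).

Lemma path_covC r s b : path_cov r s b = path_cov s r b.
Proof. by rewrite /path_cov -h_even opprB. Qed.

Lemma mean_path_cov r s : 0 <= r <= s ->
  \int[PB]_b path_cov r s b = \int[gauss_rV n (s - r)]_z h z.
Proof. by move=> rs; rewrite -(Rint_increment hB rs). Qed.

Lemma norm_mean_path_cov r s : 0 <= r <= s ->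
  `|\int[PB]_b path_cov r s b| <= K * phi (s - r).
Proof.
move=> rs; rewrite mean_path_cov//; apply: le_trans (norm_Rint _ bh) _.
by apply: gauss_le0; have /andP[_ ?] := rs; rewrite subr_ge0.
Qed.

Lemma path_cov_disjoint r s v u : 0 <= r -> r <= s -> s <= v -> v <= u ->
  \int[PB]_b (path_cov r s b * path_cov v u b) =
  (\int[PB]_b path_cov r s b) * \int[PB]_b path_cov v u b.
Proof.
move=> r0 rs sv vu; have s0 := le_trans r0 rs; have v0 := le_trans s0 sv.
rewrite !mean_path_cov ?r0 ?v0//.
have b3 : bm (fun z : V * (V * V) => h z.1 * h z.2.2).
  apply: bmM; first exact: (bm_comp bh).
  by apply: (bm_comp bh); apply: measurableT_comp.
rewrite /path_cov (Rint_increments3 hB r0 rs sv vu b3).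
transitivity (\int[gauss_rV n (s - r)]_x (h x * \int[gauss_rV n (u - v)]_z h z)).
  apply: eq_Rint => x /=.
  have bs : bm (fun z : V * V => h z.2) by exact: (bm_comp bh).
  have e := RintZl (pairp (gauss_rV n (v - s)) (gauss_rV n (u - v))) (h x) bs.
  apply: (etrans e); congr (_ * _).
  exact: (@Rint_prod_snd _ _ _ _ _ (gauss_rV n (v - s)) (gauss_rV n (u - v)) h).
by rewrite RintZr.
Qed.

(** Averaging the first increment with the rest frozen bounds the first factor by [K * phi (v - r)].
    The second factor can then be averaged over either of its two increments, and [le_pw_sum] merges
    the two bounds. *)
Lemma path_cov_overlap r v s u : 0 <= r -> r <= v -> v <= s -> s <= u ->
  `|\int[PB]_b (path_cov r s b * path_cov v u b)| <=
  2 `^ p * K ^+ 2 * (phi (v - r) * phi ((s - v) + (u - s))).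
Proof.
move=> r0 rv vs su; have v0 := le_trans r0 rv; have s0 := le_trans v0 vs.
have vr0 : 0 <= v - r by rewrite subr_ge0.
have sv0 : 0 <= s - v by rewrite subr_ge0.
have us0 : 0 <= u - s by rewrite subr_ge0.
set N1 := gauss_rV n (v - r); set N2 := gauss_rV n (s - v); set N3 := gauss_rV n (u - s).
have ma : measurable_fun setT (fun z : V * (V * V) => z.1 + z.2.1).
  by apply: measurable_rVD => //; apply: measurableT_comp.
have mb : measurable_fun setT (fun z : V * (V * V) => z.2.1 + z.2.2).
  by apply: measurable_rVD; apply: measurableT_comp.
have b3 : bm (fun z : V * (V * V) => h (z.1 + z.2.1) * h (z.2.1 + z.2.2)).
  by apply: bmM; apply: (bm_comp bh).
have bn3 : bm (fun z : V * (V * V) => `|h (z.1 + z.2.1)| * `|h (z.2.1 + z.2.2)|).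
  by apply: bmM; apply: (bm_comp bnh).
have b2 : bm (fun z : V * V => `|h (z.1 + z.2)|) by exact: (bm_comp bnh).
set I := (X in `|X|).
have IE : I = \int[N1]_x \int[(N2 \x N3)%E]_z (h (x + z.1) * h (z.1 + z.2)).
  rewrite /I -(Rint_increments3 hB r0 rv vs su b3); apply: eq_Rint => b /=.
  by rewrite /path_cov !tel.
have I1 : `|I| <= K * phi (v - r) * \int[(N2 \x N3)%E]_z `|h (z.1 + z.2)|.
  have bs : bm (fun x : V => \int[(N2 \x N3)%E]_z (h (x + z.1) * h (z.1 + z.2))).
    by have := bm_Rint N1 (pairp N2 N3) b3.
  have bns : bm (fun x : V => \int[(N2 \x N3)%E]_z (`|h (x + z.1)| * `|h (z.1 + z.2)|)).
    by have := bm_Rint N1 (pairp N2 N3) bn3.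
  rewrite IE.
  apply: (@le_trans _ _ (\int[N1]_x \int[(N2 \x N3)%E]_z (`|h (x + z.1)| * `|h (z.1 + z.2)|))).
    apply: norm_Rint_le => // x; apply: norm_Rint_le.
    - exact: (bm_slice x b3).
    - exact: (bm_slice x bn3).
    - by move=> z; rewrite normrM.
  rewrite (Rint_swap N1 (pairp N2 N3) bn3) -RintZl; last exact: b2.
  apply: le_Rint.
  - exact: (bm_Rint2 N1 (pairp N2 N3) bn3).
  - by apply: bmM => //; exact: bm_cst.
  move=> z /=; rewrite RintZr; last by apply: (bm_comp bnh); apply: measurable_rVD.
  by rewrite ler_wpM2r// gauss_ler.
have q0 : 0 <= K * phi (v - r) by rewrite mulr_ge0 ?pw_ge0// ltW.
have Y : \int[(N2 \x N3)%E]_z `|h (z.1 + z.2)| <= K * 2 `^ p * phi ((s - v) + (u - s)).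
  apply: (@le_pw_sum _ k p); rewrite ?(ltW K0)//.
    rewrite Rint_prod// (Rint_swap N2 N3 b2); apply: Rint_le_cst.
      exact: (bm_Rint2 N2 N3 b2).
    by move=> z; exact: gauss_ler.
  rewrite Rint_prod//; apply: Rint_le_cst; first exact: (bm_Rint N2 N3 b2).
  by move=> z; exact: gauss_le.
apply: (le_trans I1); apply: (le_trans (ler_wpM2l q0 Y)).
by rewrite le_eqVlt; apply/orP; left; apply/eqP; ring.
Qed.

(** The outer factor contains the inner increment, but it can be averaged over either outer piece
    with the inner one frozen; what is left of the inner factor averages to [K * phi (u - v)]. *)
Lemma path_cov_nested r v u s : 0 <= r -> r <= v -> v <= u -> u <= s ->
  `|\int[PB]_b (path_cov r s b * path_cov v u b)| <=
  2 `^ p * K ^+ 2 * (phi ((v - r) + (s - u)) * phi (u - v)).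
Proof.
move=> r0 rv vu us; have v0 := le_trans r0 rv; have u0 := le_trans v0 vu.
have vr0 : 0 <= v - r by rewrite subr_ge0.
have uv0 : 0 <= u - v by rewrite subr_ge0.
have su0 : 0 <= s - u by rewrite subr_ge0.
set N1 := gauss_rV n (v - r); set N2 := gauss_rV n (u - v); set N3 := gauss_rV n (s - u).
have ma : measurable_fun setT (fun z : V * (V * V) => z.1 + (z.2.1 + z.2.2)).
  by apply: measurable_rVD => //; apply: measurable_rVD; apply: measurableT_comp.
have mb : measurable_fun setT (fun z : V * (V * V) => z.2.1) by apply: measurableT_comp.
have b3 : bm (fun z : V * (V * V) => h (z.1 + (z.2.1 + z.2.2)) * h z.2.1).
  by apply: bmM; apply: (bm_comp bh).
have bn3 : bm (fun z : V * (V * V) => `|h (z.1 + (z.2.1 + z.2.2))| * `|h z.2.1|).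
  by apply: bmM; apply: (bm_comp bnh).
set I := (X in `|X|).
have I1 : `|I| <= \int[N1]_x \int[(N2 \x N3)%E]_z (`|h (x + (z.1 + z.2))| * `|h z.1|).
  have bs : bm (fun x : V => \int[(N2 \x N3)%E]_z (h (x + (z.1 + z.2)) * h z.1)).
    by have := bm_Rint N1 (pairp N2 N3) b3.
  have bns : bm (fun x : V => \int[(N2 \x N3)%E]_z (`|h (x + (z.1 + z.2))| * `|h z.1|)).
    by have := bm_Rint N1 (pairp N2 N3) bn3.
  have -> : I = \int[N1]_x \int[(N2 \x N3)%E]_z (h (x + (z.1 + z.2)) * h z.1).
    rewrite /I -(Rint_increments3 hB r0 rv vu us b3); apply: eq_Rint => b /=.
    by rewrite /path_cov !tel.
  apply: norm_Rint_le => // x; apply: norm_Rint_le.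
  - exact: (bm_slice x b3).
  - exact: (bm_slice x bn3).
  - by move=> z; rewrite normrM.
have q0 s' : 0 <= K * phi s' by rewrite mulr_ge0 ?pw_ge0// ltW.
have J1 : \int[N1]_x \int[(N2 \x N3)%E]_z (`|h (x + (z.1 + z.2))| * `|h z.1|) <=
    K ^+ 2 * phi (u - v) * phi (v - r).
  rewrite (Rint_swap N1 (pairp N2 N3) bn3).
  apply: (@le_trans _ _ (\int[(N2 \x N3)%E]_z (K * phi (v - r) * `|h z.1|))).
    apply: le_Rint.
    - exact: (bm_Rint2 N1 (pairp N2 N3) bn3).
    - by apply: bmM; [exact: bm_cst|exact: (bm_comp bnh)].
    move=> z /=; rewrite RintZr; last by apply: (bm_comp bnh); apply: measurable_rVD.
    by rewrite ler_wpM2r// gauss_ler.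
  rewrite RintZl; last exact: (bm_comp bnh).
  rewrite (@Rint_prod_fst _ _ _ _ _ N2 N3 (fun x => `|h x|))//.
  apply: (le_trans (ler_wpM2l (q0 _) (gauss_le0 uv0))).
  by rewrite le_eqVlt; apply/orP; left; apply/eqP; ring.
have J2 : \int[N1]_x \int[(N2 \x N3)%E]_z (`|h (x + (z.1 + z.2))| * `|h z.1|) <=
    K ^+ 2 * phi (u - v) * phi (s - u).
  apply: Rint_le_cst; first exact: (bm_Rint N1 (pairp N2 N3) bn3).
  move=> x; have bx := bm_slice x bn3; rewrite Rint_prod//.
  apply: (@le_trans _ _ (\int[N2]_y (K * phi (s - u) * `|h y|))).
    apply: le_Rint; first exact: (bm_Rint N2 N3 bx).
      by apply: bmM => //; exact: bm_cst.
    move=> y /=; rewrite RintZr; last first.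
      by apply: (bm_comp bnh); apply: measurable_rVD => //; apply: measurable_rVD.
    rewrite ler_wpM2r//; under eq_Rint do rewrite addrA.
    exact: gauss_le.
  rewrite RintZl//; apply: (le_trans (ler_wpM2l (q0 _) (gauss_le0 uv0))).
  by rewrite le_eqVlt; apply/orP; left; apply/eqP; ring.
have C0 : 0 <= K ^+ 2 * phi (u - v) by rewrite mulr_ge0 ?pw_ge0 ?sqr_ge0.
apply: (le_trans I1); apply: le_trans (le_pw_sum k0 p0 C0 vr0 su0 J1 J2) _.
by rewrite le_eqVlt; apply/orP; left; apply/eqP; ring.
Qed.

(** [kk1] and [kk2] are [kern1] and [kern2] at unclamped times. *)
Definition kk1 (r s v u : R) : R := phi `|r - v| * phi (`|s - v| + `|u - s|).
Definition kk2 (r s v u : R) : R := phi (`|r - v| + `|s - u|) * phi `|u - v|.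

Lemma kk1_ge0 r s v u : 0 <= kk1 r s v u.
Proof. by rewrite mulr_ge0 ?pw_ge0. Qed.

Lemma kk2_ge0 r s v u : 0 <= kk2 r s v u.
Proof. by rewrite mulr_ge0 ?pw_ge0. Qed.

Local Notation A := ((1 + 2 `^ p) * K ^+ 2).

Let cov2 r s v u := `|\int[PB]_b (path_cov r s b * path_cov v u b) -
  (\int[PB]_b path_cov r s b) * \int[PB]_b path_cov v u b|.

Let A0 : 0 <= A.
Proof. by rewrite mulr_ge0 ?sqr_ge0// addr_ge0 ?powR_ge0. Qed.

Let phiN s : 0 <= K * phi s.
Proof. by rewrite mulr_ge0 ?pw_ge0// ltW. Qed.

Let pN0 : - p <= 0.
Proof. by rewrite oppr_le0. Qed.

(** Cancellation is exploited only for disjoint intervals. Otherwise the mean of the product and the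
    product of the means are bounded separately, by [2 ^ p * K ^ 2] and [K ^ 2] times the same
    kernel, which gives the two summands of the constant. *)
Lemma covariance_ordered r s v u : 0 <= r -> r <= s -> v <= u -> r <= v ->
  cov2 r s v u <= A * (kk1 r s v u + kk2 r s v u).
Proof.
move=> r0 rs vu rv; have v0 := le_trans r0 rv; have s0 := le_trans r0 rs.
have [sv|vs] := leP s v.
  rewrite /cov2 path_cov_disjoint// subrr normr0 mulr_ge0// addr_ge0 ?kk1_ge0 ?kk2_ge0//.
have mm : `|(\int[PB]_b path_cov r s b) * \int[PB]_b path_cov v u b| <=
    K ^+ 2 * (phi (s - r) * phi (u - v)).
  rewrite normrM (_ : K ^+ 2 * _ = (K * phi (s - r)) * (K * phi (u - v))); last by ring.
  by apply: ler_pM => //; apply: norm_mean_path_cov; rewrite ?r0 ?v0.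
have vs' := ltW vs.
have vr0 : 0 <= v - r by rewrite subr_ge0.
apply: le_trans (ler_normB _ _) _.
have [su|us] := leP s u.
  have k1E : kk1 r s v u = phi (v - r) * phi ((s - v) + (u - s)).
    by rewrite /kk1 distrC (ger0_norm vr0) !ger0_norm ?subr_ge0.
  apply: (@le_trans _ _ (A * kk1 r s v u)); last by rewrite ler_wpM2l// lerDl kk2_ge0.
  rewrite mulrDl mul1r mulrDl [leRHS]addrC lerD//; first by rewrite k1E path_cov_overlap.
  apply: (le_trans mm); rewrite k1E ler_wpM2l ?sqr_ge0//.
  rewrite (_ : s - v + (u - s) = u - v); last by ring.
  by rewrite ler_wpM2r ?pw_ge0// pw_anti// lerB.
have us' := ltW us.
have k2E : kk2 r s v u = phi ((v - r) + (s - u)) * phi (u - v).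
  by rewrite /kk2 distrC (ger0_norm vr0) !ger0_norm ?subr_ge0.
apply: (@le_trans _ _ (A * kk2 r s v u)); last by rewrite ler_wpM2l// lerDr kk1_ge0.
rewrite mulrDl mul1r mulrDl [leRHS]addrC lerD//; first by rewrite k2E path_cov_nested.
apply: (le_trans mm); rewrite k2E ler_wpM2l ?sqr_ge0//.
rewrite ler_wpM2r ?pw_ge0// pw_anti//; first by rewrite addr_ge0// subr_ge0.
by rewrite -subr_ge0 (_ : _ - _ = u - v); [rewrite subr_ge0|ring].
Qed.

Lemma covariance_pair r s v u : 0 <= r -> 0 <= v -> r <= s -> v <= u ->
  cov2 r s v u <= A * (kk1 r s v u + kk2 r s v u + (kk1 v u r s + kk2 v u r s)).
Proof.
move=> r0 v0 rs vu; have [rv|vr] := leP r v.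
  apply: le_trans (covariance_ordered r0 rs vu rv) _.
  by rewrite ler_wpM2l// lerDl addr_ge0 ?kk1_ge0 ?kk2_ge0.
rewrite (_ : cov2 r s v u = cov2 v u r s); last first.
  have e : \int[PB]_b (path_cov r s b * path_cov v u b) =
      \int[PB]_b (path_cov v u b * path_cov r s b) by apply: eq_Rint => b; rewrite mulrC.
  have e' := mulrC (\int[PB]_b path_cov r s b) (\int[PB]_b path_cov v u b).
  by rewrite /cov2 e e'.
apply: le_trans (covariance_ordered v0 vu rs (ltW vr)) _.
by rewrite ler_wpM2l// lerDr addr_ge0 ?kk1_ge0 ?kk2_ge0.
Qed.

End brownian_covariance.

Lemma measurable_rVB (R : realType) n d (T : measurableType d) (f g : T -> 'rV[R]_n) :
  measurable_fun setT f -> measurable_fun setT g -> measurable_fun setT (fun z => f z - g z).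
Proof.
move=> mf mg; apply: measurable_fun_rVP => i; under eq_fun do rewrite !mxE.
by apply: measurable_funB; apply: (measurableT_comp (@measurable_coord _ R n i)).
Qed.

(** * Symmetrization of the four-time kernels *)

Section pair_swap.
Context d d' (T : measurableType d) (T' : measurableType d') (R : realType).
Variables (U : probability T R) (Q : probability T' R).

Lemma Rint_swap_fst (f : (T * T) * T' -> R) : bm f ->
  \int[(pairp U U \x Q)%E]_z f ((z.1.2, z.1.1), z.2) = \int[(pairp U U \x Q)%E]_z f z.
Proof.
move=> bf.
have bs : bm (fun z : (T * T) * T' => f ((z.1.2, z.1.1), z.2)).
  apply: (bm_comp bf); apply: measurable_fun_pair => //.
  by apply: measurable_fun_pair; apply: measurableT_comp.
rewrite (Rint_prod (pairp U U) Q bs) (Rint_prod (pairp U U) Q bf).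
exact: esym (Rint_prod_swap U U (bm_Rint (pairp U U) Q bf)).
Qed.

Lemma Rint_swap_snd (f : T' * (T * T) -> R) : bm f ->
  \int[(Q \x pairp U U)%E]_z f (z.1, (z.2.2, z.2.1)) = \int[(Q \x pairp U U)%E]_z f z.
Proof.
move=> bf.
have bs : bm (fun z : T' * (T * T) => f (z.1, (z.2.2, z.2.1))).
  apply: (bm_comp bf); apply: measurable_fun_pair => //.
  by apply: measurable_fun_pair; apply: measurableT_comp.
rewrite (Rint_prod Q (pairp U U) bs) (Rint_prod Q (pairp U U) bf).
apply: eq_Rint => x; exact: esym (Rint_prod_swap U U (bm_slice x bf)).
Qed.

End pair_swap.

Lemma Rint_add2_le d (T : measurableType d) (R : realType) (P : probability T R)
    (f g : T -> R) (c : R) : bm f -> bm g ->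
  \int[P]_x f x <= c -> \int[P]_x g x <= c -> \int[P]_x (f x + g x) <= 2 * c.
Proof. by move=> bf bg hf hg; rewrite RintD// mulr_natl mulr2n lerD. Qed.

Lemma Rint_add4_le d (T : measurableType d) (R : realType) (P : probability T R)
    (f1 f2 f3 f4 : T -> R) (c : R) : bm f1 -> bm f2 -> bm f3 -> bm f4 ->
  \int[P]_x f1 x <= c -> \int[P]_x f2 x <= c -> \int[P]_x f3 x <= c ->
  \int[P]_x f4 x <= c ->
  \int[P]_x (f1 x + f2 x + (f3 x + f4 x)) <= 4 * c.
Proof.
move=> b1 b2 b3 b4 h1 h2 h3 h4; rewrite RintD; [|exact: bmD|exact: bmD].
rewrite !RintD//; apply: le_trans (lerD (lerD h1 h2) (lerD h3 h4)) _.
by rewrite le_eqVlt; apply/orP; left; apply/eqP; ring.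
Qed.

Section symmetrized_kernels.
Context (R : realType) (t k p : R).
Local Notation RR := (measurableTypeR R).
Local Notation RR4 := ((RR * RR) * (RR * RR))%type.

Definition sw1 (z : RR4) : RR4 := ((z.1.2, z.1.1), z.2).

Definition sw2 (z : RR4) : RR4 := (z.1, (z.2.2, z.2.1)).

Definition sw (z : RR4) : RR4 := (z.2, z.1).

Definition kern12 (z : RR4) : R := kern1 t k p z + kern2 t k p z.

Definition kern4 (z : RR4) : R := kern12 z + kern12 (sw z).

(** Four times may come in any order, while the covariance bounds assume each pair sorted. Summing
    over the reversals of both pairs and the exchange of the pairs gives sixteen nonnegative
    kernels, among them the ones needed; the swaps preserve the product measure, so each has mean at
    most [2 * M ^ 2 * ell]. *)
Definition kern16 (z : RR4) : R :=
  kern4 z + kern4 (sw1 z) + (kern4 (sw2 z) + kern4 (sw1 (sw2 z))).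

Lemma kern4_ge0 z : 0 <= kern4 z.
Proof. by rewrite /kern4 /kern12 /kern1 /kern2 !addr_ge0// mulr_ge0 ?pw_ge0. Qed.

Hypotheses (t0 : 0 < t) (k0 : 0 < k) (p1 : 1 < p).
Local Notation U := (unif t0).
Local Notation UU := (pairp U U).
Local Notation ell := (ell k p t0).
Local Notation M := (2 * mass k p / t).

Lemma ell_le1 : ell <= 1.
Proof.
apply: Rint_le_cst => [|s].
  by apply: bm_chi => //; [exact: measurable_clamp|exact: clamp_ge0].
by apply: pw_le1; rewrite ?clamp_ge0 ?subr_le0 ?(ltW p1).
Qed.

Lemma bm_kern12 : bm kern12.
Proof. by apply: bmD; [exact: bm_kern1|exact: bm_kern2]. Qed.

Lemma bm_kern4 : bm kern4.
Proof.
apply: bmD; first exact: bm_kern12.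
apply: (bm_comp bm_kern12); exact: measurable_fun_pair.
Qed.

Lemma measurable_sw1 : measurable_fun setT sw1.
Proof.
apply: measurable_fun_pair => //.
by apply: measurable_fun_pair; apply: measurableT_comp.
Qed.

Lemma measurable_sw2 : measurable_fun setT sw2.
Proof.
apply: measurable_fun_pair => //.
by apply: measurable_fun_pair; apply: measurableT_comp.
Qed.

Lemma bm_kern16 : bm kern16.
Proof.
apply: bmD; apply: bmD.
- exact: bm_kern4.
- exact: (bm_comp bm_kern4 measurable_sw1).
- exact: (bm_comp bm_kern4 measurable_sw2).
- exact: (bm_comp (bm_comp bm_kern4 measurable_sw1) measurable_sw2).
Qed.

Lemma integral_kern4 : \int[(UU \x UU)%E]_z kern4 z <= 8 * M ^+ 2 * ell.
Proof.
have e2 : \int[(UU \x UU)%E]_z kern12 z <= 2 * (2 * M ^+ 2 * ell).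
  have e := Rint_add2_le (P := pairp UU UU) (bm_kern1 t k0 p1) (bm_kern2 t k0 p1).
  have e1 := e _ (integral_kern1 t0 k0 p1) (integral_kern2 t0 k0 p1).
  exact: e1.
have bs : bm (fun z => kern12 (sw z)).
  by apply: (bm_comp bm_kern12); exact: measurable_fun_pair.
have es : \int[(UU \x UU)%E]_z kern12 (sw z) <= 2 * (2 * M ^+ 2 * ell).
  apply: le_trans e2; rewrite le_eqVlt; apply/orP; left; apply/eqP.
  exact: esym (Rint_prod_swap UU UU bm_kern12).
apply: (le_trans (Rint_add2_le (P := pairp UU UU) bm_kern12 bs e2 es)).
by rewrite !mulrA -!natrM.
Qed.

Lemma integral_kern16 : \int[(UU \x UU)%E]_z kern16 z <= 32 * M ^+ 2 * ell.
Proof.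
have b1 := bm_comp bm_kern4 measurable_sw1.
have b2 := bm_comp bm_kern4 measurable_sw2.
have b12 := bm_comp b1 measurable_sw2.
have e1 : \int[(UU \x UU)%E]_z kern4 (sw1 z) = \int[(UU \x UU)%E]_z kern4 z.
  exact: (Rint_swap_fst U UU bm_kern4).
have e2 : \int[(UU \x UU)%E]_z kern4 (sw2 z) = \int[(UU \x UU)%E]_z kern4 z.
  exact: (Rint_swap_snd U UU bm_kern4).
have e12 : \int[(UU \x UU)%E]_z kern4 (sw1 (sw2 z)) = \int[(UU \x UU)%E]_z kern4 z.
  by rewrite -e1; exact: (Rint_swap_snd U UU b1).
have i4 := integral_kern4; have lec (a b : R) : a = b -> a <= b by move=> ->.
have j1 := le_trans (lec _ _ e1) i4; have j2 := le_trans (lec _ _ e2) i4.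
have j12 := le_trans (lec _ _ e12) i4.
have i := Rint_add4_le (P := pairp UU UU) bm_kern4 b1 b2 b12 i4 j1 j2 j12.
apply: (le_trans i).
by rewrite !mulrA -natrM.
Qed.

End symmetrized_kernels.

(** * Concentration of the phase variance, and covariance along two paths *)

Section phase.
Context (R : realType) (n : nat).
Variables (h : 'rV[R]_n -> R).
Hypothesis bh : bm h.
Hypothesis h_even : forall x, h (- x) = h x.
Variables (k p K : R).
Hypotheses (k0 : 0 < k) (p1 : 1 < p) (K0 : 0 < K).
Local Notation phi := (pw k (- p)).
Hypothesis gauss_le : forall s (y : 'rV[R]_n), 0 <= s ->
  \int[gauss_rV n s]_z `|h (y + z)| <= K * phi s.
Context (d : measure_display) (T : measurableType d).
Variables (PB : probability T R) (B : R -> T -> 'rV[R]_n).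
Hypothesis hB : standard_brownian PB B.
Variables (t : R) (t0 : 0 < t).
Local Notation U := (unif t0).
Local Notation UU := (pairp U U).
Local Notation cl := (clamp t).
Local Notation ell := (ell k p t0).
Local Notation M := (2 * mass k p / t).
Local Notation RR := (measurableTypeR R).
Local Notation A := ((1 + 2 `^ p) * K ^+ 2).

Let p0 : 0 <= p.
Proof. by rewrite ltW// (lt_trans _ p1). Qed.

Let A0 : 0 <= A.
Proof. by rewrite mulr_ge0 ?sqr_ge0// addr_ge0 ?powR_ge0. Qed.

Let M0 : 0 <= M.
Proof. by rewrite divr_ge0 ?(ltW t0)// mulr_ge0// ltW// mass_gt0. Qed.

Local Notation path_cov := (path_cov h B).

Let pc (z : RR * RR) (b : T) : R := path_cov (cl z.1) (cl z.2) b.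

Let bm_pc : bm (fun y : (RR * RR) * T => pc y.1 y.2).
Proof.
apply: (bm_comp bh); apply: measurable_rVB.
  apply: (measurableT_comp (measurable_brownian_path hB t)
     (g := fun y : (RR * RR) * T => (y.1.2, y.2))).
  by apply: measurable_fun_pair => //; apply: measurableT_comp.
apply: (measurableT_comp (measurable_brownian_path hB t)
     (g := fun y : (RR * RR) * T => (y.1.1, y.2))).
by apply: measurable_fun_pair => //; apply: measurableT_comp.
Qed.

Let m (z : RR * RR) : R := \int[PB]_b pc z b.

(** Since [h] is even, each pair of times may be sorted without changing the path covariance;
    [kern16] contains the kernel of whichever sorted version occurs. *)
Let cov_pair (z z' : RR * RR) :
  `|\int[PB]_b (pc z b * pc z' b) - m z * m z'| <= A * kern16 t k p (z, z').
Proof.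
have sortE (z0 : RR * RR) : exists z1, [/\ z1 = z0 \/ z1 = (z0.2, z0.1), cl z1.1 <= cl z1.2 &
    forall b, pc z0 b = pc z1 b].
  have [le01|/ltW le10] := leP (cl z0.1) (cl z0.2); first by exists z0; split => //; left.
  by exists (z0.2, z0.1); split => //; [right|move=> b; rewrite /pc path_covC].
have [z1 [e1 le1 pc1]] := sortE z; have [z2 [e2 le2 pc2]] := sortE z'.
have -> : m z = m z1 by apply: eq_Rint.
have -> : m z' = m z2 by apply: eq_Rint.
under eq_Rint do rewrite pc1 pc2.
have h4 : `|\int[PB]_b (pc z1 b * pc z2 b) - m z1 * m z2| <= A * kern4 t k p (z1, z2).
  apply: le_trans (covariance_pair bh k0 p0 K0 gauss_le hB _ _ le1 le2) _;
    rewrite ?clamp_ge0//.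
apply: (le_trans h4); rewrite ler_wpM2l ?A0// /kern16.
have sum4 (u1 u2 u3 u4 : R) : 0 <= u1 -> 0 <= u2 -> 0 <= u3 -> 0 <= u4 ->
    let u := u1 + u2 + (u3 + u4) in [/\ u1 <= u, u2 <= u, u3 <= u & u4 <= u].
  by move=> u10 u20 u30 u40 u; rewrite /u; split; lra.
have [h1 h2 h3 h12] := sum4 _ _ _ _ (kern4_ge0 t k p (z, z')) (kern4_ge0 t k p (sw1 (z, z')))
  (kern4_ge0 t k p (sw2 (z, z'))) (kern4_ge0 t k p (sw1 (sw2 (z, z')))).
by case: e1 => ->; case: e2 => ->; [exact: h1|exact: h3|exact: h2|exact: h12].
Qed.

(** Multiplied by [(t / e) ^ 2], this is the variance of the random phase given the path. *)
Definition phase (b : T) : R := \int[UU]_z path_cov (cl z.1) (cl z.2) b.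

Lemma bm_phase : bm phase.
Proof. exact: (bm_Rint2 UU PB bm_pc). Qed.

Let bm_m : bm m.
Proof. exact: (bm_Rint UU PB bm_pc). Qed.

Let mean_phase : \int[PB]_b phase b = \int[UU]_z m z.
Proof. exact: esym (Rint_swap UU PB bm_pc). Qed.

Let bm_fst_m : bm (fun y : (RR * RR) * T => m y.1).
Proof. exact: (bm_comp bm_m). Qed.

Let pc_slice z : bm (pc z).
Proof. exact: (bm_slice z bm_pc). Qed.

(** [second_moment] applied to centred path covariances expresses the variance as an average, over
    four times, of covariances between two pairs. *)
Let var_phase : \int[PB]_b (phase b - \int[UU]_z m z) ^+ 2 <= 32 * A * M ^+ 2 * ell.
Proof.
have bF : bm (fun y : (RR * RR) * T => pc y.1 y.2 - m y.1) by exact: (bmB bm_pc bm_fst_m).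
have e := second_moment UU PB bF.
rewrite (_ : (\int[PB]_b _)%R = \int[PB]_b (\int[UU]_z (pc z b - m z)) ^+ 2); last first.
  apply: eq_Rint => b; congr (_ ^+ 2); apply: esym; apply: (RintB UU) => //.
  exact: (bm_slice2 b bm_pc).
have covE (z z' : RR * RR) : \int[PB]_b ((pc z b - m z) * (pc z' b - m z')) =
    \int[PB]_b (pc z b * pc z' b) - m z * m z'.
  have -> : \int[PB]_b ((pc z b - m z) * (pc z' b - m z')) =
      \int[PB]_b ((pc z b * pc z' b - m z' * pc z b) - (m z * pc z' b - m z * m z')).
    by apply: eq_Rint => b'; ring.
  have pz := pc_slice z; have pz' := pc_slice z'.
  have bz : bm (fun b => m z' * pc z b) by apply: bmM => //; exact: bm_cst.
  have bz' : bm (fun b => m z * pc z' b) by apply: bmM => //; exact: bm_cst.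
  have bzz : bm (fun b => pc z b * pc z' b) by exact: bmM.
  rewrite RintB; [|exact: bmB|by apply: bmB => //; exact: bm_cst].
  rewrite !RintB//; last exact: bm_cst.
  by rewrite Rint_cst !RintZl// -!/(m _); ring.
rewrite e; apply: le_trans (_ : \int[(UU \x UU)%E]_z (A * kern16 t k p z) <= _).
  apply: (le_Rint (pairp UU UU)) => [| |z].
  - have bFF : bm (fun y : ((RR * RR) * (RR * RR)) * T =>
        (pc y.1.1 y.2 - m y.1.1) * (pc y.1.2 y.2 - m y.1.2)).
      apply: bmM.
        apply: (bm_comp bF (g := fun y : ((RR * RR) * (RR * RR)) * T => (y.1.1, y.2))).
        by apply: measurable_fun_pair => //; apply: measurableT_comp.
      apply: (bm_comp bF (g := fun y : ((RR * RR) * (RR * RR)) * T => (y.1.2, y.2))).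
      by apply: measurable_fun_pair => //; apply: measurableT_comp.
    exact: (bm_Rint (pairp UU UU) PB bFF).
  - by apply: bmM; [exact: bm_cst|exact: bm_kern16].
  - by case: z => z z' /=; rewrite covE; apply: le_trans (ler_norm _) _; exact: cov_pair.
rewrite (RintZl (pairp UU UU)); last exact: bm_kern16.
apply: le_trans (ler_wpM2l A0 (integral_kern16 t0 k0 p1)) _.
by rewrite le_eqVlt; apply/orP; left; apply/eqP; ring.
Qed.

Variables (g : R -> R) (S : R).
Hypothesis gE : forall s, 0 <= s -> \int[gauss_rV n s]_z h z = g s.
Hypothesis g_ge0 : forall s, 0 <= s -> 0 <= g s.
Hypothesis mg : measurable_fun setT (fun u : R => g `|u|).
Hypothesis gS : (\int[lebesgue_measure]_(u in `[0%R, +oo[) (g u)%:E = (S / 2)%:E)%E.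

Let mE z : m z = g `|cl z.2 - cl z.1|.
Proof.
rewrite -gE// /m /pc; have [le12|/ltW le21] := leP (cl z.1) (cl z.2).
  by rewrite (mean_path_cov bh hB) ?clamp_ge0// ger0_norm ?subr_ge0.
under eq_Rint do rewrite path_covC//.
by rewrite (mean_path_cov bh hB) ?clamp_ge0// distrC ger0_norm ?subr_ge0.
Qed.

Lemma phase_variance :
  \int[PB]_b (t * phase b - S) ^+ 2 <= (128 * A + 36 * K ^+ 2) * mass k p ^+ 2 * ell.
Proof.
set mu := \int[UU]_z m z.
have bias : `|t * mu - S| <= 6 * K * mass k p * ell.
  rewrite (_ : mu = \int[(U \x U)%E]_z g `|cl z.2 - cl z.1|); last first.
    by apply: eq_Rint => z; rewrite mE.
  apply: (mean_bias t0 k0 p1 (ltW K0) mg _ gS) => u u0; rewrite g_ge0//= -gE//.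
  apply: le_trans (ler_norm _) _; apply: le_trans (norm_Rint _ bh) _.
  by have := gauss_le 0 u0; under eq_Rint do rewrite add0r.
have bph : bm (fun b => phase b - mu) by apply: bmB; [exact: bm_phase|exact: bm_cst].
(* Fluctuation plus bias: the cross term is linear in the centred phase and has mean zero. *)
have -> : \int[PB]_b (t * phase b - S) ^+ 2 =
    \int[PB]_b (t ^+ 2 * (phase b - mu) ^+ 2 +
       (2 * t * (t * mu - S) * (phase b - mu) + (t * mu - S) ^+ 2)).
  by apply: eq_Rint => b; ring.
have b1 : bm (fun b => t ^+ 2 * (phase b - mu) ^+ 2).
  by apply: bmM; [exact: bm_cst|exact: bm_sqr].
have b2 : bm (fun b => 2 * t * (t * mu - S) * (phase b - mu)).
  by apply: bmM => //; exact: bm_cst.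
rewrite RintD//; last by apply: bmD => //; exact: bm_cst.
rewrite RintD//; last exact: bm_cst.
rewrite (Rint_cst PB (_ ^+ 2)) !RintZl//; last exact: bm_sqr.
rewrite RintB; [|exact: bm_phase|exact: bm_cst].
rewrite Rint_cst mean_phase -/mu subrr mulr0 add0r.
have e0 : 0 <= ell by exact: ell_ge0.
have m0 : 0 <= mass k p by rewrite ltW// mass_gt0.
have v : t ^+ 2 * \int[PB]_b (phase b - mu) ^+ 2 <= 128 * A * mass k p ^+ 2 * ell.
  apply: le_trans (ler_wpM2l (sqr_ge0 t) var_phase) _.
  rewrite le_eqVlt; apply/orP; left; apply/eqP; field; by rewrite gt_eqF.
have w : (t * mu - S) ^+ 2 <= 36 * K ^+ 2 * mass k p ^+ 2 * ell.
  rewrite -real_normK ?num_real//.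
  apply: (@le_trans _ _ ((6 * K * mass k p * ell) ^+ 2)).
    by rewrite lerXn2r// nnegrE ?normr_ge0// (le_trans (normr_ge0 _) bias).
  (* The squared bias carries [ell ^ 2], and [ell <= 1] brings it to the order of the variance. *)
  rewrite (_ : _ ^+ 2 = 36 * K ^+ 2 * mass k p ^+ 2 * ell * ell); last by ring.
  apply: ler_piMr; last by apply: ell_le1.
  by apply: mulr_ge0 => //; apply: mulr_ge0; [apply: mulr_ge0 => //|]; exact: sqr_ge0.
by apply: le_trans (lerD v w) _; lra.
Qed.

(** Multiplied by [(t / e) ^ 2], the covariance of the random phases along two frozen paths. *)
Definition cross (b b' : T) : R := \int[UU]_z h (B (cl z.2) b' - B (cl z.1) b).

Let bm_cr : bm (fun y : (RR * RR) * (T * T) => h (B (cl y.1.2) y.2.2 - B (cl y.1.1) y.2.1)).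
Proof.
apply: (bm_comp bh); apply: measurable_rVB.
  apply: (measurableT_comp (measurable_brownian_path hB t)
     (g := fun y : (RR * RR) * (T * T) => (y.1.2, y.2.2))).
  by apply: measurable_fun_pair; apply: measurableT_comp.
apply: (measurableT_comp (measurable_brownian_path hB t)
     (g := fun y : (RR * RR) * (T * T) => (y.1.1, y.2.1))).
by apply: measurable_fun_pair; apply: measurableT_comp.
Qed.

Lemma bm_cross : bm (fun w : T * T => cross w.1 w.2).
Proof. exact: (bm_Rint2 UU (pairp PB PB) bm_cr). Qed.

(** Either path may be averaged with the other frozen. Both start at 0, so the two bounds are
    [phi r] and [phi s], merged into [phi (r + s)], whose mean has order [M * ell]. *)
Lemma mean_cross : \int[(PB \x PB)%E]_w `|cross w.1 w.2| <= 2 `^ p * K * M * ell.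
Proof.
have bn := bm_norm bm_cr.
apply: (@le_trans _ _ (\int[pairp PB PB]_w \int[UU]_z
    `|h (B (cl z.2) w.2 - B (cl z.1) w.1)|)).
  apply: (le_Rint (pairp PB PB)).
  - exact: bm_norm bm_cross.
  - exact: (bm_Rint2 UU (pairp PB PB) bn).
  - move=> w; apply: norm_Rint; exact: (bm_slice2 w bm_cr).
rewrite -(Rint_swap UU (pairp PB PB) bn).
have bms (r : R) : 0 <= r -> measurable_fun setT (B r) by exact: brownian_measurable hB r.
have increment (r : R) (y : 'rV[R]_n) : 0 <= r -> \int[PB]_b `|h (y + B r b)| <= K * phi r.
  move=> r0; have b_ : bm (fun z : 'rV[R]_n => `|h (y + z)|).
    apply: bm_norm; apply: (bm_comp bh); apply: measurable_rVD => //.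
  have := gauss_le y r0; have r00 : 0 <= (0 : R) <= r by apply/andP.
  rewrite -{1}[r]subr0 -(Rint_increment hB r00 b_).
  by under eq_Rint do rewrite (brownian0 hB) subr0.
have pair_le (r s : R) : 0 <= r -> 0 <= s ->
    \int[pairp PB PB]_w `|h (B s w.2 - B r w.1)| <= K * 2 `^ p * phi (r + s).
  move=> r0 s0.
  have bw : bm (fun w : T * T => `|h (B s w.2 - B r w.1)|).
    apply: bm_norm; apply: (bm_comp bh); apply: measurable_rVB.
      by apply: (measurableT_comp (bms s s0)).
    by apply: (measurableT_comp (bms r r0)).
  rewrite (Rint_pair PB PB bw); apply: (@le_pw_sum _ k p); rewrite ?(ltW K0) ?p0//.
    rewrite (Rint_swap PB PB bw); apply: Rint_le_cst; first exact: (bm_Rint2 PB PB bw).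
    (* Evenness of [h] brings the averaged path into the position with a plus sign. *)
    move=> b' /=; under eq_Rint => b do rewrite -h_even opprB addrC.
    by apply: increment.
  apply: Rint_le_cst; first exact: (bm_Rint PB PB bw).
  by move=> b /=; under eq_Rint => b' do rewrite addrC; exact: increment.
have C0 : 0 <= K * 2 `^ p by rewrite mulr_ge0 ?powR_ge0 ?ltW.
have bs : bm (fun z : RR * RR => phi (cl z.1 + cl z.2)).
  apply: bm_phi => //; last by move=> z; rewrite addr_ge0 ?clamp_ge0.
  by apply: measurable_funD; apply: (measurableT_comp (measurable_clamp t)).
apply: (@le_trans _ _ (\int[UU]_z (K * 2 `^ p * phi (cl z.1 + cl z.2)))).
  apply: le_Rint.
  - exact: (bm_Rint UU (pairp PB PB) bn).
  - by apply: bmM => //; exact: bm_cst.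
  - move=> z; exact: (pair_le _ _ (clamp_ge0 t z.1) (clamp_ge0 t z.2)).
rewrite RintZl//; apply: le_trans (ler_wpM2l C0 (mean_phi_sum2 t0 k0 p1)) _.
by rewrite le_eqVlt; apply/orP; left; apply/eqP; ring.
Qed.

End phase.

(** * Gaussian fields *)

Lemma integrable_EFinD d (T : measurableType d) (R : realType) (P : probability T R)
    (f g : T -> R) : P.-integrable setT (EFin \o f) -> P.-integrable setT (EFin \o g) ->
  P.-integrable setT (EFin \o (fun w => f w + g w)).
Proof.
move=> If Ig; have := integrableD measurableT If Ig.
by apply: eq_integrable => // w _; rewrite /= EFinD.
Qed.

Lemma Rint_sum d (T : measurableType d) (R : realType) (P : probability T R)
    (I : finType) (F : I -> T -> R) : (forall i, P.-integrable setT (EFin \o F i)) ->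
  P.-integrable setT (EFin \o (fun w => \sum_i F i w)) /\
  \int[P]_w \sum_i F i w = \sum_i \int[P]_w F i w.
Proof.
move=> Fi; elim: (index_enum I) => [|i s [IH1 IH2]].
  under [in X in X /\ _]eq_fun do rewrite big_nil; rewrite big_nil.
  under eq_Rint do rewrite big_nil; rewrite Rint_cst; split => //.
  by apply: bm_integrable; exact: bm_cst.
split.
  by under [X in _ \o X]eq_fun do rewrite big_cons; exact: integrable_EFinD.
under eq_Rint do rewrite big_cons.
by rewrite big_cons RintegralD// IH2.
Qed.

Section l2_field.
Context (R : realType) (n : nat) (d : measure_display) (T : measurableType d).
Variables (P : probability T R) (V : 'rV[R]_n -> T -> R) (cov : 'rV[R]_n -> R).
Hypothesis mV : measurable_fun setT (fun z : 'rV[R]_n * T => V z.1 z.2).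
Hypothesis V2 : forall y, P.-integrable setT (EFin \o (fun w => V y w ^+ 2)).
Hypothesis V0 : forall y, \int[P]_w V y w = 0.
Hypothesis Vcov : forall y z, \int[P]_w (V y w * V z w) = cov (z - y).
Hypothesis hG : gaussian_field P V.

Lemma measurable_field y : measurable_fun setT (V y).
Proof.
by apply: (measurableT_comp mV (g := fun w : T => (y, w))); exact: measurable_fun_pair.
Qed.

Lemma field_mul_integrable y z : P.-integrable setT (EFin \o (fun w => V y w * V z w)).
Proof.
apply: (@le_integrable _ _ _ _ setT _ _ (EFin \o (fun w => V y w ^+ 2 + V z w ^+ 2))) => //.
- apply/measurable_EFinP; apply: measurable_funM; exact: measurable_field.
- move=> w _ /=; rewrite lee_fin normrM [leRHS]ger0_norm ?addr_ge0 ?sqr_ge0//.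
  rewrite -(real_normK (num_real (V y w))) -(real_normK (num_real (V z w))).
  have := sqr_ge0 (`|V y w| - `|V z w|); have := normr_ge0 (V y w); have := normr_ge0 (V z w); nra.
- exact: integrable_EFinD.
Qed.

Lemma field_integrable y : P.-integrable setT (EFin \o V y).
Proof.
apply: (@le_integrable _ _ _ _ setT _ _ (EFin \o (fun w => V y w ^+ 2 + 1))) => //.
- by apply/measurable_EFinP; exact: measurable_field.
- move=> w _ /=; rewrite lee_fin [leRHS]ger0_norm ?addr_ge0 ?sqr_ge0//.
  rewrite -(real_normK (num_real (V y w))).
  have := sqr_ge0 (`|V y w| - 1); have := normr_ge0 (V y w); nra.
- apply: integrable_EFinD => //; exact: (bm_integrable P (bm_cst T (1 : R))).
Qed.

Section combinations.
Variables (I : finType) (a : I -> R) (x : I -> 'rV[R]_n).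

Definition comb w : R := \sum_i a i * V (x i) w.

Definition comb_var : R := \sum_i \sum_j a i * a j * cov (x j - x i).

Lemma measurable_comb : measurable_fun setT comb.
Proof.
apply: measurable_sum => i; apply: measurable_funM => //; exact: measurable_field.
Qed.

Let term_integrable i : P.-integrable setT (EFin \o (fun w => a i * V (x i) w)).
Proof.
apply: (@eq_integrable _ _ _ _ _ _ (fun w => (a i)%:E * (V (x i) w)%:E)%E) => //.
by apply: integrableZl => //; exact: field_integrable.
Qed.

Lemma comb_integrable : P.-integrable setT (EFin \o comb).
Proof. by have [] := Rint_sum term_integrable. Qed.

Lemma mean_comb : \int[P]_w comb w = 0.
Proof.
have [_ ->] := Rint_sum term_integrable.
by apply: big1 => i _; rewrite RintegralZl ?V0 ?mulr0//; exact: field_integrable.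
Qed.

Let term2 (ij : I * I) w := a ij.1 * a ij.2 * (V (x ij.1) w * V (x ij.2) w).

Let term2_integrable ij : P.-integrable setT (EFin \o term2 ij).
Proof.
apply: (@eq_integrable _ _ _ _ _ _
  (fun w => (a ij.1 * a ij.2)%:E * (V (x ij.1) w * V (x ij.2) w)%:E)%E) => //.
by apply: integrableZl => //; exact: field_mul_integrable.
Qed.

Let comb_sqrE w : comb w ^+ 2 = \sum_ij term2 ij w.
Proof.
rewrite expr2 /comb big_distrlr/= pair_bigA/=; apply: eq_bigr => -[i j] _.
by rewrite /term2/=; ring.
Qed.

Lemma comb_sqr_integrable : P.-integrable setT (EFin \o (fun w => comb w ^+ 2)).
Proof.
under [X in _.-integrable _ (_ \o X)]eq_fun do rewrite comb_sqrE.
by have [] := Rint_sum term2_integrable.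
Qed.

Lemma variance_comb : \int[P]_w comb w ^+ 2 = comb_var.
Proof.
under eq_Rint do rewrite comb_sqrE.
have [_ ->] := Rint_sum term2_integrable.
rewrite /comb_var pair_bigA/=; apply: eq_bigr => -[i j] _.
by rewrite RintegralZl// ?Vcov//; exact: field_mul_integrable.
Qed.

(** A [finType] is enumerated because [gaussian_field] indexes points by ordinals. *)
Lemma comb_normal_law : exists m s, normal_law P m s comb.
Proof.
have [m [s ms]] := hG (fun k : 'I_#|I| => x (enum_val k)) (fun k => a (enum_val k)).
exists m, s; rewrite (_ : comb = (fun w => \sum_(i < #|I|) a (enum_val i) * V (x (enum_val i)) w))//.
by apply/funext => w; rewrite /comb (big_enum_val (fun i => a i * V (x i) w)).
Qed.

(** [gaussian_field] only asserts some normal law; its parameters are recovered from the first two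
    moments. *)
Lemma mean_cos_comb : \int[P]_w cos (comb w) = expR (- (comb_var / 2)).
Proof.
have [m [s ms]] := comb_normal_law.
have [m0 s2] := normal_law_parameters ms comb_integrable comb_sqr_integrable mean_comb.
rewrite -variance_comb -s2; rewrite m0 in ms.
have := normal_law_cos 1 ms; rewrite expr1n mul1r => <-.
by apply: eq_Rint => w; rewrite mul1r.
Qed.

End combinations.

End l2_field.

Lemma bm_sum d (T : measurableType d) (R : realType) (I : finType) (F : I -> T -> R) :
  (forall i, bm (F i)) -> bm (fun s => \sum_i F i s).
Proof.
move=> bF; elim: (index_enum I) => [|i r IH].
  by under eq_fun do rewrite big_nil; exact: bm_cst.
by under eq_fun do rewrite big_cons; exact: bmD.
Qed.

Lemma Rint_finite_range d (T : measurableType d) (R : realType) (P : probability T R)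
    (g : T -> nat) (N : nat) (F : nat -> R) :
  (forall i, measurable (g @^-1` [set i])) -> (forall s, (g s < N)%N) ->
  bm (fun s => F (g s)) /\
  \int[P]_s F (g s) = \sum_(i < N) (\int[P]_s \1_(g @^-1` [set val i]) s) * F i.
Proof.
move=> mg gN.
have FE s : F (g s) = \sum_(i < N) \1_(g @^-1` [set val i]) s * F i.
  rewrite (bigD1 (Ordinal (gN s)))//= big1 ?addr0 => [|i /eqP ine].
    by rewrite indicE mem_set// mul1r.
  by rewrite indicE memNset ?mul0r// => /= e; apply: ine; exact/val_inj.
have b_ (i : 'I_N) : bm (fun s => \1_(g @^-1` [set val i]) s * F i).
  by apply: bmM; [exact: bm_indic|exact: bm_cst].
split.
  rewrite (_ : (fun _ => _) = (fun s => \sum_(i < N) \1_(g @^-1` [set val i]) s * F i)).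
    exact: bm_sum.
  by apply/funext => s; rewrite FE.
under eq_Rint do rewrite FE.
have [|_ ->] := @Rint_sum _ _ _ P _ (fun (i : 'I_N) s => \1_(g @^-1` [set val i]) s * F i).
  by move=> i; exact: bm_integrable.
by apply: eq_bigr => i _; rewrite RintZr//; exact: bm_indic.
Qed.

(** Holds without integrability: positive and negative parts are handled by Tonelli, and [fine] maps
    infinite values to 0. The potential may fail to be time integrable for exceptional media. *)
Lemma measurable_Rint d1 d2 (T1 : measurableType d1) (T2 : measurableType d2)
    (R : realType) (P : probability T1 R) (F : T1 * T2 -> R) : measurable_fun setT F ->
  measurable_fun setT (fun w => \int[P]_s F (s, w)).
Proof.
move=> mF; rewrite /Rintegral; apply: (measurableT_comp (@fine_measurable R setT measurableT)).
under eq_fun do rewrite integralE; apply: emeasurable_funB.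
  rewrite (_ : (fun _ => _) = fubini_G P (EFin \o F)^\+%E).
    apply: measurable_fun_fubini_tonelli_G => [|z]; last exact: funepos_ge0.
    by apply: measurable_funepos; exact/measurable_EFinP.
  by apply/funext => w; apply: eq_integral => s _; rewrite funepos.unlock.
rewrite (_ : (fun _ => _) = fubini_G P (EFin \o F)^\-%E).
  apply: measurable_fun_fubini_tonelli_G => [|z]; last exact: funeneg_ge0.
  by apply: measurable_funeneg; exact/measurable_EFinP.
by apply/funext => w; apply: eq_integral => s _; rewrite funeneg.unlock.
Qed.

Lemma cvg_sum (R : realType) (I : finType) (u : nat -> I -> R) (l : I -> R) :
  (forall i, u k i @[k --> \oo] --> l i) -> \sum_i u k i @[k --> \oo] --> \sum_i l i.
Proof.
move=> ul; elim: (index_enum I) => [|i r IH].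
  by under eq_fun do rewrite big_nil; rewrite big_nil; exact: cvg_cst.
by under eq_fun do rewrite big_cons; rewrite big_cons; exact: cvgD.
Qed.

Lemma norm_cosB (R : realType) (x y : R) : `|cos x - cos y| <= `|x - y|.
Proof.
wlog xy : x y / x < y.
  move=> H; have [xy|yx|->] := ltgtP x y; last by rewrite !subrr normr0.
    exact: H.
  by rewrite distrC [leRHS]distrC; exact: H.
rewrite distrC [leRHS]distrC.
have [z _ ->] := @MVT R cos (fun z => - sin z) x y xy
  (fun z _ => is_derive_cos z) (continuous_subspaceT (@continuous_cos R)).
by rewrite normrM normrN ler_piMl// ler_norml sin_geN1 sin_le1.
Qed.

(** Integrated AM-GM with a free parameter [c], for functions that are only square integrable. *)
Lemma mean_norm_le d (T : measurableType d) (R : realType) (P : probability T R)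
    (f : T -> R) (c : R) : 0 < c -> measurable_fun setT f ->
  P.-integrable setT (EFin \o (fun w => f w ^+ 2)) ->
  (\int[P]_w `|f w|%:E <= (c / 2 + (\int[P]_w f w ^+ 2) / (2 * c))%:E)%E.
Proof.
move=> c0 mf f2.
have i2 : P.-integrable setT (EFin \o (fun w => (2 * c)^-1 * f w ^+ 2)).
  apply: (@eq_integrable _ _ _ _ _ _ (fun w => ((2 * c)^-1)%:E * (f w ^+ 2)%:E)%E) => //.
  exact: integrableZl.
have ic : P.-integrable setT (EFin \o (fun _ : T => c / 2)).
  by apply: bm_integrable; exact: bm_cst.
have i3 := integrable_EFinD ic i2.
apply: (@le_trans _ _ (\int[P]_w (c / 2 + (2 * c)^-1 * f w ^+ 2)%:E)%E).
  apply: ge0_le_integral => //.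
  - by apply/measurable_EFinP; exact: measurableT_comp.
  - by have /integrableP[] := i3.
  - move=> w _; rewrite lee_fin -(ler_pM2l (_ : 0 < 2 * c)) ?mulr_gt0//.
    rewrite mulrDr [leRHS](_ : _ = c ^+ 2 + f w ^+ 2); last by field; rewrite gt_eqF.
    rewrite -(real_normK (num_real (f w))); have := sqr_ge0 (`|f w| - c); nra.
rewrite -(EFin_Rint i3) RintegralD// Rint_cst RintegralZl// lee_fin.
by rewrite [(2 * c)^-1 * _]mulrC.
Qed.

(** * The Gaussian formula for time averages of the field *)

Section gaussian_average.
Context (R : realType) (n : nat) (d : measure_display) (T : measurableType d).
Variables (P : probability T R) (V : 'rV[R]_n -> T -> R) (cov : 'rV[R]_n -> R).
Hypothesis mV : measurable_fun setT (fun z : 'rV[R]_n * T => V z.1 z.2).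
Hypothesis V2 : forall y, P.-integrable setT (EFin \o (fun w => V y w ^+ 2)).
Hypothesis V0 : forall y, \int[P]_w V y w = 0.
Hypothesis Vcov : forall y z, \int[P]_w (V y w * V z w) = cov (z - y).
Hypothesis hG : gaussian_field P V.
Hypothesis bcov : bm cov.
Hypothesis cov_cvg : forall (x_ : nat -> 'rV[R]_n) (x : 'rV[R]_n),
  (forall i, x_ k ord0 i @[k --> \oo] --> x ord0 i) -> cov (x_ k) @[k --> \oo] --> cov x.

Context (dS : measure_display) (S : measurableType dS) (U : probability S R).
Variables (J : finType) (a : J -> R) (y : J -> S -> 'rV[R]_n).
Hypothesis my : forall j, measurable_fun setT (y j).
Variables (g : nat -> S -> nat) (N : nat -> nat) (pt : nat -> nat -> J -> 'rV[R]_n).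
Hypothesis mg : forall k i, measurable (g k @^-1` [set i]).
Hypothesis gN : forall k s, (g k s < N k)%N.
Hypothesis pt_cvg : forall s j i, pt k (g k s) j ord0 i @[k --> \oo] --> y j s ord0 i.

(** [H] is the integrand along the curves [y j], [G k] its step approximation, constant on each of
    the [N k] cells given by [g k]. *)
Let H s w := comb V a (y ^~ s) w.
Let G k s w := comb V a (pt k (g k s)) w.

Let mpt k j : measurable_fun setT (fun s => pt k (g k s) j).
Proof.
have := @measurable_countable_index _ _ _ S S _ (g k) (fun i _ => pt k i j) (mg k).
move=> /(_ (fun i => measurable_cst (pt k i j))) m2.
by apply: (measurableT_comp m2 (g := fun s => (s, s))); exact: measurable_fun_pair.
Qed.

Let mcomb (x : J -> S -> 'rV[R]_n) : (forall j, measurable_fun setT (x j)) ->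
  measurable_fun setT (fun z : S * T => comb V a (x ^~ z.1) z.2).
Proof.
move=> mx; apply: measurable_sum => j; apply: measurable_funM => //.
apply: (measurableT_comp mV (g := fun z : S * T => (x j z.1, z.2))).
by apply: measurable_fun_pair => //; apply: measurableT_comp.
Qed.

Let mH : measurable_fun setT (fun z : S * T => H z.1 z.2).
Proof. exact: mcomb. Qed.

Let mG k : measurable_fun setT (fun z : S * T => G k z.1 z.2).
Proof. by apply: (mcomb (x := fun j s => pt k (g k s) j)) => j; exact: mpt. Qed.

Definition time_cov s r : R := \sum_i \sum_j a i * a j * cov (y j r - y i s).

Let gcov k s r : R := \sum_i \sum_j a i * a j * cov (pt k (g k r) j - pt k (g k s) i).

Let W w := \int[U]_s H s w.
Let Y k w := \int[U]_s G k s w.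

Let pr k i : R := \int[U]_s \1_(g k @^-1` [set i]) s.

Let YE k w : Y k w = comb V (fun ij : 'I_(N k) * J => pr k ij.1 * a ij.2)
  (fun ij => pt k ij.1 ij.2) w.
Proof.
have [_ e] := @Rint_finite_range _ _ _ U (g k) (N k) (fun i => comb V a (pt k i) w) (mg k) (gN k).
rewrite /Y e /comb.
transitivity (\sum_(i < N k) \sum_j pr k i * a j * V (pt k i j) w); last first.
  by rewrite pair_bigA.
by apply: eq_bigr => i _; rewrite mulr_sumr; apply: eq_bigr => j _; rewrite mulrA.
Qed.

Let bm_cov_sum (I : finType) (b : I -> R) d' (T' : measurableType d')
    (x x' : I -> T' -> 'rV[R]_n) : (forall i, measurable_fun setT (x i)) ->
  (forall i, measurable_fun setT (x' i)) ->
  bm (fun z => \sum_i \sum_j b i * b j * cov (x' j z - x i z)).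
Proof.
move=> mx mx'; apply: bm_sum => i; apply: bm_sum => j.
apply: bmM; first exact: bm_cst.
by apply: (bm_comp bcov); exact: measurable_rVB.
Qed.

Let bm_gcov k : bm (fun z : S * S => gcov k z.1 z.2).
Proof.
apply: (bm_cov_sum a (x := fun i (z : S * S) => pt k (g k z.1) i)
  (x' := fun i (z : S * S) => pt k (g k z.2) i)) => i.
  exact: (measurableT_comp (mpt k i)).
exact: (measurableT_comp (mpt k i)).
Qed.

Let var_Y k : \int[(U \x U)%E]_z gcov k z.1 z.2 =
  comb_var cov (fun ij : 'I_(N k) * J => pr k ij.1 * a ij.2) (fun ij => pt k ij.1 ij.2).
Proof.
pose c i i' := \sum_j \sum_j' a j * a j' * cov (pt k i' j' - pt k i j).
rewrite (Rint_prod U U (bm_gcov k)).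
transitivity (\sum_(i < N k) pr k i * \sum_(i' < N k) pr k i' * c i i').
  have [_ <-] := @Rint_finite_range _ _ _ U (g k) (N k)
    (fun i => \sum_(i' < N k) pr k i' * c i i') (mg k) (gN k).
  apply: eq_Rint => s /=.
  by have [_ <-] := @Rint_finite_range _ _ _ U (g k) (N k) (c (g k s)) (mg k) (gN k).
rewrite /comb_var.
transitivity (\sum_(i < N k) \sum_j \sum_(i' < N k) \sum_j'
  (pr k i * a j * (pr k i' * a j') * cov (pt k i' j' - pt k i j))); last first.
  rewrite pair_bigA; apply: eq_bigr => -[i j] _ /=.
  by rewrite pair_bigA; apply: eq_bigr => -[i' j'].
apply: eq_bigr => i _; rewrite mulr_sumr exchange_big; apply: eq_bigr => i' _.
rewrite /c !mulr_sumr; apply: eq_bigr => j _.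
by rewrite !mulr_sumr; apply: eq_bigr => j' _; ring.
Qed.

Let mean_cos_Y k :
  \int[P]_w cos (Y k w) = expR (- (\int[(U \x U)%E]_z gcov k z.1 z.2 / 2)).
Proof.
rewrite var_Y -(mean_cos_comb mV V2 V0 Vcov hG).
by apply: eq_Rint => w; rewrite YE.
Qed.

(** Doubling the index set by a sign writes [H - G k] as one combination, whose second moment is
    again a [comb_var]. *)
Let aD (p : J * bool) : R := if p.2 then a p.1 else - a p.1.

Let xD k s (p : J * bool) := if p.2 then y p.1 s else pt k (g k s) p.1.

Let D k s := comb_var cov aD (xD k s).

Let diffE k s w : H s w - G k s w = comb V aD (xD k s) w.
Proof.
rewrite /H /G /comb -sumrB.
transitivity (\sum_j \sum_b aD (j, b) * V (xD k s (j, b)) w); last first.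
  by rewrite pair_bigA; apply: eq_bigr => -[].
by apply: eq_bigr => j _; rewrite big_bool /aD /xD/= mulNr.
Qed.

Let mxD k p : measurable_fun setT (xD k ^~ p).
Proof. by case: p => j [] /=; [exact: my|exact: mpt]. Qed.

Let bm_D k : bm (D k).
Proof. by apply: (bm_cov_sum aD (x := fun p s => xD k s p) (x' := fun p s => xD k s p)) => p; exact: mxD. Qed.

Let mW : measurable_fun setT W.
Proof. exact: (measurable_Rint U mH). Qed.

Let mY k : measurable_fun setT (Y k).
Proof. exact: (measurable_Rint U (mG k)). Qed.

Let bm_G k w : bm (G k ^~ w).
Proof. by have [] := @Rint_finite_range _ _ _ U (g k) (N k) (fun i => comb V a (pt k i) w) (mg k) (gN k). Qed.

Let norm_cos_le k w :
  (`|cos (W w) - cos (Y k w)|%:E <= \int[U]_s `|H s w - G k s w|%:E)%E.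
Proof.
have mHw : measurable_fun setT (H ^~ w).
  by apply: (measurableT_comp mH (g := fun s : S => (s, w))); exact: measurable_fun_pair.
have mGw := bm_measurable (bm_G k w).
have mB : measurable_fun setT (EFin \o (fun s => H s w - G k s w)).
  by apply/measurable_EFinP; exact: measurable_funB.
(* Where the right-hand side is infinite nothing is to be shown; otherwise [H] is integrable in
   time, because the step function is bounded. *)
have [oo|fin] := leP +oo%E (\int[U]_s `|H s w - G k s w|%:E)%E.
  by apply: le_trans oo; exact: leey.
have iB : U.-integrable setT (EFin \o (fun s => H s w - G k s w)).
  by apply/integrableP; split.
have iG := bm_integrable U (bm_G k w).
have iH : U.-integrable setT (EFin \o (H ^~ w)).
  have := integrable_EFinD iB iG.
  by apply: eq_integrable => // s _; rewrite /= subrK.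
apply: (@le_trans _ _ `|W w - Y k w|%:E); first by rewrite lee_fin norm_cosB.
rewrite /W /Y -RintegralB//; apply: le_trans (le_abse_integral U measurableT mB).
by rewrite -(EFin_Rint iB).
Qed.

(** Cosine is 1-Lipschitz, so the L2 distance of the integrands controls the error; the free [c]
    stands in for a square root. *)
Let approximation k c : 0 < c ->
  `|\int[P]_w cos (W w) - expR (- (\int[(U \x U)%E]_z gcov k z.1 z.2 / 2))| <=
  c / 2 + (\int[U]_s D k s) / (2 * c).
Proof.
move=> c0; rewrite -mean_cos_Y.
have bW := bm_cos mW; have bY := bm_cos (mY k); have bB := bmB bW bY.
rewrite -RintB//; apply: le_trans (norm_Rint _ bB) _.
rewrite -lee_fin EFin_Rint; last by apply: bm_integrable; exact: bm_norm.
have mF : measurable_fun setT (fun z : S * T => `|H z.1 z.2 - G k z.1 z.2|%:E).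
  by apply/measurable_EFinP; apply: measurableT_comp => //; exact: (measurable_funB mH (mG k)).
apply: (@le_trans _ _ (\int[P]_w \int[U]_s `|H s w - G k s w|%:E)%E).
  apply: ge0_le_integral => //.
  - by apply/measurable_EFinP; exact: bm_measurable (bm_norm bB).
  - by apply: (@measurable_fun_fubini_tonelli_G _ _ S T R U
      (fun z => `|H z.1 z.2 - G k z.1 z.2|%:E)) => // z; rewrite lee_fin.
rewrite -(@fubini_tonelli _ _ S T R U P (fun z => `|H z.1 z.2 - G k z.1 z.2|%:E))//.
have bD := bm_D k.
have bR : bm (fun s => c / 2 + (2 * c)^-1 * D k s).
  by apply: bmD; [exact: bm_cst|apply: bmM => //; exact: bm_cst].
apply: (@le_trans _ _ (\int[U]_s (c / 2 + (2 * c)^-1 * D k s)%:E)%E); last first.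
  rewrite -(EFin_Rint (bm_integrable U bR)) lee_fin RintD; last 2 first.
  - exact: bm_cst.
  - by apply: bmM => //; exact: bm_cst.
  by rewrite Rint_cst RintZl// [(2 * c)^-1 * _]mulrC.
apply: ge0_le_integral => //.
- by move=> s _; apply: integral_ge0 => w _; rewrite lee_fin.
- by apply: (@measurable_fun_fubini_tonelli_F _ _ S T R P
    (fun z => `|H z.1 z.2 - G k z.1 z.2|%:E)) => // z; rewrite lee_fin.
- by apply/measurable_EFinP; exact: bm_measurable bR.
move=> s _; have := mean_norm_le c0 (measurable_comb mV aD (xD k s))
  (comb_sqr_integrable mV V2 aD (xD k s)).
rewrite (variance_comb mV V2 Vcov) -/(D k s) => h.
rewrite [(2 * c)^-1 * _]mulrC; apply: le_trans h.
rewrite le_eqVlt; apply/orP; left; apply/eqP; apply: eq_integral => w _.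
by rewrite diffE.
Qed.

Let cov_sum_le : exists M, 0 <= M /\ forall (I : finType) (b : I -> R) (x x' : I -> 'rV[R]_n),
  `|\sum_i \sum_j b i * b j * cov (x' j - x i)| <= M * \sum_i \sum_j `|b i * b j|.
Proof.
have [_ [M covM]] := bcov; exists M; split; first exact: le_trans (covM 0).
move=> I b x x'; rewrite mulr_sumr; apply: le_trans (ler_norm_sum _ _ _) _.
apply: ler_sum => i _; rewrite mulr_sumr; apply: le_trans (ler_norm_sum _ _ _) _.
by apply: ler_sum => j _; rewrite normrM mulrC ler_wpM2r.
Qed.

Let cov_sum_cvg (I : finType) (b : I -> R) (x x' : nat -> I -> 'rV[R]_n) (z z' : I -> 'rV[R]_n) :
  (forall i l, x k i ord0 l @[k --> \oo] --> z i ord0 l) ->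
  (forall i l, x' k i ord0 l @[k --> \oo] --> z' i ord0 l) ->
  \sum_i \sum_j b i * b j * cov (x' k j - x k i) @[k --> \oo] -->
  \sum_i \sum_j b i * b j * cov (z' j - z i).
Proof.
move=> cx cx'; apply: cvg_sum => i; apply: cvg_sum => j.
apply: cvgM; first exact: cvg_cst.
apply: cov_cvg => l; rewrite !mxE; under eq_fun do rewrite !mxE.
exact: cvgB.
Qed.

(** In the limit the signed points coincide in pairs, so the limiting form is the variance of the
    zero combination. *)
Let D_cvg s : D k s @[k --> \oo] --> (0 : R).
Proof.
pose x0 (p : J * bool) := y p.1 s.
have x0E w : comb V aD x0 w = 0.
  transitivity (\sum_j \sum_b aD (j, b) * V (x0 (j, b)) w).
    by rewrite pair_bigA; apply: eq_bigr => -[].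
  by apply: big1 => j _; rewrite big_bool /aD /x0/= mulNr subrr.
have <- : comb_var cov aD x0 = 0.
  rewrite -(variance_comb mV V2 Vcov); under eq_Rint do rewrite x0E expr0n/=.
  exact: Rint_cst.
by apply: cov_sum_cvg => -[j []] l /=; [exact: cvg_cst|exact: pt_cvg|exact: cvg_cst|exact: pt_cvg].
Qed.

Lemma gaussian_average_cos :
  \int[P]_w cos (W w) = expR (- (\int[(U \x U)%E]_z time_cov z.1 z.2 / 2)).
Proof.
have [M [M0 covM]] := cov_sum_le.
have q_cvg : \int[(U \x U)%E]_z gcov k z.1 z.2 @[k --> \oo] -->
    \int[(U \x U)%E]_z time_cov z.1 z.2.
  apply: (@cvg_Rint _ _ _ (pairp U U) _ _ (M * \sum_i \sum_j `|a i * a j|)).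
  - by move=> k; exact: bm_measurable (bm_gcov k).
  - by move=> k z; exact: covM.
  - by move=> z; apply: cov_sum_cvg => i l; exact: pt_cvg.
have d_cvg : \int[U]_s D k s @[k --> \oo] --> (0 : R).
  rewrite -(Rint_cst U (0 : R)).
  apply: (@cvg_Rint _ _ _ U _ _ (M * \sum_i \sum_j `|aD i * aD j|)).
  - by move=> k; exact: bm_measurable (bm_D k).
  - by move=> k z; exact: covM.
  - exact: D_cvg.
set L := \int[P]_w cos (W w); set q := \int[(U \x U)%E]_z _.
have le_c (c : R) : 0 < c -> `|L - expR (- (q / 2))| <= c / 2.
  move=> c0; rewrite -[leRHS]addr0 -(mul0r (2 * c)^-1).
  have l1 : `|L - expR (- (\int[(U \x U)%E]_z gcov k z.1 z.2 / 2))| @[k --> \oo] -->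
      `|L - expR (- (q / 2))|.
    apply: cvg_norm; apply: cvgB; first exact: cvg_cst.
    apply: continuous_cvg; first exact: continuous_expR.
    by apply: cvgN; apply: cvgM => //; exact: cvg_cst.
  have l2 : c / 2 + (\int[U]_s D k s) / (2 * c) @[k --> \oo] --> c / 2 + 0 / (2 * c).
    by apply: cvgD; [exact: cvg_cst|apply: cvgM => //; exact: cvg_cst].
  apply: (ler_cvg_to l1 l2).
  by near=> k; exact: approximation.
(* A nonzero distance, taken itself as [c], would be at most half of itself. *)
apply/eqP; rewrite -subr_eq0 -normr_le0 leNgt; apply/negP => L0.
by have := le_c _ L0; rewrite leNgt ltr_pdivrMr// ltr_pMr// ltr1n.
Unshelve. all: by end_near.
Qed.

End gaussian_average.

(** * Moments of the stationary potential *)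

Section stationary_potential.
Context (R : realType) (n : nat) (d : measure_display) (T : measurableType d).
Variables (P : probability T R) (tau : 'rV[R]_n -> T -> T) (VV : T -> R).
Variable cov : 'rV[R]_n -> R.
Hypothesis htau : ergodic_action P tau.
Hypothesis VV2 : VV \in Lfun P 2%:E.
Hypothesis VV0 : ('E_P[VV] = 0)%E.
Local Notation V := (stationary_field tau VV).
Hypothesis hcov : forall x, ('E_P[(fun w => V 0 w * V x w)%R] = (cov x)%:E)%E.

Lemma measurable_potential : measurable_fun setT VV.
Proof. by move: VV2 => /andP[]; rewrite inE. Qed.

Lemma measurable_stationary_field :
  measurable_fun setT (fun z : 'rV[R]_n * T => V z.1 z.2).
Proof. exact: (measurableT_comp measurable_potential (action_measurable htau)). Qed.

Lemma measurable_action y : measurable_fun setT (tau y).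
Proof.
apply: (measurableT_comp (action_measurable htau) (g := fun w : T => (y, w))).
exact: measurable_fun_pair.
Qed.

Lemma integrable_action y (h : T -> R) : P.-integrable setT (EFin \o h) ->
  P.-integrable setT (EFin \o (h \o tau y)).
Proof.
move=> ih; have /integrableP[mh hoo] := ih.
have mt := measurable_action y.
have mht : measurable_fun setT (EFin \o (h \o tau y)).
  by apply: (measurableT_comp mh).
apply/integrableP; split => //.
rewrite (_ : (\int[P]_w `|(EFin \o (h \o tau y)) w|)%E = (\int[P]_w `|(EFin \o h) w|)%E)//.
transitivity (\int[pushforward P (tau y)]_w `|(EFin \o h) w|)%E.
  rewrite ge0_integral_pushforward//.
  by apply: measurableT_comp.
apply: eq_measure_integral => A mA _.
by rewrite /pushforward; exact: action_preserving.
Qed.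

Lemma Rint_action y (h : T -> R) : P.-integrable setT (EFin \o h) ->
  \int[P]_w h (tau y w) = \int[P]_w h w.
Proof.
move=> ih; apply: Rint_law; first exact: measurable_action.
- by move=> A mA; exact: action_preserving.
- by apply/measurable_EFinP; have /integrableP[] := ih.
- exact: integrable_action.
Qed.

Lemma stationary_field_sqr y : P.-integrable setT (EFin \o (fun w => V y w ^+ 2)).
Proof. exact: (integrable_action y (Lfun2_integrable_sqr VV2)). Qed.

Lemma stationary_field_mean y : \int[P]_w V y w = 0.
Proof.
have iV : P.-integrable setT (EFin \o VV).
  have := field_integrable measurable_stationary_field stationary_field_sqr 0.
  by apply: eq_integrable => // w _; rewrite /= /stationary_field (action0 htau).
rewrite (Rint_action y iV) /Rintegral.
by move: VV0; rewrite unlock => ->.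
Qed.

(** Both points are translated by [- y] through the measure-preserving [tau y], which reduces to a
    covariance with the origin. *)
Lemma stationary_field_cov y z : \int[P]_w (V y w * V z w) = cov (z - y).
Proof.
pose h w := V 0 w * V (z - y) w.
have ih : P.-integrable setT (EFin \o h).
  exact: (field_mul_integrable measurable_stationary_field stationary_field_sqr).
transitivity (\int[P]_w h (tau y w)).
  apply: eq_Rint => w; rewrite /h /stationary_field (action0 htau).
  by rewrite -(actionD htau) subrK.
by rewrite (Rint_action y ih) /Rintegral; have := hcov (z - y); rewrite unlock => ->.
Qed.

End stationary_potential.

Section time_average.
Context (R : realType) (n : nat) (d : measure_display) (T : measurableType d).
Variables (P : probability T R) (V : 'rV[R]_n -> T -> R) (cov : 'rV[R]_n -> R).
Hypothesis mV : measurable_fun setT (fun z : 'rV[R]_n * T => V z.1 z.2).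
Hypothesis V2 : forall y, P.-integrable setT (EFin \o (fun w => V y w ^+ 2)).
Hypothesis Vcov : forall y z, \int[P]_w (V y w * V z w) = cov (z - y).
Context (dS : measure_display) (S : measurableType dS) (U : probability S R).

(** The potential is unbounded, so its integrability along a curve holds only for almost every
    medium, by Tonelli and the uniform second moment. *)
Lemma time_integrable_ae (y : S -> 'rV[R]_n) : measurable_fun setT y ->
  {ae P, forall w, U.-integrable setT (EFin \o (fun s => V (y s) w))}.
Proof.
move=> my; have mH : measurable_fun setT (fun z : S * T => V (y z.1) z.2).
  apply: (measurableT_comp mV (g := fun z : S * T => (y z.1, z.2))).
  by apply: measurable_fun_pair => //; apply: measurableT_comp.
have mF : measurable_fun setT (fun z : S * T => `|V (y z.1) z.2|%:E).
  by apply/measurable_EFinP; apply: measurableT_comp.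
pose F w := (\int[U]_s `|V (y s) w|%:E)%E.
have mFw : measurable_fun setT F.
  by apply: (@measurable_fun_fubini_tonelli_G _ _ S T R U
    (fun z => `|V (y z.1) z.2|%:E)) => // z; rewrite lee_fin.
have F0 w : (0 <= F w)%E by apply: integral_ge0 => s _; rewrite lee_fin.
have iF : P.-integrable setT F.
  apply/integrableP; split => //.
  under eq_integral => w _ do rewrite gee0_abs//.
  rewrite -(@fubini_tonelli _ _ S T R U P (fun z => `|V (y z.1) z.2|%:E))//=.
  (* This is [mean_norm_le] with [c = 1]; by stationarity the second moment is [cov 0] at every
     point. *)
  apply: (@le_lt_trans _ _ (\int[U]_s (1 / 2 + cov 0 / (2 * 1))%:E)%E).
    apply: ge0_le_integral => //.
    - by move=> s _; apply: integral_ge0 => w _; rewrite lee_fin.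
    - by apply: (@measurable_fun_fubini_tonelli_F _ _ S T R P
        (fun z => `|V (y z.1) z.2|%:E)) => // z; rewrite lee_fin.
    - move=> s _; have := @mean_norm_le _ _ _ P (V (y s)) 1 ltr01 _ (V2 (y s)).
      rewrite (eq_Rint P (g := fun w => V (y s) w * V (y s) w))//.
      by rewrite Vcov subrr; apply; exact: measurable_field.
  by rewrite integral_cst//= (_ : U _ = 1%E) ?mule1 ?ltry//; exact: probability_setT.
have := integrable_ae measurableT iF.
apply: filterS => w /(_ I) fw; apply/integrableP; split.
  apply/measurable_EFinP.
  by apply: (measurableT_comp mH (g := fun s : S => (s, w))); exact: measurable_fun_pair.
by rewrite -ge0_fin_numE//; exact: F0.
Qed.

(** The sum and the time integral commute only where all terms are integrable; an almost sure
    identity is enough under the expectation. *)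
Lemma mean_cos_average (J : finType) (a : J -> R) (y : J -> S -> 'rV[R]_n) :
  (forall j, measurable_fun setT (y j)) ->
  \int[P]_w cos (\sum_j a j * \int[U]_s V (y j s) w) =
  \int[P]_w cos (\int[U]_s comb V a (y ^~ s) w).
Proof.
move=> my; rewrite /Rintegral; congr fine.
have mH j : measurable_fun setT (fun z : S * T => V (y j z.1) z.2).
  apply: (measurableT_comp mV (g := fun z : S * T => (y j z.1, z.2))).
  by apply: measurable_fun_pair => //; apply: measurableT_comp.
have mcos (h : T -> R) : measurable_fun setT h -> measurable_fun setT (fun w => (cos (h w))%:E).
  by move=> mh; apply/measurable_EFinP; exact: bm_measurable (bm_cos mh).
apply: ae_eq_integral => //.
- apply: mcos; apply: measurable_sum => j; apply: measurable_funM => //.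
  exact: (measurable_Rint U (mH j)).
- apply: mcos; apply: (measurable_Rint U (F := fun z => comb V a (y ^~ z.1) z.2)).
  by apply: measurable_sum => j; apply: measurable_funM.
have : {ae P, forall w, forall j, U.-integrable setT (EFin \o (fun s => V (y j s) w))}.
  by apply: filter_forall => j; exact: time_integrable_ae.
apply: filterS => w iw _; congr (cos _)%:E.
have ai j : U.-integrable setT (EFin \o (fun s => a j * V (y j s) w)).
  by have := integrableZl measurableT (a j) (iw j); apply: eq_integrable => // s _; rewrite /= EFinM.
have [_ e] := Rint_sum ai; apply/esym/(etrans e).
by apply: eq_bigr => j _; rewrite RintegralZl.
Qed.

End time_average.

(** * Correlations of cosines and sines of two Gaussian phases *)

Lemma norm_expRB (R : realType) (u v : R) : 0 <= u -> 0 <= v ->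
  `|expR (- u) - expR (- v)| <= `|u - v|.
Proof.
wlog uv : u v / u <= v.
  move=> H u0 v0; have [uv|/ltW vu] := leP u v; first exact: H.
  by rewrite distrC [leRHS]distrC; exact: H.
move=> u0 v0; rewrite distrC (distrC u) (ger0_norm (_ : 0 <= v - u)) ?subr_ge0//.
rewrite distrC ger0_norm ?subr_ge0 ?ler_expR ?lerN2//.
have -> : expR (- v) = expR (- u) * expR (- (v - u)) by rewrite -expRD; congr expR; ring.
have := expR_ge1Dx (- (v - u)); have : expR (- u) <= 1 by rewrite -expR0 ler_expR oppr_le0.
have := expR_gt0 (- u); have : 0 <= v - u by rewrite subr_ge0.
set a := expR (- u); set b := expR _; nra.
Qed.

(* The exponents [q1 + q2 +- 2 c] are variances, hence the hypotheses [2 c <= q1 + q2]. *)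
Lemma gaussian_cos_correlation (R : realType) (q1 q2 c s : R) :
  0 <= q1 -> 0 <= q2 -> 0 <= s -> 2 * c <= q1 + q2 -> - (2 * c) <= q1 + q2 ->
  `|(expR (- ((q1 + q2 - 2 * c) / 2)) + expR (- ((q1 + q2 + 2 * c) / 2))) / 2 -
    expR (- (s / 2)) * (expR (- (q1 / 2)) + expR (- (q2 / 2))) + expR (- (s / 2)) ^+ 2| <=
  ((q1 - s) ^+ 2 + (q2 - s) ^+ 2) / 8 + `|c|.
Proof.
move=> q10 q20 s0 c1 c2; set k := expR (- (s / 2)).
have half (u : R) : 0 <= u -> 0 <= u / 2 by move=> ?; rewrite divr_ge0.
have lip q : 0 <= q -> `|expR (- (q / 2)) - k| <= `|q - s| / 2.
  move=> q0; apply: le_trans (norm_expRB (half _ q0) (half _ s0)) _.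
  by rewrite -mulrBl normrM (ger0_norm (_ : 0 <= 2^-1)) ?invr_ge0.
have q120 := half _ (addr_ge0 q10 q20).
have lm : `|expR (- ((q1 + q2 - 2 * c) / 2)) - expR (- ((q1 + q2) / 2))| <= `|c|.
  apply: le_trans (norm_expRB _ q120) _; first by apply: half; rewrite subr_ge0.
  by rewrite (_ : _ - _ = - c) ?normrN//; field.
have lp : `|expR (- ((q1 + q2 + 2 * c) / 2)) - expR (- ((q1 + q2) / 2))| <= `|c|.
  apply: le_trans (norm_expRB _ q120) _; first by apply: half; lra.
  by rewrite (_ : _ - _ = c)//; field.
have eAB : expR (- ((q1 + q2) / 2)) = expR (- (q1 / 2)) * expR (- (q2 / 2)).
  by rewrite -expRD; congr expR; ring.
have := lip _ q10; have := lip _ q20; move: lm lp; rewrite eAB.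
set A := expR (- (q1 / 2)); set B := expR (- (q2 / 2)).
set Em := expR (- ((q1 + q2 - 2 * c) / 2)); set Ep := expR (- ((q1 + q2 + 2 * c) / 2)).
move=> lm lp lB lA.
(* Subtracting [A * B] from both exponentials isolates the effect of [c], and the rest factors. The
   product of the two deviations yields squares, with 1 / 8 coming from two factors 1 / 2 and
   AM-GM. *)
rewrite (_ : _ + k ^+ 2 = (A - k) * (B - k) + ((Em - A * B) + (Ep - A * B)) / 2); last by field.
apply: le_trans (ler_normD _ _) _; apply: lerD.
  rewrite normrM; apply: le_trans (ler_pM (normr_ge0 _) (normr_ge0 _) lA lB) _.
  rewrite -(real_normK (num_real (q1 - s))) -(real_normK (num_real (q2 - s))).
  have := sqr_ge0 (`|q1 - s| - `|q2 - s|); lra.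
rewrite normrM (ger0_norm (_ : 0 <= 2^-1)) ?invr_ge0//.
rewrite ler_pdivrMr//; apply: le_trans (ler_normD _ _) _.
by apply: le_trans (lerD lm lp) _; lra.
Qed.

Lemma gaussian_sin_correlation (R : realType) (q1 q2 c : R) :
  2 * c <= q1 + q2 -> - (2 * c) <= q1 + q2 ->
  `|(expR (- ((q1 + q2 - 2 * c) / 2)) - expR (- ((q1 + q2 + 2 * c) / 2))) / 2| <= `|c|.
Proof.
move=> c1 c2; rewrite normrM (ger0_norm (_ : 0 <= 2^-1)) ?invr_ge0//.
rewrite ler_pdivrMr//; apply: le_trans (norm_expRB _ _) _.
- by rewrite divr_ge0// subr_ge0.
- by rewrite divr_ge0//; lra.
rewrite (_ : _ - _ = - (c * 2)); last by field.
by rewrite normrN normrM (ger0_norm (_ : 0 <= 2)).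
Qed.

(** * Measurability and boundedness of the initial datum; time integrals as uniform averages *)

Lemma measurable_floor_fiber d (T : measurableType d) (R : realType) (h : T -> R) (z : int) :
  measurable_fun setT h -> measurable ((fun x => Num.floor (h x)) @^-1` [set z]).
Proof.
move=> mh; rewrite (_ : _ @^-1` _ = h @^-1` `[z%:~R, (z + 1)%:~R[).
  by rewrite -[X in measurable X]setTI; apply: mh => //; exact: measurable_itv.
apply/seteqP; split => x /=; rewrite in_itv/= => /eqP.
  by rewrite floor_eq.
by move=> /eqP h'; apply/eqP; rewrite floor_eq.
Qed.

(* The grid [N.+1^-1 * Z^n] turns a continuous function into a limit of functions with countable range. *)
Lemma continuous_measurable_rV (R : realType) n (g : 'rV[R]_n -> R) :
  continuous g -> measurable_fun setT g.
Proof.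
move=> cg.
pose ka N (x : 'rV[R]_n) : 'rV[int]_n := \row_i Num.floor (x ord0 i * N.+1%:R).
pose pt N (z : 'rV[int]_n) : 'rV[R]_n := \row_i ((z ord0 i)%:~R / N.+1%:R).
have mka N z : measurable (ka N @^-1` [set z]).
  rewrite (_ : _ @^-1` _ = \bigcap_(i in [set: 'I_n])
      ((fun x : 'rV[R]_n => Num.floor (x ord0 i * N.+1%:R)) @^-1` [set z ord0 i])).
    apply: fin_bigcap_measurable => // i _; apply: measurable_floor_fiber.
    by apply: measurable_funM => //; exact: measurable_coord.
  apply/seteqP; split => x /=; first by move=> <- i _ /=; rewrite mxE.
  by move=> xz; apply/rowP => i; rewrite mxE; exact: xz.
have mpk N i : measurable ((fun x => pickle (ka N x)) @^-1` [set i]).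
  (* Cells are numbered by [pickle]; a number that codes no cell has an empty fibre. *)
  have [[z zi]|nz] := pselect (exists z : 'rV[int]_n, pickle z = i).
    rewrite (_ : _ @^-1` _ = ka N @^-1` [set z])//.
    apply/seteqP; split => x /=; last by move=> ->.
    by rewrite -zi; exact: (pcan_inj pickleK).
  rewrite (_ : _ @^-1` _ = set0)//; apply/seteqP; split => x //= xi.
  by apply: nz; exists (ka N x).
pose F N i (_ : 'rV[R]_n) : R := if unpickle i is Some z then g (pt N z) else 0.
apply: (@measurable_fun_cvg _ _ _ _ (fun N x => g (pt N (ka N x)))).
  move=> N; have := @measurable_countable_index _ _ _ _ 'rV[R]_n _ (fun x => pickle (ka N x))
    (F N) (mpk N) (fun i => measurable_cst _).
  move=> m2; have := measurableT_comp m2 (g := fun x : 'rV[R]_n => (x, x)).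
  rewrite (_ : _ \o _ = (fun x => g (pt N (ka N x)))).
    by apply; exact: measurable_fun_pair.
  by apply/funext => x; rewrite /F/= pickleK.
move=> x _; apply: (continuous_cvg _ (cg x)).
apply/cvg_ballP => e e0; near=> N; split => // i j; rewrite !mxE ord1.
rewrite -ball_normE/= ltr_distlC.
have N0 : 0 < N.+1%:R :> R by [].
have /andP[f1 f2] := floor_itv (x ord0 j * N.+1%:R).
rewrite intrD in f2.
have Ne : N.+1%:R^-1 < e by near: N; exact: near_infty_natSinv_lt (PosNum e0).
set a := (Num.floor _)%:~R in f1 f2 *.
have h1 : a / N.+1%:R <= x ord0 j by rewrite ler_pdivrMr.
have h2 : x ord0 j < a / N.+1%:R + N.+1%:R^-1.
  by rewrite -[X in _ + X]mul1r -mulrDl ltr_pdivlMr.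
rewrite -[x 0 j]/(x ord0 j); move: h1 h2; move: (a / _) (x ord0 j) => u v h1 h2.
by apply/andP; split; [rewrite ltrBlDr (lt_trans h2)// ltrD2l|rewrite (le_lt_trans h1)// ltrDl].
Unshelve. all: by end_near.
Qed.

(** A continuous function is bounded on the compact closure of the support and zero off it. *)
Lemma Cc_infty_bm (R : realType) n (f : 'rV[R]_n -> R[i]) : Cc_infty f ->
  bm (fun x => complex.Re (f x)) /\ bm (fun x => complex.Im (f x)).
Proof.
move=> [sR sI cK].
have bdd (g : 'rV[R]_n -> R) : continuous g -> (forall x, g x != 0 -> f x != 0%C) -> bm g.
  move=> cg gf; split; first exact: continuous_measurable_rV.
  have cgK : {within closure [set x | f x != 0%C], continuous g} by exact: continuous_subspaceT.
  have [M [_ Mb]] := compact_bounded (continuous_compact cgK cK).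
  exists (Num.max 0 (M + 1)) => x; have [->|gx] := eqVneq (g x) 0.
    by rewrite normr0 le_max lexx.
  rewrite le_max; apply/orP; right; apply: Mb; first by rewrite ltrDl.
  by exists x => //; apply: subset_closure; exact: gf.
split; apply: bdd.
(* The empty list of derivatives in [smooth] is the continuity of the function itself. *)
- by have [] := sR [::].
- by move=> x; apply: contraNneq => ->.
- by have [] := sI [::].
- by move=> x; apply: contraNneq => ->.
Qed.

(** No integrability is assumed: if a part is infinite, both sides are 0 through [fine], since
    scaling by a positive number preserves infinities. This lets the phase be rewritten for every
    medium. *)
Lemma Rint_unif (R : realType) (t : R) (t0 : 0 < t) (k : R -> R) : measurable_fun setT k ->
  \int[lebesgue_measure]_(s in `[0, t]) k s = t * \int[unif t0]_s k s.
Proof.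
move=> mk; rewrite /Rintegral.
have mE : measurable_fun setT (EFin \o k) by exact/measurable_EFinP.
rewrite (integralE lebesgue_measure) (integralE (unif t0)).
rewrite (@integral_uniform _ _ _ t0); last 2 first.
- exact: measurable_funepos.
- by move=> x; exact: funepos_ge0.
rewrite (@integral_uniform _ _ _ t0); last 2 first.
- exact: measurable_funeneg.
- by move=> x; exact: funeneg_ge0.
rewrite subr0.
set a := (\int[_]_(x in _) _)%E; set b := (\int[_]_(x in _) _)%E.
have : (0 <= b)%E by apply: integral_ge0 => x _; exact: funeneg_ge0.
have : (0 <= a)%E by apply: integral_ge0 => x _; exact: funepos_ge0.
have ti : (0 < (t^-1)%:E :> \bar R)%E by rewrite lte_fin invr_gt0.
case: a => [a| |] // _; case: b => [b| |] // _; rewrite ?(gt0_muley ti)//= ?mulr0//.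
by rewrite -mulrBr mulrA divff ?gt_eqF// mul1r.
Qed.

(** * Homogenization error *)

Section random_phase.
Context (R : realType) (n : nat).
Context (dO : measure_display) (Omega : measurableType dO).
Variables (P : probability Omega R) (V : 'rV[R]_n -> Omega -> R) (cov : 'rV[R]_n -> R).
Hypothesis mV : measurable_fun setT (fun z : 'rV[R]_n * Omega => V z.1 z.2).
Hypothesis V2 : forall y, P.-integrable setT (EFin \o (fun w => V y w ^+ 2)).
Hypothesis V0 : forall y, \int[P]_w V y w = 0.
Hypothesis Vcov : forall y z, \int[P]_w (V y w * V z w) = cov (z - y).
Hypothesis hG : gaussian_field P V.
Hypothesis bcov : bm cov.
Hypothesis cov_cvg : forall (x_ : nat -> 'rV[R]_n) (x : 'rV[R]_n),
  (forall i, x_ k ord0 i @[k --> \oo] --> x ord0 i) -> cov (x_ k) @[k --> \oo] --> cov x.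
Hypothesis covN : forall x, cov (- x) = cov x.

Context (dB : measure_display) (OB : measurableType dB).
Variables (PB : probability OB R) (B : R -> OB -> 'rV[R]_n).
Hypothesis hB : standard_brownian PB B.
Variables (t e : R) (x : 'rV[R]_n).
Hypotheses (t0 : 0 < t) (e0 : 0 < e).
Local Notation U := (unif t0).
Local Notation UU := (pairp U U).
Local Notation cl := (clamp t).
Local Notation RR := (measurableTypeR R).

Let h (z : 'rV[R]_n) := cov (e^-1 *: z).

Let bh : bm h.
Proof. exact: (bm_comp bcov (measurable_scale _)). Qed.

Let hN z : h (- z) = h z.
Proof. by rewrite /h scalerN covN. Qed.

Let y b (s : RR) : 'rV[R]_n := e^-1 *: (x + B (cl s) b).

Let measurable_path : measurable_fun setT (fun z : RR * OB => y z.2 z.1).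
Proof.
apply: (measurableT_comp (measurable_scale _)); apply: measurable_rVD => //.
exact: (measurable_brownian_path hB t).
Qed.

Let my b : measurable_fun setT (y b).
Proof.
apply: (measurableT_comp measurable_path (g := fun s : RR => (s, b))).
exact: measurable_fun_pair.
Qed.

Definition random_phase b w : R :=
  e^-1 * \int[lebesgue_measure]_(s in `[0, t]) V (e^-1 *: (x + B s b)) w.

Let random_phaseE b w : random_phase b w = t / e * \int[U]_s V (y b s) w.
Proof.
rewrite /random_phase (_ : (\int[lebesgue_measure]_(s in `[0, t]) V _ w)%R =
  \int[lebesgue_measure]_(s in `[0, t]) V (y b s) w); last first.
  apply: eq_Rintegral => s; rewrite inE/= in_itv/= => st.
  by rewrite /y clamp_id.
rewrite (Rint_unif t0) ?mulrA 1?[e^-1 * t]mulrC//.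
apply: (measurableT_comp mV (g := fun s : RR => (y b s, w))).
by apply: measurable_fun_pair => //; exact: my.
Qed.

Lemma measurable_random_phase :
  measurable_fun setT (fun z : OB * Omega => random_phase z.1 z.2).
Proof.
under eq_fun do rewrite random_phaseE; apply: measurable_funM => //.
apply: (measurable_Rint U (F := fun z : RR * (OB * Omega) => V (y z.2.1 z.1) z.2.2)).
apply: (measurableT_comp mV (g := fun z : RR * (OB * Omega) => (y z.2.1 z.1, z.2.2))).
apply: measurable_fun_pair; last by apply: measurableT_comp.
apply: (measurableT_comp measurable_path (g := fun z : RR * (OB * Omega) => (z.1, z.2.1))).
by apply: measurable_fun_pair => //; apply: measurableT_comp.
Qed.

Local Notation phase := (phase h B t0).
Local Notation cross := (cross h B t0).

(** [Q] and [C] are the variance of the random phase along one path and the covariance along two,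
    the paths being frozen. *)
Let Q b : R := (t / e) ^+ 2 * phase b.
Let C b b' : R := (t / e) ^+ 2 * cross b b'.

Let bm_pair b b' : bm (fun z : RR * RR => h (B (cl z.2) b' - B (cl z.1) b)).
Proof.
apply: (bm_comp bh); apply: measurable_rVB.
  apply: (measurableT_comp (measurable_brownian_path hB t)
     (g := fun z : RR * RR => (z.2, b'))).
  exact: measurable_fun_pair.
apply: (measurableT_comp (measurable_brownian_path hB t)
     (g := fun z : RR * RR => (z.1, b))).
exact: measurable_fun_pair.
Qed.

Let crossC b b' : cross b b' = cross b' b.
Proof.
rewrite /cross (Rint_prod_swap U U (bm_pair b b')).
by apply: eq_Rint => z /=; rewrite -hN opprB.
Qed.

(** [gaussian_average_cos] with index set [bool], one index per path; evenness of [h] merges the two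
    mixed terms. *)
Let mean_cos b b' (a a' : R) :
  \int[P]_w cos (a * random_phase b w + a' * random_phase b' w) =
  expR (- ((a ^+ 2 * Q b + a' ^+ 2 * Q b' + 2 * (a * a') * C b b') / 2)).
Proof.
pose al (j : bool) := (if j then a else a') * (t / e).
pose yy (j : bool) := y (if j then b else b').
have myy j : measurable_fun setT (yy j) by exact: my.
pose pt N i (j : bool) := e^-1 *: (x + B (i%:R / N.+1%:R) (if j then b else b')).
have mc := mean_cos_average mV V2 Vcov U al myy.
have gc := @gaussian_average_cos _ _ _ _ P V cov mV V2 V0 Vcov hG bcov cov_cvg
  _ _ U _ al yy myy (grid_index t) (fun N => (Num.truncn (t * N.+1%:R)).+1) pt
  (measurable_grid_index t) _ _.
rewrite (eq_Rint P (g := fun w => cos (\sum_j al j * \int[U]_s V (yy j s) w))); last first.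
  by move=> w; rewrite big_bool !random_phaseE /al /yy/= !mulrA.
rewrite mc gc.
- congr (expR (- (_ / 2))).
  have hE b1 b2 (z : RR * RR) : cov (y b2 z.2 - y b1 z.1) = h (B (cl z.2) b2 - B (cl z.1) b1).
    by rewrite /h /y -scalerBr; congr (cov (_ *: _)); rewrite opprD addrACA subrr add0r.
  have b2 (c : R) b1 b2 : bm (fun z : RR * RR => c * h (B (cl z.2) b2 - B (cl z.1) b1)).
    by apply: bmM; [exact: bm_cst|exact: bm_pair].
  rewrite (eq_Rint UU (g := fun z : RR * RR =>
    (al true * al true * h (B (cl z.2) b - B (cl z.1) b) +
     al true * al false * h (B (cl z.2) b' - B (cl z.1) b)) +
    (al false * al true * h (B (cl z.2) b - B (cl z.1) b') +
     al false * al false * h (B (cl z.2) b' - B (cl z.1) b')))); last first.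
    by move=> z; rewrite /time_cov big_bool !big_bool /yy/= !hE.
  rewrite (RintD UU); [|exact: bmD|exact: bmD].
  rewrite !(RintD UU)// !(RintZl UU); try exact: bm_pair.
  rewrite -!/(cross _ _) -[cross b b]/(phase b) -[cross b' b']/(phase b').
  rewrite (crossC b' b) /Q /C /al.
  ring.
- move=> N s; rewrite ltnS /grid_index; apply: le_truncn.
  by rewrite ler_wpM2r// clamp_le// ltW.
- move=> s j i; rewrite /pt /yy /y !mxE; under eq_fun do rewrite !mxE.
  apply: cvgM; first exact: cvg_cst.
  apply: cvgD; first exact: cvg_cst.
  by apply: (brownian_cvg hB); [move=> N; exact: grid_ge0|exact: clamp_ge0|exact: grid_cvg].
Qed.

(** Nonnegativity of the quadratic form is read off the formula itself: the mean of a cosine is at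
    most 1, so the exponent cannot be positive. *)
Let cos_ge0 b b' (a a' : R) :
  0 <= a ^+ 2 * Q b + a' ^+ 2 * Q b' + 2 * (a * a') * C b b'.
Proof.
have : \int[P]_w cos (a * random_phase b w + a' * random_phase b' w) <= 1.
  apply: Rint_le_cst => [|w]; last exact: cos_le1.
  apply: bm_cos; apply: measurable_funD; apply: measurable_funM => //.
    apply: (measurableT_comp measurable_random_phase (g := fun w : Omega => (b, w))).
    exact: measurable_fun_pair.
  apply: (measurableT_comp measurable_random_phase (g := fun w : Omega => (b', w))).
  exact: measurable_fun_pair.
by rewrite mean_cos -expR0 ler_expR oppr_le0 pmulr_lge0 ?invr_gt0.
Qed.

Let mphase b : measurable_fun setT (random_phase b).
Proof.
apply: (measurableT_comp measurable_random_phase (g := fun w : Omega => (b, w))).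
exact: measurable_fun_pair.
Qed.

Variable s : R.
Hypothesis s0 : 0 <= s.

Let bound b b' : R := ((Q b - s) ^+ 2 + (Q b' - s) ^+ 2) / 8 + `|C b b'|.

Let Q_ge0 b : 0 <= Q b.
Proof. by have := cos_ge0 b b 1 0; rewrite expr1n expr0n mul1r mul0r !mulr0 mul0r !addr0. Qed.

Let C_le b b' : 2 * C b b' <= Q b + Q b'.
Proof. by have := cos_ge0 b b' 1 (-1); rewrite sqrrN expr1n !mul1r mulrN1 mulNr subr_ge0. Qed.

Let C_ge b b' : - (2 * C b b') <= Q b + Q b'.
Proof. by have := cos_ge0 b b' 1 1; rewrite expr1n !mul1r mulr1 => q; rewrite -subr_ge0 opprK. Qed.

Let mean_cos1 b : \int[P]_w cos (random_phase b w) = expR (- (Q b / 2)).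
Proof.
have := mean_cos b b 1 0; rewrite expr1n expr0n mul1r mul0r !mulr0 mul0r !addr0 => <-.
by apply: eq_Rint => w; rewrite mul1r mul0r addr0.
Qed.

Let mean_cosD b b' : \int[P]_w cos (random_phase b w + random_phase b' w) =
  expR (- ((Q b + Q b' + 2 * C b b') / 2)).
Proof.
have := mean_cos b b' 1 1; rewrite expr1n !mul1r mulr1 => <-.
by apply: eq_Rint => w; rewrite !mul1r.
Qed.

Let mean_cosB b b' : \int[P]_w cos (random_phase b w - random_phase b' w) =
  expR (- ((Q b + Q b' - 2 * C b b') / 2)).
Proof.
have := mean_cos b b' 1 (-1); rewrite sqrrN expr1n !mul1r mulrN1 mulNr => <-.
by apply: eq_Rint => w; rewrite mul1r mulN1r.
Qed.

Lemma cos_correlation b b' : `|\int[P]_w ((cos (random_phase b w) - expR (- (s / 2))) *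
    (cos (random_phase b' w) - expR (- (s / 2))))| <= bound b b'.
Proof.
set k := expR _.
have bc b1 : bm (fun w => cos (random_phase b1 w)) by exact: (bm_cos (mphase b1)).
have bD : bm (fun w => cos (random_phase b w + random_phase b' w)).
  by apply: bm_cos; exact: (measurable_funD (mphase b) (mphase b')).
have bB : bm (fun w => cos (random_phase b w - random_phase b' w)).
  by apply: bm_cos; exact: (measurable_funB (mphase b) (mphase b')).
have bk : bm (fun _ : Omega => k ^+ 2) by exact: bm_cst.
have bk1 : bm (fun _ : Omega => k) by exact: bm_cst.
have bh2 : bm (fun _ : Omega => 2^-1 : R) by exact: bm_cst.
rewrite (eq_Rint P (g := fun w => ((cos (random_phase b w - random_phase b' w) +
    cos (random_phase b w + random_phase b' w)) * 2^-1 -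
    k * (cos (random_phase b w) + cos (random_phase b' w))) + k ^+ 2)); last first.
  by move=> w; rewrite cosB cosD; field.
have b1 := bmD bB bD; have b2 := bmM b1 bh2; have b3 := bmD (bc b) (bc b').
have b4 := bmM bk1 b3.
rewrite RintD//; last exact: bmB.
rewrite RintB// RintZr// RintZl// !RintD// Rint_cst mean_cosB mean_cosD !mean_cos1.
exact: (gaussian_cos_correlation (Q_ge0 b) (Q_ge0 b') s0 (C_le b b') (C_ge b b')).
Qed.

Lemma sin_correlation b b' : `|\int[P]_w (sin (random_phase b w) *
    sin (random_phase b' w))| <= bound b b'.
Proof.
have bD : bm (fun w => cos (random_phase b w + random_phase b' w)).
  by apply: bm_cos; exact: (measurable_funD (mphase b) (mphase b')).
have bB : bm (fun w => cos (random_phase b w - random_phase b' w)).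
  by apply: bm_cos; exact: (measurable_funB (mphase b) (mphase b')).
rewrite (eq_Rint P (g := fun w => (cos (random_phase b w - random_phase b' w) -
    cos (random_phase b w + random_phase b' w)) * 2^-1)); last first.
  by move=> w; rewrite cosB cosD; field.
rewrite RintZr; last exact: bmB.
rewrite RintB// mean_cosB mean_cosD.
apply: le_trans (gaussian_sin_correlation (C_le b b') (C_ge b b')) _.
by rewrite lerDr divr_ge0// addr_ge0 ?sqr_ge0.
Qed.

Variables (p K : R).
Hypotheses (p1 : 1 < p) (K0 : 0 < K).
Local Notation phi := (pw (e ^+ 2) (- p)).
Hypothesis gauss_le : forall s (y : 'rV[R]_n), 0 <= s ->
  \int[gauss_rV n s]_z `|h (y + z)| <= K * phi s.
Variables (g : R -> R).
Hypothesis gE : forall s, 0 <= s -> \int[gauss_rV n s]_z h z = g s.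
Hypothesis g_ge0 : forall s, 0 <= s -> 0 <= g s.
Hypothesis mg : measurable_fun setT (fun u : R => g `|u|).
Variable sig : R.
Hypothesis sE : s = sig * t.
Hypothesis gS : (\int[lebesgue_measure]_(u in `[0%R, +oo[) (g u)%:E =
  (e ^+ 2 * sig / 2)%:E)%E.
Local Notation ell := (ell (e ^+ 2) p t0).

(** The first quotient is a quarter of the constant of [phase_variance] and the second comes from
    [mean_cross], both after [mass = e ^ 2 / (p - 1)] has cancelled the powers of [e]. *)
Definition moment_const : R :=
  (128 * ((1 + 2 `^ p) * K ^+ 2) + 36 * K ^+ 2) / (4 * (p - 1) ^+ 2) + 2 * 2 `^ p * K / (p - 1).

Let bm_Q : bm Q.
Proof. by apply: bmM; [exact: bm_cst|exact: (bm_phase bh hB t0)]. Qed.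

Let bm_C : bm (fun z : OB * OB => C z.1 z.2).
Proof. by apply: bmM; [exact: bm_cst|exact: (bm_cross bh hB t0)]. Qed.

(** The variance part is of order [t ^ 2 * ell] and the cross part of order [t * ell], which
    explains the factor [1 + t]. *)
Lemma mean_bound :
  \int[(PB \x PB)%E]_z bound z.1 z.2 <= moment_const * (1 + t) * (t * ell).
Proof.
have e20 : 0 < e ^+ 2 by rewrite exprn_gt0.
have l0 : 0 <= ell by exact: ell_ge0.
have p10 : 0 < p - 1 by rewrite subr_gt0.
have bs : bm (fun b => (Q b - s) ^+ 2).
  by apply: bm_sqr; apply: bmB; [exact: bm_Q|exact: bm_cst].
have b1 : bm (fun z : OB * OB => (Q z.1 - s) ^+ 2) by exact: (bm_comp bs).
have b2 : bm (fun z : OB * OB => (Q z.2 - s) ^+ 2) by exact: (bm_comp bs).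
have b12 := bmD b1 b2.
have bn := bm_norm bm_C.
have bh8 : bm (fun _ : OB * OB => 8^-1 : R) by exact: bm_cst.
have b8 := bmM b12 bh8.
have E1 : \int[PB]_b (Q b - s) ^+ 2 <=
    (t / (p - 1)) ^+ 2 * ((128 * ((1 + 2 `^ p) * K ^+ 2) + 36 * K ^+ 2) * ell).
  rewrite (eq_Rint PB (g := fun b => (t / e ^+ 2) ^+ 2 * (t * phase b - e ^+ 2 * sig) ^+ 2)); last first.
    by move=> b; rewrite /Q sE; field; rewrite gt_eqF.
  rewrite RintZl; last first.
    apply: bm_sqr; apply: bmB; last exact: bm_cst.
    by apply: bmM; [exact: bm_cst|exact: (bm_phase bh hB t0)].
  have pv := phase_variance bh hN e20 p1 K0 gauss_le hB t0 gE g_ge0 mg gS.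
  apply: le_trans (ler_wpM2l (sqr_ge0 _) pv) _.
  rewrite le_eqVlt; apply/orP; left; apply/eqP; rewrite /mass; field.
  by rewrite !gt_eqF.
have E2 : \int[pairp PB PB]_z `|C z.1 z.2| <= t / (p - 1) * (2 * 2 `^ p * K * ell).
  rewrite (eq_Rint (pairp PB PB) (g := fun z : OB * OB => (t / e) ^+ 2 * `|cross z.1 z.2|)); last first.
    by move=> z; rewrite /C normrM (ger0_norm (sqr_ge0 _)).
  rewrite (RintZl (pairp PB PB)); last by apply: bm_norm; exact: (bm_cross bh hB t0).
  apply: le_trans (ler_wpM2l (sqr_ge0 _) (mean_cross bh hN e20 p1 K0 gauss_le hB t0)) _.
  rewrite le_eqVlt; apply/orP; left; apply/eqP; rewrite /mass; field.
  by rewrite !gt_eqF.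
rewrite (_ : (\int[(PB \x PB)%E]_z bound z.1 z.2)%R =
  (\int[PB]_b (Q b - s) ^+ 2) / 4 + \int[pairp PB PB]_z `|C z.1 z.2|); last first.
  apply: (etrans (RintD (pairp PB PB) b8 bn)); congr (_ + _).
  apply: (etrans (RintZr (pairp PB PB) 8^-1 b12)).
  have e12 := RintD (pairp PB PB) b1 b2.
  rewrite (Rint_prod_fst PB PB bs) (Rint_prod_snd PB PB bs) in e12.
  rewrite e12; move: (\int[PB]_b _)%R => u; by field.
have c1 : 0 <= (128 * ((1 + 2 `^ p) * K ^+ 2) + 36 * K ^+ 2) / (4 * (p - 1) ^+ 2).
  have q0 : 0 <= (1 + 2 `^ p) * K ^+ 2 by rewrite mulr_ge0 ?sqr_ge0// addr_ge0 ?powR_ge0.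
  apply: divr_ge0; last by apply: mulr_ge0 => //; exact: sqr_ge0.
  by apply: addr_ge0; apply: mulr_ge0 => //; exact: sqr_ge0.
have c2 : 0 <= 2 * 2 `^ p * K / (p - 1).
  apply: divr_ge0; last exact: ltW.
  by apply: mulr_ge0; [apply: mulr_ge0 => //; exact: powR_ge0|exact: ltW].
have hh := lerD (ler_wpM2r (_ : 0 <= 4^-1) E1) E2.
apply: le_trans (hh _) _; first by rewrite invr_ge0.
rewrite /moment_const; move: c1 c2.
set a1 := _ / (4 * _); set a2 := _ / (p - 1) => c1 c2.
rewrite (_ : _ + _ = (a1 * t + a2) * (t * ell)); last by rewrite /a1 /a2; field; rewrite gt_eqF.
rewrite ler_wpM2r ?mulr_ge0 ?(ltW t0)//; have := ltW t0; nra.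
Qed.

(** The weight [G] depends on the path alone, so it leaves the expectation over [P] and costs
    [M ^ 2]. *)
Lemma second_moment_bound (k : R -> R) (G : OB -> R) (M : R) : bm k -> bm G ->
  (forall b, `|G b| <= M) ->
  (forall b b', `|\int[P]_w (k (random_phase b w) * k (random_phase b' w))| <= bound b b') ->
  \int[P]_w (\int[PB]_b (G b * k (random_phase b w))) ^+ 2 <=
  M ^+ 2 * (moment_const * (1 + t) * (t * ell)).
Proof.
move=> bk bG GM kb.
have bF : bm (fun z : OB * Omega => G z.1 * k (random_phase z.1 z.2)).
  apply: bmM; first exact: (bm_comp bG).
  exact: (bm_comp bk measurable_random_phase).
have -> := second_moment PB P bF.
have bB : bm (fun z : OB * OB => bound z.1 z.2).
  have bs : bm (fun b => (Q b - s) ^+ 2).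
    by apply: bm_sqr; apply: bmB; [exact: bm_Q|exact: bm_cst].
  apply: bmD; last exact: bm_norm bm_C.
  apply: bmM; last exact: bm_cst.
  by apply: bmD; [exact: (bm_comp bs measurable_fst)|exact: (bm_comp bs measurable_snd)].
apply: le_trans (ler_wpM2l (sqr_ge0 M) mean_bound).
rewrite -(RintZl (pairp PB PB))//.
apply: (le_Rint (pairp PB PB)).
- have bFF : bm (fun z : (OB * OB) * Omega =>
      (G z.1.1 * k (random_phase z.1.1 z.2)) * (G z.1.2 * k (random_phase z.1.2 z.2))).
    apply: bmM.
      apply: (bm_comp bF (g := fun z : (OB * OB) * Omega => (z.1.1, z.2))).
      by apply: measurable_fun_pair => //; apply: measurableT_comp.
    apply: (bm_comp bF (g := fun z : (OB * OB) * Omega => (z.1.2, z.2))).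
    by apply: measurable_fun_pair => //; apply: measurableT_comp.
  exact: (bm_Rint (pairp PB PB) P bFF).
- by apply: bmM => //; exact: bm_cst.
case=> b b' /=; apply: le_trans (ler_norm _) _.
rewrite (eq_Rint P (g := fun w => (G b * G b') * (k (random_phase b w) * k (random_phase b' w)))); last first.
  by move=> w; ring.
rewrite RintZl; last first.
  by apply: bmM; apply: (bm_comp bk); exact: mphase.
rewrite normrM; apply: ler_pM => //; rewrite normrM expr2; exact: ler_pM.
Qed.

End random_phase.

Lemma rate_high_gt0 (R : realType) (beta e : R) : 0 < e <= 1 / 2 -> 0 < rate_high beta e.
Proof.
move=> /andP[e0 e1]; rewrite /rate_high; case: ifP => _; first exact: powR_gt0.
case: ifP => _ //; rewrite mulr_gt0// sqrtr_gt0 normr_gt0 lt_eqF// ln_lt0// e0/=.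
by apply: le_lt_trans e1 _; rewrite ltr_pdivrMr// mul1r ltr1n.
Qed.

Lemma sigma2_ge0 (R : realType) n (spec : 'rV[R]_n -> R) : (forall xi, 0 <= spec xi) ->
  0 <= sigma2 spec.
Proof.
move=> h; rewrite /sigma2 mulr_ge0//.
  by rewrite divr_ge0// exprn_ge0// mulr_ge0// pi_ge0.
by apply: Rintegral_ge0 => xi _; rewrite divr_ge0 ?sqr_ge0.
Qed.

Lemma normc_le (R : realType) (a b : R) : Normc.normc (a +i* b)%C <= `|a| + `|b|.
Proof.
rewrite /= -[leRHS](ger0_norm (addr_ge0 (normr_ge0 a) (normr_ge0 b))) -sqrtr_sqr.
apply: ler_wsqrtr; rewrite -(real_normK (num_real a)) -(real_normK (num_real b)).
have := normr_ge0 a; have := normr_ge0 b; nra.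
Qed.

(** * The error estimate for a fixed medium and Brownian motion *)

Section homogenization.
Context (R : realType) (n : nat) (beta : R) (f : 'rV[R]_n -> R[i]) (cov spec : 'rV[R]_n -> R).
Hypothesis hbeta : 2 < beta < n%:R.
Hypothesis hspec : power_spectrum cov spec.
Hypothesis hcov : asymp_infty cov (fun x => enorm x `^ (- beta)).
Variables (M K C2 : R).
Local Notation f1 := (fun z => complex.Re (f z)).
Local Notation f2 := (fun z => complex.Im (f z)).
Hypotheses (M0 : 0 < M) (K0 : 0 < K) (C20 : 0 < C2).
Hypotheses (mf1 : measurable_fun setT f1) (mf2 : measurable_fun setT f2).
Hypotheses (f1M : forall z, `|f1 z| <= M) (f2M : forall z, `|f2 z| <= M).
Hypothesis gauss_le : forall e s (y : 'rV[R]_n), 0 < e -> 0 <= s ->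
  \int[gauss_rV n s]_z `|cov (e^-1 *: (y + z))| <= K * pw (e ^+ 2) (- (beta / 2)) s.
Hypothesis chi_le : forall (e t : R) (t0 : 0 < t), 0 < e <= 1 / 2 ->
  t * ell (e ^+ 2) (beta / 2) t0 <= C2 * (1 + t) * rate_high beta e ^+ 2.

Context (dO : measure_display) (Omega : measurableType dO).
Variables (P : probability Omega R) (tau : 'rV[R]_n -> Omega -> Omega) (VV : Omega -> R).
Hypothesis htau : ergodic_action P tau.
Hypothesis VV2 : VV \in Lfun P 2%:E.
Hypothesis VV0 : ('E_P[VV] = 0)%E.
Local Notation V := (stationary_field tau VV).
Hypothesis hG : gaussian_field P V.
Hypothesis hV : forall x, ('E_P[(fun w => V 0 w * V x w)%R] = (cov x)%:E)%E.
Context (dB : measure_display) (OB : measurableType dB).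
Variables (PB : probability OB R) (B : R -> OB -> 'rV[R]_n).
Hypothesis hB : standard_brownian PB B.
Variables (t e : R) (x : 'rV[R]_n).
Hypotheses (t0 : 0 < t) (he : 0 < e <= 1 / 2).

Local Notation s := (sigma2 spec * t).
Local Notation c := (expR (- (s / 2))).
Local Notation X := (random_phase V B t e x).

Let e0 : 0 < e.
Proof. by have /andP[] := he. Qed.

Let p1 : 1 < beta / 2.
Proof. by rewrite ltr_pdivlMr// mul1r; have /andP[] := hbeta. Qed.

(** Adding 1 makes the constant positive and lets its square dominate [moment_const * C2], in place
    of a square root. *)
Definition error_const : R := 1 + moment_const (beta / 2) K * C2.

Let mm0 : 0 <= moment_const (beta / 2) K.
Proof.
have P0 : 0 <= 2 `^ (beta / 2) :> R by exact: powR_ge0.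
have q0 : 0 <= (1 + 2 `^ (beta / 2)) * K ^+ 2 by rewrite mulr_ge0 ?sqr_ge0// addr_ge0.
have q1 : 0 < beta / 2 - 1 by rewrite subr_gt0 p1.
rewrite /moment_const; apply: addr_ge0.
  apply: divr_ge0; last by apply: mulr_ge0 => //; exact: sqr_ge0.
  by apply: addr_ge0; apply: mulr_ge0 => //; exact: sqr_ge0.
apply: divr_ge0; last exact: ltW.
by apply: mulr_ge0; [exact: mulr_ge0|exact: ltW].
Qed.

Let err := M * error_const * (1 + t) * rate_high beta e.

Let err_gt0 : 0 < err.
Proof.
rewrite /err; apply: mulr_gt0; last exact: rate_high_gt0.
apply: mulr_gt0; last exact: addr_gt0.
apply: mulr_gt0 => //; rewrite /error_const ltr_pwDl//.
by apply: mulr_ge0; [exact: mm0|exact: ltW].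
Qed.

Let mV := measurable_stationary_field htau VV2.
Let V2 := stationary_field_sqr htau VV2.

Let mX : measurable_fun setT (fun z : OB * Omega => X z.1 z.2).
Proof. exact: (measurable_random_phase mV hB e x t0). Qed.

Let bm_D (k : R -> R) (G : OB -> R) : bm k -> bm G ->
  bm (fun w => \int[PB]_b (G b * k (X b w))).
Proof.
move=> bk bG; apply: (bm_Rint2 PB P (f := fun z => G z.1 * k (X z.1 z.2))).
by apply: bmM; [exact: (bm_comp bG)|exact: (bm_comp bk mX)].
Qed.

Let mean_D (k : R -> R) (G : OB -> R) : (k = (fun u => cos u - c) \/ k = (fun u => sin u)) ->
  bm G -> (forall b, `|G b| <= M) ->
  \int[P]_w `|\int[PB]_b (G b * k (X b w))| <= err.
Proof.
move=> hk bG GM.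
have bk : bm k.
  case: hk => ->; last by apply: bm_sin.
  by apply: bmB; [exact: bm_cos|exact: bm_cst].
apply: mean_norm_le_sqr; [exact: bm_D|exact: err_gt0|].
have Vmean := stationary_field_mean htau VV2 VV0.
have Vcov := stationary_field_cov htau VV2 hV.
have bcov := bm_cov hspec.
have covN := cov_even hspec.
have s0 : 0 <= s by rewrite mulr_ge0 ?(ltW t0)//; apply: sigma2_ge0; exact: spec_ge0 hspec.
have ge := fun s y => gauss_le (e := e) (s := s) y e0.
(* The abstract mean covariance [g] becomes [gcov] and [sig] becomes [sigma2 spec]; [integral_gcov]
   is the required link between them. *)
have hkb := second_moment_bound (P := P) mV bcov covN hB (x := x) (t0 := t0) e0 (s := s) p1 K0 ge
  (fun s => Rint_gauss_cov hspec e (s := s)) (fun s _ => gcov_ge0 hspec e s)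
  (measurable_gcov_norm hspec e) erefl (integral_gcov hspec hbeta e0 K0 ge) bk bG GM.
apply: le_trans (hkb _) _.
  case: hk => ->.
    exact: (cos_correlation mV V2 Vmean Vcov hG bcov (cov_cvg hspec) covN hB e x t0 s0).
  exact: (sin_correlation mV V2 Vmean Vcov hG bcov (cov_cvg hspec) covN hB e x t0 s).
have ch := chi_le t0 he.
apply: (@le_trans _ _ (M ^+ 2 * (moment_const (beta / 2) K * (1 + t) *
    (C2 * (1 + t) * rate_high beta e ^+ 2)))).
  apply: ler_wpM2l; first exact: sqr_ge0.
  by apply: ler_wpM2l => //; apply: mulr_ge0; [exact: mm0|apply: ltW; exact: addr_gt0].
rewrite [leLHS](_ : _ = M ^+ 2 * ((moment_const (beta / 2) K * C2) *
  ((1 + t) ^+ 2 * rate_high beta e ^+ 2))); last by ring.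
rewrite /err [leRHS](_ : _ = M ^+ 2 * (error_const ^+ 2 *
  ((1 + t) ^+ 2 * rate_high beta e ^+ 2))); last by ring.
apply: ler_wpM2l; first exact: sqr_ge0.
apply: ler_wpM2r; first by apply: mulr_ge0; exact: sqr_ge0.
rewrite /error_const.
have : 0 <= moment_const (beta / 2) K * C2 by rewrite mulr_ge0 ?mm0// ltW.
move: (moment_const _ _ * C2) => u; nra.
Qed.

Lemma mean_error_le :
  ('E_P[(fun w => Normc.normc
      (u_eps PB B f (fun y => V y w) e t x - u_hom PB B f (sigma2 spec) t x))%R] <=
   ((1 + t) * (4 * M * error_const) * rate_high beta e)%:E)%E.
Proof.
pose G1 b := f1 (x + B t b); pose G2 b := f2 (x + B t b).
have mBt : measurable_fun setT (fun b => x + B t b).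
  by apply: measurable_rVD => //; apply: (brownian_measurable hB); exact: ltW.
have bG1 : bm G1 by split; [exact: (measurableT_comp mf1 mBt)|exists M => b; exact: f1M].
have bG2 : bm G2 by split; [exact: (measurableT_comp mf2 mBt)|exists M => b; exact: f2M].
pose kc (u : R) := cos u - c; pose ks (u : R) := sin u.
have bkc : bm kc by apply: bmB; [exact: bm_cos|exact: bm_cst].
have bks : bm ks by exact: bm_sin.
pose D (k : R -> R) (G : OB -> R) w := \int[PB]_b (G b * k (X b w)).
have D_le k G : (k = kc \/ k = ks) -> bm G -> (forall b, `|G b| <= M) ->
    \int[P]_w `|D k G w| <= err by exact: mean_D.
have bD k G : bm k -> bm G -> bm (fun w => `|D k G w|) by move=> bk bG; apply: bm_norm; exact: bm_D.
have mXw w : measurable_fun setT (X ^~ w).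
  by apply: (measurableT_comp mX (g := fun b : OB => (b, w))); exact: measurable_fun_pair.
(* Subtracting [u_hom] replaces [cos] by [cos - c] and leaves the sines alone, so four real averages
   remain; this is the factor 4 in the bound. *)
have uE w : u_eps PB B f (fun y => V y w) e t x - u_hom PB B f (sigma2 spec) t x =
    ((D kc G1 w - D ks G2 w) +i* (D ks G1 w + D kc G2 w))%C.
  have bc : bm (fun b => cos (X b w)) by exact: bm_cos.
  have bs : bm (fun b => sin (X b w)) by exact: bm_sin.
  have bcc : bm (fun _ : OB => c) by exact: bm_cst.
  have kcE G : bm G -> D kc G w = \int[PB]_b (G b * cos (X b w)) - c * \int[PB]_b G b.
    move=> bG; rewrite /D -RintZl// -RintB; [|exact: bmM|exact: bmM].
    by apply: eq_Rint => b; rewrite /kc; ring.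
  rewrite !kcE// /D /ks.
  have -> : u_hom PB B f (sigma2 spec) t x =
      ((c * \int[PB]_b G1 b) +i* (c * \int[PB]_b G2 b))%C.
    rewrite /u_hom /integralC (_ : - sigma2 spec * t / 2 = - (s / 2)); last by rewrite !mulNr.
    by simpc.
  have -> : u_eps PB B f (fun y => V y w) e t x =
      ((\int[PB]_b (G1 b * cos (X b w)) - \int[PB]_b (G2 b * sin (X b w))) +i*
       (\int[PB]_b (G1 b * sin (X b w)) + \int[PB]_b (G2 b * cos (X b w))))%C.
    rewrite -RintB; [|exact: bmM|exact: bmM].
    rewrite -RintD; [|exact: bmM|exact: bmM].
    rewrite /u_eps /integralC; congr (_ +i* _)%C; apply: eq_Rint => b;
      by rewrite /expi /G1 /G2; case: (f _).
  by simpc; congr (_ +i* _)%C; ring.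
rewrite unlock.
apply: (@le_trans _ _ (\int[P]_w (`|D kc G1 w| + `|D ks G2 w| +
    (`|D ks G1 w| + `|D kc G2 w|))%:E)%E).
  apply: ge0_le_integral => //.
  - by move=> w _; rewrite uE lee_fin sqrtr_ge0.
  - under eq_fun do rewrite uE.
    apply/measurable_EFinP => /=.
    apply: (measurableT_comp (f := @Num.sqrt R)).
      exact: continuous_measurable_fun (@sqrt_continuous R).
    have m2 k G : bm k -> bm G -> measurable_fun setT (D k G).
      by move=> bk bG; exact: bm_measurable (bm_D bk bG).
    apply: measurable_funD; apply: measurable_funX.
      by apply: measurable_funB; exact: m2.
    by apply: measurable_funD; exact: m2.
  - apply/measurable_EFinP.
    by apply: measurable_funD; apply: measurable_funD; apply: bm_measurable; exact: bD.
  - move=> w _; rewrite uE lee_fin; apply: le_trans (normc_le _ _) _.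
    by apply: lerD; [exact: ler_normB|exact: ler_normD].
have b1 := bmD (bD _ _ bkc bG1) (bD _ _ bks bG2).
have b2 := bmD (bD _ _ bks bG1) (bD _ _ bkc bG2).
rewrite -(EFin_Rint (bm_integrable P (bmD b1 b2))) lee_fin.
rewrite RintD// !RintD; try exact: bD.
have d1 := D_le kc G1 (or_introl erefl) bG1 (fun b => f1M _).
have d2 := D_le ks G2 (or_intror erefl) bG2 (fun b => f2M _).
have d3 := D_le ks G1 (or_intror erefl) bG1 (fun b => f1M _).
have d4 := D_le kc G2 (or_introl erefl) bG2 (fun b => f2M _).
apply: le_trans (lerD (lerD d1 d2) (lerD d3 d4)) _.
by rewrite /err le_eqVlt; apply/orP; left; apply/eqP; ring.
Qed.

End homogenization.

Local Open Scope complex_scope.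

Theorem theorem2p9 (R : realType) (n : nat) (hn : (3 <= n)%N)
    (beta : R) (hbeta : 2 < beta < n%:R)
    (f : 'rV[R]_n -> R[i]) (hf : Cc_infty f)
    (cov spec : 'rV[R]_n -> R) (hspec : power_spectrum cov spec)
    (hcov : asymp_infty cov (fun x => enorm x `^ (- beta))) :
  (\int[lebesgue_rV R n]_xi (spec xi / enorm xi ^+ 2)%:E < +oo)%E /\
  exists C : R,
    forall (dO : measure_display) (Omega : measurableType dO)
      (P : probability Omega R) (tau : 'rV[R]_n -> Omega -> Omega)
      (VV : Omega -> R),
    ergodic_action P tau ->
    strongly_continuous_L2 P tau ->
    VV \in Lfun P 2%:E ->
    ('E_P[VV] = 0)%E ->
    gaussian_field P (stationary_field tau VV) ->
    (forall x, 'E_P[(fun w => stationary_field tau VV 0 w *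
                              stationary_field tau VV x w)%R] = (cov x)%:E)%E ->
    forall (dB : measure_display) (OmegaB : measurableType dB)
      (PB : probability OmegaB R) (B : R -> OmegaB -> 'rV[R]_n),
    standard_brownian PB B ->
    forall (t : R) (x : 'rV[R]_n) (eps : R),
    0 < t -> 0 < eps <= 1 / 2 ->
    let error := 'E_P[(fun w => Normc.normc
      (u_eps PB B f (fun y => stationary_field tau VV y w) eps t x -
       u_hom PB B f (sigma2 spec) t x))%R]%E in
    (n = 3%N \/ n = 4%N -> (error <= ((1 + t) * C * rate_low beta eps)%:E)%E) /\
    ((4 < n)%N -> (error <= ((1 + t) * C * rate_high beta eps)%:E)%E).
Proof.
have /andP[beta2 betan] := hbeta.
have beta0 : 0 < beta by apply: lt_trans beta2.
have n0 : (0 < n)%N by apply: leq_trans hn.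
have [K [K0 gauss_le]] := gauss_cov_le hspec n0 beta0 hcov betan.
have [C2 [C20 chi_le]] := mean_chi_rate beta2.
have [[mf1 [M1 f1M]] [mf2 [M2 f2M]]] := Cc_infty_bm hf.
split.
  (* The integral does not involve [e], so the decay bound is used at [e = 1]. *)
  exact: (integral_spec_over_sqr_finite hspec hbeta ltr01 K0 (fun s y => gauss_le 1 s y ltr01)).
set M := 1 + `|M1| + `|M2|.
have M0 : 0 < M by rewrite /M -addrA ltr_pwDl// addr_ge0.
have f1M' z : `|complex.Re (f z)| <= M.
  by apply: le_trans (f1M z) _; rewrite /M; have := ler_norm M1; have := normr_ge0 M2; lra.
have f2M' z : `|complex.Im (f z)| <= M.
  by apply: le_trans (f2M z) _; rewrite /M; have := ler_norm M2; have := normr_ge0 M1; lra.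
exists (4 * M * error_const beta K C2).
move=> dO Omega P tau VV htau _ VV2 VV0 hG hV dB OB PB B hB t x eps t0 he error.
have err : (error <= ((1 + t) * (4 * M * error_const beta K C2) * rate_high beta eps)%:E)%E.
  exact: (mean_error_le hbeta hspec M0 K0 C20 mf1 mf2 f1M' f2M' gauss_le chi_le htau VV2 VV0
    hG hV hB x t0 he).
(* In dimensions 3 and 4, [beta < n <= 4] selects the first branch of [rate_high], which is
   [rate_low]. *)
split => // n34; rewrite (_ : rate_low beta eps = rate_high beta eps)//.
rewrite /rate_high ifT//; apply: lt_le_trans betan _.
by rewrite (ler_nat R n 4); case: n34 => ->.
Qed.
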